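(* Consider, for $\alpha,\varkappa\ge0$, the system of two identical coupled equations $$u_{tt}+\nu Au+Du_t+\alpha K(u_t-v_t)+\varkappa K(u-v)+B(u)=0,$$ $$v_{tt}+\nu Av+Dv_t+\alpha K(v_t-u_t)+\varkappa K(v-u)+B(v)=0.$$ Assume, in addition to the standing assumptions of the context, that: (1) $D$ is bounded from $H^{1/2}$ into $H$, and there exist $c_0>0$ and $\bar\alpha\ge0$ such that $$(Du,u)+(Dv,v)+\bar\alpha(K(u-v),u-v)\ge c_0(\|u\|^2+\|v\|^2),\quad u,v\in H^{1/2};$$ (2) there exist $\eta<1$ and $\delta,C>0$ such that $$\delta\,(\Pi_{0}(u)+\Pi_{0}(v))-(B(u),u)-(B(v),v)\le\eta\,\nu\left(\|A^{1/2}u\|^2+\|A^{1/2}v\|^2\right)+C,\quad u,v\in H^{1/2};$$ (3) either there is $\delta>0$ such that for every $\varrho>0$ there exists $L(\varrho)$ with $\|B(u)-B(v)\|\le L(\varrho)\|u-v\|_{1/2-\delta}$ for all $u,v\in H^{1/2}$ with $\|u\|_{1/2},\|v\|_{1/2}\le\varrho$; or else $\Pi$ is continuous on $H^{1/2-\delta}$ for some $\delta>0$ and the mapping $u\mapsto A^{-l}B(u)$ is continuous from $H^{1/2-\delta}$ into $H^{-l}$ for some $\delta,l>0$; (4) one of the following holds: (4a) $\Pi:H^{1/2}\to\mathbb{R}$ is a Fréchet $C^3$-mapping and there is $\sigma<1/2$ such that for every $\rho>0$ there is $C_\rho>0$ with $|\langle\Pi^{(2)}(u);v,v\rangle|\le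 C_\rho\|A^{\sigma}v\|^2$ for $v\in H^{1/2}$ and $|\langle\Pi^{(3)}(u);v_1,v_2,v_3\rangle|\le C_\rho\|A^{1/2}v_1\|\|A^{1/2}v_2\|\|v_3\|$ for $v_1,v_2,v_3\in H^{1/2}$, for all $u\in H^{1/2}$ with $\|A^{1/2}u\|\le\rho$ (here $\langle\Pi^{(k)}(u);v_1,\dots,v_k\rangle$ is the value of the $k$-th Fréchet derivative at $u$ on $v_1,\dots,v_k$); (4b) there is $\sigma_0<1/2$ such that for every $\varrho>0$ there is $L(\varrho)$ with $\|B(u_1)-B(u_2)\|\le L(\varrho)\|A^{\sigma_0}(u_1-u_2)\|$ for all $u_1,u_2\in H^{1/2}$ with $\|A^{1/2}u_j\|\le\varrho$, $j=1,2$. Assume that $\alpha\in[\bar\alpha,\alpha_*]$ for some fixed $\alpha_*$, and let $$s_\varkappa=\inf\{\nu(Aw,w)+\varkappa(Kw,w):\ w\in H^{1/2},\ \|w\|=1\}.$$ Then there exist $s_*=s_*(\bar\alpha,\alpha_* )$ and $\omega>0$ such that under the condition $s_\varkappa\ge s_*$ the property of asymptotic exponential synchronization holds, i.e. $$\lim_{t\to\infty}\left\{e^{\omega t}\left[\|u_t(t)-v_t(t)\|^2+\|A^{1/2}(u(t)-v(t))\|^2\right]\right\}=0$$ for every solution $U(t)=(u(t);v(t))$ to the system. In this case $\mathfrak{A}^{\alpha,\varkappa}\equiv\widetilde{\mathfrak{A}}$ for all $\varkappa$ such that $s_\varkappa\ge s_*$, where $\mathfrak{A}^{\alpha,\varkappa}$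 is the global attractor of the dynamical system generated by the coupled system in $\mathcal{H}$, $\widetilde{\mathfrak{A}}=\{(u_0;u_0;u_1;u_1):(u_0;u_1)\in\mathfrak{A}\}$, and $\mathfrak{A}$ is the global attractor of the dynamical system generated in $H^{1/2}\times H$ by $w_{tt}+\nu Aw+Dw_t+B(w)=0$, $w(0)=w_0$, $w_t(0)=w_1$.
   Context: Spaces. $H$ is a separable Hilbert space with norm $\|\cdot\|$ and inner product $(\cdot,\cdot)$; $A$ is a self-adjoint positive operator with dense domain in $H$ and compact resolvent. For $s>0$, $H^s$ is the domain of $A^s$ with norm $\|\cdot\|_s=\|A^s\cdot\|$, and $H^{-s}$ is the completion of $H$ in the norm $\|A^{-s}\cdot\|$; $H^0=H$; $(\cdot,\cdot)$ also denotes the duality between $H^s$ and $H^{-s}$ (so $(Aw,w)=\|A^{1/2}w\|^2$ for $w\in H^{1/2}$). $\bar H^s=H^s\times H^s$, $\bar H=H\times H$. Standing assumptions. $\nu>0$. $K$ is a strictly positive (symmetric, $(Ku,u)\ge a\|u\|^2$ with $a>0$) operator in $H$ with domain containing $H^{1/2}$. The linear operator $D:H^{1/2}\to H$ is nonnegative (symmetric form, $(Du,u)\ge0$). The operator $B:H^{1/2}\to H$ is locally Lipschitz: for every $\varrho>0$ there is $L(\varrho)$ with $\|B(u)-B(v)\|\le L(\varrho)\|u-v\|_{1/2}$ whenever $\|u\|_{1/2},\|v\|_{1/2}\le\varrho$. It is potential: $B(u)=\Pi'(u)$ for a Fréchet differentiable functional $\Pi:H^{1/2}\to\mathbb{R}$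 (i.e. $\|w\|_{1/2}^{-1}[\Pi(u+w)-\Pi(u)-(B(u),w)]\to0$ as $\|w\|_{1/2}\to0$), and $\Pi=\Pi_{0}+\Pi_{1}$, where $\Pi_{0}\ge0$ is locally bounded on $H^{1/2}$ and for every $\eta>0$ there is $C_\eta$ with $|\Pi_{1}(u)|\le\eta[\|A^{1/2}u\|^2+\Pi_{0}(u)]+C_\eta$ for all $u\in H^{1/2}$. Solutions. Write the coupled system as $U_{tt}+\mathcal{A}U+\mathcal{D}U_t+\varkappa\mathcal{K}U+\mathcal{B}(U)=0$ with $U=(u;v)$, $\mathcal{A}U=\nu(Au;Av)$, $\mathcal{K}U=(K(u-v);K(v-u))$, $\mathcal{D}U=(Du;Dv)+\alpha\mathcal{K}U$, $\mathcal{B}(U)=(B(u);B(v))$. A function $U\in C([0,T];\bar H^{1/2})\cap C^1([0,T];\bar H)$ with $U(0)=U_0$, $U_t(0)=U_1$ is a strong solution on $[0,T]$ if for any $0<a<b<T$ both $U:[a,b]\to\bar H^{1/2}$ and $U_t:[a,b]\to\bar H$ are continuous with derivative in $L_1(a,b;\bar H^{1/2})$, resp. $L_1(a,b;\bar H)$, $\mathcal{A}U(t)+\mathcal{D}U_t(t)\in\bar H$ for a.a. $t$, and the equation holds in $\bar H$ for a.a. $t$. It is a generalized solution if there are strong solutions $U_n$ with $\max_{[0,T]}\{\|\partial_tU-\partial_tU_n\|+\|\mathcal{A}^{1/2}(U-U_n)\|\}\to0$. ''Solution'' means generalized solution. For every $(U_0;U_1)\in\mathcal{H}:=\bar H^{1/2}\times\bar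 H$ there is a unique generalized solution on every $[0,T]$, and $S_t(U_0;U_1)=(U(t);U_t(t))$ defines the dynamical system on $\mathcal{H}$ (depending on $(\alpha;\varkappa)$). The dynamical system of the single equation for $w$ in $H^{1/2}\times H$ is defined in the same way, $(w_0;w_1)\mapsto(w(t);w_t(t))$. A global attractor of a dynamical system $(X,S_t)$ is a bounded closed set $\mathfrak{A}\subset X$ with $S_t\mathfrak{A}=\mathfrak{A}$ for all $t\ge0$ and $\lim_{t\to\infty}\sup\{\mathrm{dist}(S_ty,\mathfrak{A}):y\in B\}=0$ for any bounded $B\subset X$. Under the hypotheses of the theorem both dynamical systems possess compact global attractors. *)

(* Defs.v *)
From HB Require Import structures.
From mathcomp Require Import all_boot all_order all_algebra.
From mathcomp Require Import sesquilinear.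
From mathcomp Require Import all_classical all_reals all_analysis.

Set Implicit Arguments.
Unset Strict Implicit.
Unset Printing Implicit Defensive.

Import Order.TTheory GRing.Theory Num.Theory numFieldNormedType.Exports.
Local Open Scope classical_set_scope.
Local Open Scope ring_scope.

(* Unbounded operators are pairs (dom, T) with T : H -> H a total function whose
   values outside dom are irrelevant. *)
Section LinearOn.
Context {R : realType} {H : lmodType R}.

Definition lin_subspace (V : set H) : Prop :=
  V 0 /\ forall (a : R) x y, V x -> V y -> V (a *: x + y).

Definition linear_on (V : set H) (T : H -> H) : Prop :=
  forall (a : R) x y, V x -> V y -> T (a *: x + y) = a *: T x + T y.

Definition symmetric_on (ip : H -> H -> R) (V : set H) (T : H -> H) : Prop :=
  forall x y, V x -> V y -> ip (T x) y = ip x (T y).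

End LinearOn.

Section Operators.
Context {R : realType} {H : completeNormedModType R}.
Variable ip : H -> H -> R.

Definition separable_space : Prop := exists2 S : set H, countable S & dense S.

(* The second component says that (dom, T) coincides with its adjoint: x belongs
   to the domain of the adjoint, with value f, iff (Ty, x) = (y, f) on dom. *)
Definition self_adjoint (dom : set H) (T : H -> H) : Prop :=
  [/\ lin_subspace dom, linear_on dom T, dense dom &
      forall x f, (dom x /\ T x = f) <-> (forall y, dom y -> ip (T y) x = ip y f)].

Definition positive_op (dom : set H) (T : H -> H) : Prop :=
  forall x, dom x -> x != 0 -> 0 < ip (T x) x.

Definition compact_resolvent (dom : set H) (T : H -> H) : Prop :=
  exists (l : R) (G : H -> H),
    [/\ forall x, dom (G x) /\ T (G x) - l *: G x = x,
        forall x, dom x -> G (T x - l *: x) = x &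
        compact (closure (G @` [set x | `|x| <= 1]))].

End Operators.

Section Scale.
Context {R : realType} {H : completeNormedModType R}.
Variables (ip : H -> H -> R) (domA : set H) (A : H -> H).

(* w = A^s u, s any real: by compactness of the resolvent the eigenvectors of A
   are total in H, and A^s acts on the eigenfunction expansion of u by
   multiplying the coefficient along each eigenvector of eigenvalue l by l^s. *)
Definition frac_pow_graph (s : R) (u w : H) : Prop :=
  forall (l : R) (e : H), domA e -> A e = l *: e -> ip w e = l `^ s * ip u e.

Definition frac_pow_dom (s : R) : set H := [set u | exists w, frac_pow_graph s u w].

Definition frac_pow (s : R) (u : H) : H := xget 0 [set w | frac_pow_graph s u w].

(* For s < 0 this is the norm of H^s on the dense subspace H of H^s. *)
Definition hnorm (s : R) (u : H) : R := `|frac_pow s u|.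

Definition Hhalf : set H := frac_pow_dom 2^-1.

(* nu A u + d = f, an identity in H^{-1/2} between u in H^{1/2} and d, f in H,
   read through the duality between H^{1/2} and H^{-1/2}. *)
Definition elliptic_eq (nu : R) (u d f : H) : Prop :=
  forall phi, Hhalf phi ->
    nu * ip (frac_pow 2^-1 u) (frac_pow 2^-1 phi) + ip d phi = ip f phi.

(* s_kappa, with (Aw, w) = ||A^{1/2} w||^2. *)
Definition form_bottom (nu : R) (K : H -> H) (kappa : R) : R :=
  inf [set nu * hnorm 2^-1 w ^+ 2 + kappa * ip (K w) w
      | w in [set w | Hhalf w /\ `|w| = 1]].

End Scale.

Section Nonlinearity.
Context {R : realType} {H : completeNormedModType R}.
Variables (ip : H -> H -> R) (domA : set H) (A : H -> H).

Local Notation V := (Hhalf ip domA A).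
Local Notation hn := (hnorm ip domA A).

(* ||B(u) - B(v)|| <= L(rho) ||u - v||_s on balls of H^{1/2} *)
Definition lipschitz_on_balls (s : R) (B : H -> H) : Prop :=
  forall rho : R, 0 < rho -> exists L : R, forall u v, V u -> V v ->
    hn 2^-1 u <= rho -> hn 2^-1 v <= rho -> `|B u - B v| <= L * hn s (u - v).

Definition frechet_potential (B : H -> H) (Pi : H -> R) : Prop :=
  forall u, V u -> forall e : R, 0 < e -> exists2 d : R, 0 < d &
    forall w, V w -> hn 2^-1 w < d ->
      `|Pi (u + w) - Pi u - ip (B u) w| <= e * hn 2^-1 w.

Definition bounded_on_balls (F : H -> R) : Prop :=
  forall rho : R, 0 < rho -> exists M : R, forall u, V u ->
    hn 2^-1 u <= rho -> `|F u| <= M.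

(* Pi is defined on H^{1/2}; continuity is in the topology of H^s. *)
Definition functional_continuous (s : R) (Pi : H -> R) : Prop :=
  forall u, V u -> forall e : R, 0 < e -> exists2 d : R, 0 < d &
    forall v, V v -> hn s (v - u) < d -> `|Pi v - Pi u| < e.

(* Continuity from the topology of H^s to that of H^r. *)
Definition map_continuous (s r : R) (F : H -> H) : Prop :=
  forall u, V u -> forall e : R, 0 < e -> exists2 d : R, 0 < d &
    forall v, V v -> hn s (v - u) < d -> hn r (F v - F u) < e.

(* Pi is a Frechet C^k mapping on H^{1/2}, with P u [:: v1; ..; vj] the value
   <Pi^(j)(u); v1, .., vj> of its j-th derivative, j <= k; derivatives and
   continuity are in the norms of the spaces of bounded j-linear forms. *)
Definition frechet_Ck (k : nat) (Pi : H -> R) (P : H -> seq H -> R) : Prop :=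
  [/\ forall u, V u -> P u [::] = Pi u,
      forall u, V u -> forall s1 s2 (a : R) x y, (size s1 + size s2 < k)%N ->
        [set` s1] `<=` V -> [set` s2] `<=` V -> V x -> V y ->
        P u (s1 ++ (a *: x + y) :: s2) =
          a * P u (s1 ++ x :: s2) + P u (s1 ++ y :: s2),
      forall u, V u -> exists M : R, forall s, (size s <= k)%N -> [set` s] `<=` V ->
        `|P u s| <= M * \prod_(x <- s) hn 2^-1 x,
      forall u, V u -> forall e : R, 0 < e -> exists2 d : R, 0 < d &
        forall w s, V w -> hn 2^-1 w < d -> (size s < k)%N -> [set` s] `<=` V ->
          `|P (u + w) s - P u s - P u (w :: s)|
            <= e * hn 2^-1 w * \prod_(x <- s) hn 2^-1 x &
      forall u, V u -> forall e : R, 0 < e -> exists2 d : R, 0 < d &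
        forall w s, V w -> hn 2^-1 w < d -> size s = k -> [set` s] `<=` V ->
          `|P (u + w) s - P u s| <= e * \prod_(x <- s) hn 2^-1 x].

End Nonlinearity.

Section Bochner.
Context {R : realType} {H : completeNormedModType R}.
Variable ip : H -> H -> R.

Local Notation mu := (@lebesgue_measure R).

Definition strongly_measurable (E : set R) (g : R -> H) : Prop :=
  exists s : nat -> R -> H,
    (forall n, finite_set (range (s n)) /\
               forall x, measurable (s n @^-1` [set x])) /\
    {ae mu, forall t, E t -> s ^~ t @ \oo --> g t}.

Definition bochner_L1 (E : set R) (g : R -> H) : Prop :=
  strongly_measurable E g /\ mu.-integrable E (fun t => `|g t|%:E).

(* f : [a, b] -> H has derivative g in L_1(a, b; H), i.e. f(t) - f(a) is the
   integral of g over [a, t]; the vector-valued integral is tested on H. *)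
Definition L1_derivative (a b : R) (f g : R -> H) : Prop :=
  bochner_L1 `[a, b] g /\
  forall t, a <= t <= b -> forall phi,
    ip (f t - f a) phi = \int[mu]_(r in `[a, t]) ip (g r) phi.

End Bochner.

Section Solutions.
Context {R : realType} {H : completeNormedModType R}.
Variables (ip : H -> H -> R) (domA : set H) (A : H -> H).
Variables (nu : R) (K D B : H -> H).

Local Notation mu := (@lebesgue_measure R).
Local Notation V := (Hhalf ip domA A).
Local Notation Ahalf := (frac_pow ip domA A 2^-1).

Definition norm2 (x : H * H) : R := Num.sqrt (`|x.1| ^+ 2 + `|x.2| ^+ 2).

(* u in C([0,T]; H^{1/2}) and in C^1([0,T]; H), with derivative ut. *)
Definition energy_class (T : R) (u ut : R -> H) : Prop :=
  [/\ forall t, 0 <= t <= T -> V (u t),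
      {within `[0, T], continuous (Ahalf \o u)},
      {within `[0, T], continuous ut} &
      forall t, 0 < t < T -> is_derive t 1 u (ut t)].

(* In addition u has derivative in L_1(a,b; H^{1/2}) (it is ut) and ut has
   derivative utt in L_1(a,b; H), whenever 0 < a < b < T. *)
Definition strong_class (T : R) (u ut utt : R -> H) : Prop :=
  energy_class T u ut /\
  forall a b : R, 0 < a -> a < b -> b < T ->
    [/\ {ae mu, forall t, `[a, b]%classic t -> V (ut t)},
        L1_derivative ip a b (Ahalf \o u) (Ahalf \o ut) &
        L1_derivative ip a b ut utt].

Definition coupled_strong (alpha kappa T : R) (U Ut : R -> H * H) : Prop :=
  exists utt vtt : R -> H,
    [/\ strong_class T (fun t => (U t).1) (fun t => (Ut t).1) utt,
        strong_class T (fun t => (U t).2) (fun t => (Ut t).2) vtt &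
        {ae mu, forall t, `]0, T[%classic t ->
          let: (u, v) := U t in let: (ut, vt) := Ut t in
          exists f g : H,
            [/\ elliptic_eq ip domA A nu u (D ut + alpha *: K (ut - vt)) f,
                elliptic_eq ip domA A nu v (D vt + alpha *: K (vt - ut)) g,
                utt t + f + kappa *: K (u - v) + B u = 0 &
                vtt t + g + kappa *: K (v - u) + B v = 0]}].

(* The norm of A^{1/2} applied to a pair carries the factor sqrt nu because the
   operator of the system is nu diag(A, A). *)
Definition coupled_generalized (alpha kappa T : R) (U Ut : R -> H * H) : Prop :=
  [/\ energy_class T (fun t => (U t).1) (fun t => (Ut t).1),
      energy_class T (fun t => (U t).2) (fun t => (Ut t).2) &
      exists Un Utn : nat -> R -> H * H,
        (forall n, coupled_strong alpha kappa T (Un n) (Utn n)) /\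
        forall e : R, 0 < e -> \forall n \near \oo, forall t, 0 <= t <= T ->
          norm2 (Ut t - Utn n t) +
          Num.sqrt nu * norm2 (Ahalf (U t - Un n t).1, Ahalf (U t - Un n t).2)
            < e].

Definition coupled_solution (alpha kappa : R) (U Ut : R -> H * H) : Prop :=
  forall T : R, 0 < T -> coupled_generalized alpha kappa T U Ut.

Definition single_strong (T : R) (w wt : R -> H) : Prop :=
  exists wtt : R -> H,
    strong_class T w wt wtt /\
    {ae mu, forall t, `]0, T[%classic t ->
      exists2 f : H, elliptic_eq ip domA A nu (w t) (D (wt t)) f &
        wtt t + f + B (w t) = 0}.

Definition single_generalized (T : R) (w wt : R -> H) : Prop :=
  energy_class T w wt /\
  exists wn wtn : nat -> R -> H,
    (forall n, single_strong T (wn n) (wtn n)) /\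
    forall e : R, 0 < e -> \forall n \near \oo, forall t, 0 <= t <= T ->
      `|wt t - wtn n t| + Num.sqrt nu * `|Ahalf (w t - wn n t)| < e.

Definition single_solution (w wt : R -> H) : Prop :=
  forall T : R, 0 < T -> single_generalized T w wt.

(* The phase spaces, with the metrics of H^{1/2} x H and of its square. *)
Definition single_phase : set (H * H) := [set y | V y.1].

Definition single_dist (y z : H * H) : R :=
  norm2 (Ahalf (y.1 - z.1), y.2 - z.2).

Definition coupled_phase : set ((H * H) * (H * H)) :=
  [set y | V y.1.1 /\ V y.1.2].

Definition coupled_dist (y z : (H * H) * (H * H)) : R :=
  Num.sqrt (norm2 (Ahalf (y.1.1 - z.1.1), Ahalf (y.1.2 - z.1.2)) ^+ 2 +
            norm2 (y.2 - z.2) ^+ 2).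

(* S is the evolution operator of the equation, for times t >= 0. *)
Definition single_flow (S : R -> H * H -> H * H) : Prop :=
  forall y, single_phase y -> exists w wt : R -> H,
    [/\ single_solution w wt, (w 0, wt 0) = y &
        forall t, 0 <= t -> S t y = (w t, wt t)].

Definition coupled_flow (alpha kappa : R)
    (S : R -> (H * H) * (H * H) -> (H * H) * (H * H)) : Prop :=
  forall y, coupled_phase y -> exists U Ut : R -> H * H,
    [/\ coupled_solution alpha kappa U Ut, (U 0, Ut 0) = y &
        forall t, 0 <= t -> S t y = (U t, Ut t)].

Definition diagonal_set (E : set (H * H)) : set ((H * H) * (H * H)) :=
  [set ((y.1, y.1), (y.2, y.2)) | y in E].

End Solutions.

(* Dynamical systems on a subset X of T with metric d. *)
Section Attractor.
Context {R : realType} {T : Type}.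
Variables (X : set T) (d : T -> T -> R) (S : R -> T -> T).

Definition dist_bounded (E : set T) : Prop :=
  E `<=` X /\ exists M : R, forall x y, E x -> E y -> d x y <= M.

Definition dist_closed (E : set T) : Prop :=
  forall x, X x -> (forall e : R, 0 < e -> exists2 y, E y & d x y < e) -> E x.

(* The last clause is sup_{y in E} dist(S_t y, Att) -> 0 written out, so that the
   distance to the empty set is infinite. *)
Definition global_attractor (Att : set T) : Prop :=
  [/\ dist_bounded Att, dist_closed Att,
      forall t : R, 0 <= t -> S t @` Att = Att &
      forall E, dist_bounded E -> forall e : R, 0 < e ->
        \forall t \near +oo, forall y, E y -> exists2 a, Att a & d (S t y) a < e].

End Attractor.

(* Main.v *)
Require Import Defs.
From HB Require Import structures.
From mathcomp Require Import all_boot all_order all_algebra.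
From mathcomp Require Import sesquilinear.
From mathcomp Require Import all_classical all_reals all_analysis.
From mathcomp Require Import ring lra.

Set Implicit Arguments.
Unset Strict Implicit.
Unset Printing Implicit Defensive.

Import Order.TTheory GRing.Theory Num.Theory numFieldNormedType.Exports.
Local Open Scope classical_set_scope.
Local Open Scope ring_scope.

(* Write w = u - v. Testing the system with U_t + eps U gives a Lyapunov function, equivalent to the
   energy, that is bounded eventually by a constant independent of kappa: the solutions enter a ball
   whose radius does not depend on kappa, and the dissipation |u_t|^2 + |v_t|^2 is integrable up to a
   bounded quantity. The same multiplier for the equation of w gives a functional Phi, equivalent to
   |w_t|^2 + nu |A^{1/2} w|^2 + kappa (K w, w), where the work of B(u) - B(v) is either of lower order
   (4b) or, up to lower order, the derivative of (B(u) - B(v), w) / 2 with an error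
   (|u_t| + |v_t|) |A^{1/2} w|^2 (4a). The terms in |w|^2 are absorbed because s_kappa is large, and the
   error because Phi exp(k E + omega t) is nonincreasing for the energy E and a suitable k.

   The calculus of A^{1/2} rests on the totality of the eigenvectors of A. Differential inequalities along
   strong solutions avoid integrals: [slope_le] bounds difference quotients locally, up to small multiples
   of the increments of a primitive of an L1 majorant of the derivatives. *)

(** In case (4a) the error (|u_t| + |v_t|) |A^{1/2} w|^2 is of the same order as [Phi] and carries
    no small factor. Young's inequality turns it into half of the decay rate of [Phi] plus a
    multiple of (|u_t|^2 + |v_t|^2) times [Phi], and the second part is paid by the decrease of the
    energy: this is why [E] enters the exponent. Once the solution is in the absorbing ball, [E]
    ranges over a bounded interval independent of kappa, so the weight costs only a constant factor.
    The constants behind the threshold and the rate must precede kappa. The coupling form is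
    therefore kept as the single quantity kappa (K w, w), and a large s_kappa forces kappa >= 1, so
    that alpha (K w, w) is bounded by a multiple of it. Only the entry time into the ball and the
    final constants depend on kappa. For the attractors the decay has to be uniform on bounded sets
    of data: a point of the attractor has ancestors in it at all times, whence u = v there.
    Uniqueness identifies the coupled flow on the diagonal with the single one, and attraction with
    invariance gives both inclusions. *)

Ltac gen_norm := repeat match goal with
  |- context [@Num.norm ?A ?B ?x] => let n := fresh "n" in move: (@Num.norm A B x) => n
  end.

(** * Inner products and elementary limits *)

Section InnerProduct.
Context {R : realType} {H : completeNormedModType R}.
Variable ip : {dot H for (@idfun R)}.

Lemma ipC x y : ip x y = ip y x.
Proof. by rewrite (hermC ip x y) expr0 mul1r. Qed.

Lemma ipDr x y z : ip x (y + z) = ip x y + ip x z. Proof. exact: linearD. Qed.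
Lemma ipZr a x y : ip x (a *: y) = a * ip x y. Proof. exact: linearZ. Qed.
Lemma ipNr x y : ip x (- y) = - ip x y. Proof. exact: linearN. Qed.
Lemma ip0r x : ip x 0 = 0. Proof. exact: linear0. Qed.
Lemma ipDl x y z : ip (x + y) z = ip x z + ip y z.
Proof. by rewrite !(ipC _ z) ipDr. Qed.
Lemma ipZl a x z : ip (a *: x) z = a * ip x z.
Proof. by rewrite !(ipC _ z) ipZr. Qed.
Lemma ipNl x z : ip (- x) z = - ip x z.
Proof. by rewrite !(ipC _ z) ipNr. Qed.
Lemma ip0l z : ip 0 z = 0. Proof. by rewrite ipC ip0r. Qed.
Lemma ipBl x y z : ip (x - y) z = ip x z - ip y z.
Proof. by rewrite ipDl ipNl. Qed.

Definition ipE := (ipDr, ipDl, ipNr, ipNl, ipZr, ipZl, ip0r, ip0l).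

Lemma ip_sumr (I : Type) (s : seq I) (F : I -> H) x :
  ip x (\sum_(i <- s) F i) = \sum_(i <- s) ip x (F i).
Proof. exact: linear_sum. Qed.

Hypothesis hip : forall x : H, ip x x = `|x| ^+ 2.

Lemma sqr_normB x y : `|x - y| ^+ 2 = `|x| ^+ 2 - 2 * ip x y + `|y| ^+ 2.
Proof. by rewrite -!hip !ipE (ipC y x); ring. Qed.

Lemma ip_cauchy_schwarz x y : `|ip x y| <= `|x| * `|y|.
Proof.
have [->|y0] := eqVneq y 0; first by rewrite ip0r normr0 mulr_ge0.
have yp : 0 < `|y| ^+ 2 by rewrite exprn_gt0 ?normr_gt0.
have h : 0 <= `| (`|y| ^+ 2) *: x - ip x y *: y| ^+ 2 by rewrite sqr_ge0.
rewrite -ler_sqr ?nnegrE ?mulr_ge0 // exprMn real_normK ?num_real //.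
rewrite -subr_ge0 -(pmulr_rge0 _ yp); apply: le_trans h _.
by rewrite -hip !ipE (ipC y x) !hip le_eqVlt; apply/orP; left; apply/eqP; ring.
Qed.

Lemma ip_le x y : ip x y <= `|x| * `|y|.
Proof. exact: le_trans (ler_norm _) (ip_cauchy_schwarz x y). Qed.

(** Converts a bound on pairings into a norm bound, by testing a vector with itself. *)
Lemma norm_le_ip (x : H) (c : R) : 0 <= c -> `|x| ^+ 2 <= c * `|x| -> `|x| <= c.
Proof.
move=> c0; have [->|x0] := eqVneq x 0; first by rewrite normr0.
by rewrite expr2 ler_pM2r ?normr_gt0.
Qed.

Lemma ip_eq0 x : (forall y, ip x y = 0) -> x = 0.
Proof.
by move=> h; apply/eqP; rewrite -normr_eq0 -sqrf_eq0 -hip h.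
Qed.

Lemma ip_inj x y : (forall z, ip x z = ip y z) -> x = y.
Proof. by move=> h; apply/subr0_eq/ip_eq0 => z; rewrite ipBl h subrr. Qed.

Lemma ip_cvg (I : Type) (F : set_system I) {FF : Filter F} (f g : I -> H) x y :
  f @ F --> x -> g @ F --> y -> (fun i => ip (f i) (g i)) @ F --> ip x y.
Proof.
move=> fx gy.
have dx : (fun i => `|f i - x|) @ F --> (0 : R).
  by rewrite -[X in _ --> X](@normr0 _ H) -(subrr x); apply: cvg_norm; apply: cvgB fx (cvg_cst _).
have dy : (fun i => `|g i - y|) @ F --> (0 : R).
  by rewrite -[X in _ --> X](@normr0 _ H) -(subrr y); apply: cvg_norm; apply: cvgB gy (cvg_cst _).
have h : (fun i => `|f i - x| * `|g i - y| + `|f i - x| * `|y| + `|x| * `|g i - y|) @ F --> (0 : R).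
  have z : 0 * 0 + 0 * `|y| + `|x| * 0 = 0 :> R by ring.
  rewrite -[X in _ --> X]z.
  by apply: cvgD; [apply: cvgD|]; apply: cvgM => //; exact: cvg_cst.
have h2 : (fun i => ip (f i) (g i) - ip x y) @ F --> (0 : R).
  apply/norm_cvg0P; apply: (@squeeze_cvgr _ _ _ _ (cst 0) (fun i => `|f i - x| * `|g i - y| + `|f i - x| * `|y| + `|x| * `|g i - y|)) => //; last exact: cvg_cst.
  apply: nearW => i; rewrite normr_ge0 /=.
  rewrite (_ : ip (f i) (g i) - ip x y = ip (f i - x) (g i - y) + ip (f i - x) y + ip x (g i - y)); last by rewrite !ipE; ring.
  apply: le_trans (ler_normD _ _) _; apply: lerD; last exact: ip_cauchy_schwarz.
  by apply: le_trans (ler_normD _ _) _; apply: lerD; exact: ip_cauchy_schwarz.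
by apply/subr_cvg0.
Qed.

End InnerProduct.

(** The constant [c] is kept so that an error bounded by a multiple of [e] can be used without
    rescaling [e]. *)
Lemma small_norm0 (R : realType) (H : normedModType R) (x : H) (c : R) :
  (forall e : R, 0 < e -> `|x| <= c * e) -> x = 0.
Proof.
move=> h; apply/eqP; rewrite -normr_le0; apply/ler_addgt0Pr => e e0; rewrite add0r.
have c1 : 0 < `|c| + 1 by rewrite ltr_wpDl.
have := h (e / (`|c| + 1)) (divr_gt0 e0 c1); move/le_trans; apply.
rewrite mulrA ler_pdivrMr // mulrC ler_pM2l //.
by apply: le_trans (ler_norm c) _; rewrite lerDl.
Qed.

(** A cluster point serves in place of a convergent subsequence: below, it is enough that terms of
    arbitrarily large index come arbitrarily close to it. *)
Lemma compact_cluster_seq (R : realType) (H : normedModType R) (C : set H) (x : nat -> H) :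
  compact C -> (forall n, C (x n)) ->
  exists p : H, forall (e : R) N, 0 < e -> exists2 n, (N <= n)%N & `|p - x n| < e.
Proof.
move=> cC Cx.
have Fx : (x @ \oo) C by exists 0%N => // n _; exact: Cx.
have [p [_ clp]] := cC (x @ \oo) _ Fx.
exists p => e N e0.
have [|_ [[n Nn <-] pn]] := clp (x @` [set n | (N <= n)%N]) (ball p e) _ (nbhsx_ballx p e e0).
  by exists N => // n Nn; exists n.
by exists n => //; move: pn; rewrite -ball_normE.
Qed.

Lemma norm_cauchy_cvg (R : realType) (H : completeNormedModType R) (u : nat -> H) :
  (forall e : R, 0 < e -> exists N, forall n m, (N <= n)%N -> (N <= m)%N -> `|u n - u m| < e) ->
  exists p : H, u @ \oo --> p.
Proof.
move=> h; have /cvg_ex [p hp] : cvg (u @ \oo); last by exists p.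
apply/cauchy_cvgP/cauchy_ballP => e e0; have [N hN] := h _ e0.
exists (u @` [set n | (N <= n)%N], u @` [set n | (N <= n)%N]) => /=.
  by split; exists N => // n Nn; exists n.
by move=> [_ _] /= [[n Nn <-] [m Nm <-]]; rewrite -ball_normE /=; exact: hN.
Qed.

(** * Orthogonal projection and a density criterion *)

Section Projection.
Context {R : realType} {H : completeNormedModType R}.
Variable ip : {dot H for (@idfun R)}.
Hypothesis hip : forall x : H, ip x x = `|x| ^+ 2.

Lemma invS_lt (e : R) : 0 < e -> exists N, forall n, (N <= n)%N -> (n.+1%:R^-1 : R) < e.
Proof.
move=> e0; exists (Num.trunc e^-1) => n Nn.
rewrite -(invrK e) ltf_pV2 ?posrE ?invr_gt0 ?ltr0n //.
by rewrite -Num.Theory.truncn_lt_nat ?ltnS // invr_ge0 ltW.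
Qed.

(** [M] may fail to be closed, so [p] is only a limit of elements of [M]. A minimising sequence for
    the distance is Cauchy by the parallelogram identity, and minimality along each direction [m]
    gives orthogonality. *)
Lemma projection_closure (M : set H) (x : H) : lin_subspace M ->
  exists p : H, (forall e : R, 0 < e -> exists2 m, M m & `|p - m| < e) /\
    forall m, M m -> ip (x - p) m = 0.
Proof.
move=> [M0 Ml].
pose E : set R := [set `|x - m| ^+ 2 | m in M]; pose d := inf E.
have Ehi : has_inf E.
  split; first by exists (`|x - 0| ^+ 2); exists 0.
  by exists 0 => _ [m _ <-]; exact: sqr_ge0.
have dle m : M m -> d <= `|x - m| ^+ 2 by move=> Mm; apply: ge_inf (Ehi.2) _ _; exists m.
have /choice[u hu] n : exists m, M m /\ `|x - m| ^+ 2 < d + (n.+1%:R^-1 : R).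
  have [|_ [m Mm <-] hm] := @inf_adherent R E (n.+1%:R^-1) _ Ehi; first by rewrite invr_gt0 ltr0n.
  by exists m.
have par a b : M a -> M b ->
    `|a - b| ^+ 2 <= 2 * (`|x - a| ^+ 2 - d) + 2 * (`|x - b| ^+ 2 - d).
  move=> Ma Mb; have Mh : M (2^-1 *: (a + b)).
    rewrite -[_ *: _]addr0; apply: (Ml) => //.
    by rewrite -[a]scale1r; apply: Ml.
  have := dle _ Mh; have -> : `|x - 2^-1 *: (a + b)| ^+ 2 = 2^-1 * `|x - a| ^+ 2 + 2^-1 * `|x - b| ^+ 2 - 4^-1 * `|a - b| ^+ 2.
    by rewrite -!hip !ipE (ipC ip a x) (ipC ip b x) (ipC ip b a); field.
  by lra.
have [p hp] : exists p : H, u @ \oo --> p.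
  apply: norm_cauchy_cvg => e e0.
  have [|N hN] := @invS_lt (e ^+ 2 / 4); first by rewrite divr_gt0 // exprn_gt0.
  exists N => n m Nn Nm; rewrite -ltr_sqr ?nnegrE ?(ltW e0) //.
  move: (par _ _ (hu n).1 (hu m).1) (hu n).2 (hu m).2 (hN _ Nn) (hN _ Nm).
  move: (n.+1%:R^-1 : R) (m.+1%:R^-1 : R) => a b; gen_norm; lra.
have up : (fun n => `|x - u n|) @ \oo --> `|x - p|.
  by apply: cvg_norm; apply: cvgB => //; exact: cvg_cst.
exists p; split=> [e e0|m Mm].
  have /cvgrPdist_lt /(_ e e0) [N _ /(_ N (leqnn N)) hN] := hp.
  by exists (u N) => //; exact: (hu N).1.
have pd : `|x - p| ^+ 2 <= d.
  apply/ler_addgt0Pr => e e0.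
  have up2 : (fun n => `|x - u n| ^+ 2) @ \oo --> `|x - p| ^+ 2.
    by rewrite expr2; under eq_fun do rewrite expr2; apply: cvgM.
  apply: (cvgr_to_le up2); have [N hN] := invS_lt e0.
  by exists N => // n /= Nn; move: (hu n).2 (hN _ Nn); move: (n.+1%:R^-1 : R) => a; gen_norm; lra.
have key (t : R) : `|x - p| ^+ 2 <= `|x - p - t *: m| ^+ 2.
  apply: le_trans pd _.
  have um : (fun n => `|x - u n - t *: m|) @ \oo --> `|x - p - t *: m|.
    apply: cvg_norm; apply: cvgB; last exact: cvg_cst.
    by apply: cvgB => //; exact: cvg_cst.
  have um2 : (fun n => `|x - u n - t *: m| ^+ 2) @ \oo --> `|x - p - t *: m| ^+ 2.
    by rewrite expr2; under eq_fun do rewrite expr2; apply: cvgM.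
  apply: (cvgr_to_ge um2); apply: nearW => n.
  rewrite -addrA -opprD; apply: dle; rewrite addrC; apply: (Ml) => //; exact: (hu n).1.
have [->|m0] := eqVneq m 0; first by rewrite ip0r.
have mp : 0 < `|m| ^+ 2 by rewrite exprn_gt0 ?normr_gt0.
(* The minimiser of the quadratic in [t]; it would lower the squared distance by q^2 / |m|^2. *)
have := key (ip (x - p) m / `|m| ^+ 2).
rewrite (sqr_normB hip (x - p)) ipZr normrZ exprMn real_normK ?num_real //.
set q := ip (x - p) m => h.
have : q ^+ 2 / `|m| ^+ 2 <= 0.
  have e1 : (q / `|m| ^+ 2) ^+ 2 * `|m| ^+ 2 = q ^+ 2 / `|m| ^+ 2 by field; rewrite normr_eq0.
  have e2 : q / `|m| ^+ 2 * q = q ^+ 2 / `|m| ^+ 2 by field; rewrite normr_eq0.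
  by move: h; rewrite e1 e2; lra.
by rewrite pmulr_lle0 ?invr_gt0 // => q2; apply/eqP; rewrite -sqrf_eq0 eq_le q2 sqr_ge0.
Qed.

Lemma dense_of_orthogonal (M : set H) : lin_subspace M ->
  (forall y, (forall m, M m -> ip y m = 0) -> y = 0) ->
  forall (z : H) (e : R), 0 < e -> exists2 m, M m & `|z - m| < e.
Proof.
move=> Ml tot z; have [p [cp op]] := projection_closure z Ml.
by have := tot _ op; move/subr0_eq => -> e /cp.
Qed.

End Projection.

(** * Eigenvectors of an operator with compact resolvent *)

Section Spectral.
Context {R : realType} {H : completeNormedModType R}.
Variable ip : {dot H for (@idfun R)}.
Hypothesis hip : forall x : H, ip x x = `|x| ^+ 2.
Variables (domA : set H) (A : H -> H).
Hypothesis hAsa : self_adjoint ip domA A.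
Hypothesis hApos : positive_op ip domA A.
Hypothesis hAcomp : compact_resolvent domA A.

Definition eigenpair (l : R) (e : H) : Prop := domA e /\ A e = l *: e.

Lemma domA_lin (a : R) x y : domA x -> domA y -> domA (a *: x + y).
Proof. by case: hAsa => -[_ h] _ _ _; exact: h. Qed.

Lemma domA_Z (a : R) x : domA x -> domA (a *: x).
Proof. by case: hAsa => -[h0 h] _ _ _ dx; rewrite -[_ *: _]addr0; exact: h. Qed.

Lemma A_lin (a : R) x y : domA x -> domA y -> A (a *: x + y) = a *: A x + A y.
Proof. by case: hAsa => _ h _ _; exact: h. Qed.

Lemma A_0 : A 0 = 0.
Proof.
case: hAsa => -[h0 _] _ _ _; have := A_lin 1 h0 h0.
by rewrite !scale1r addr0 -{1}[A 0]addr0 => /addrI.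
Qed.

Lemma A_Z (a : R) x : domA x -> A (a *: x) = a *: A x.
Proof.
case: hAsa => -[h0 _] _ _ _ dx.
by rewrite -[a *: x]addr0 A_lin // A_0 addr0.
Qed.

Lemma A_sym x y : domA x -> domA y -> ip (A x) y = ip x (A y).
Proof. by case: hAsa => _ _ _ h dx dy; apply: (proj1 (h y (A y))). Qed.

Lemma eigenpair_orth l e l' e' : eigenpair l e -> eigenpair l' e' -> l != l' -> ip e e' = 0.
Proof.
move=> [de Ae] [de' Ae'] ll; have := A_sym de de'; rewrite Ae Ae' !ipE => /eqP.
by rewrite -subr_eq0 -mulrBl mulf_eq0 subr_eq0 (negbTE ll) => /eqP.
Qed.

Lemma eigenvalue_gt0 l e : eigenpair l e -> e != 0 -> 0 < l.
Proof.
move=> [de Ae] e0; have := hApos de e0; rewrite Ae !ipE hip.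
by rewrite pmulr_lgt0 // exprn_gt0 // normr_gt0.
Qed.

Section Resolvent.
Variables (l0 : R) (G : H -> H).
Hypothesis G_dom : forall x, domA (G x).
Hypothesis G_r : forall x, A (G x) - l0 *: G x = x.
Hypothesis G_l : forall x, domA x -> G (A x - l0 *: x) = x.
Hypothesis G_cpt : compact (closure (G @` [set x | `|x| <= 1])).

Let AG x : A (G x) = x + l0 *: G x.
Proof. by rewrite -{2}(G_r x) subrK. Qed.

Lemma resolvent_lin (a : R) x y : G (a *: x + y) = a *: G x + G y.
Proof.
rewrite -[RHS]G_l; last exact: domA_lin.
by congr G; rewrite A_lin // !AG; apply: (ip_inj hip) => z; rewrite !ipE; ring.
Qed.

Lemma resolvent_Z (a : R) x : G (a *: x) = a *: G x.
Proof.
have G0 : G 0 = 0.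
  have := resolvent_lin 1 0 0.
  by rewrite !scale1r addr0 -{1}[G 0]addr0 => /addrI.
by rewrite -[a *: x]addr0 resolvent_lin G0 addr0.
Qed.

Lemma resolventB x y : G (x - y) = G x - G y.
Proof. by rewrite addrC -scaleN1r resolvent_lin scaleN1r addrC. Qed.

Lemma resolvent_sym x y : ip (G x) y = ip x (G y).
Proof.
rewrite -{1}(G_r y) -{2}(G_r x) !ipE (A_sym (G_dom x) (G_dom y)); ring.
Qed.

Lemma resolvent_bounded : exists2 C : R, 0 < C & forall x, `|G x| <= C * `|x|.
Proof.
have [M [_ hM]] := compact_bounded G_cpt.
pose C := `|M| + 1; have C0 : 0 < C by rewrite ltr_wpDl.
have MC : M < C by rewrite /C; have := ler_norm M; gen_norm; lra.
exists C => // x; have [->|x0] := eqVneq x 0.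
  by rewrite -(scale0r x) resolvent_Z !scale0r !normr0 mulr0.
have n0 : 0 < `|x| by rewrite normr_gt0.
have -> : G x = `|x| *: G (`|x|^-1 *: x) by rewrite resolvent_Z scalerA divff ?scale1r // gt_eqF.
rewrite normrZ normr_id mulrC ler_pM2r //; apply: (hM C MC); apply: subset_closure.
by exists (`|x|^-1 *: x) => //=; rewrite normrZ normfV normr_id mulVf ?gt_eqF.
Qed.

Lemma resolvent_eigen (m : R) z : m != 0 -> G z = m *: z -> eigenpair (l0 + m^-1) z.
Proof.
move=> m0 Gz; have dz : domA z by rewrite -(scale1r z) -(mulVf m0) -scalerA -Gz; exact: domA_Z.
split=> //; have := AG z; rewrite Gz A_Z // => h.
rewrite -[A z]scale1r -(mulVf m0) -scalerA h.
by rewrite scalerDr !scalerA -scalerDl; congr (_ *: _); field.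
Qed.

Let orth (y : H) := forall l e, eigenpair l e -> ip y e = 0.

(** By symmetry it is enough that [G] maps an eigenvector of [A] to a multiple of itself; for the
    eigenvalue [l0] the resolvent identity forces the eigenvector to vanish. *)
Lemma resolvent_orth y : orth y -> orth (G y).
Proof.
move=> oy l e [de Ae]; rewrite resolvent_sym.
have h : (l - l0) *: G e = e by rewrite -resolvent_Z scalerBl -Ae G_l.
have [ll|ll] := eqVneq (l - l0) 0; first by rewrite -h ll scale0r -resolvent_sym ip0r.
have -> : G e = (l - l0)^-1 *: e by rewrite -{2}h scalerA mulVf // scale1r.
by rewrite ipZr (oy l) // mulr0.
Qed.

(** The Hilbert-Schmidt argument on the orthogonal complement of the eigenvectors, which [G] leaves
    invariant. If it were nonzero, [G] would have norm [m] > 0 on it; a maximising sequence would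
    yield by compactness a nonzero [p] with G^2 p = m^2 p, and [p] or G p - m p would be an
    eigenvector of [A] orthogonal to all eigenvectors. *)
Lemma eigenvectors_total_resolvent y : orth y -> y = 0.
Proof.
move=> oy; apply/eqP/negP => /negP y0.
pose S : set R := [set `|G x| | x in [set x | orth x /\ `|x| <= 1]].
have [C C0 hC] := resolvent_bounded.
have orthZ (a : R) x : orth x -> orth (a *: x).
  by move=> ox l e le; rewrite ipZl (ox l) // mulr0.
have S_ub : has_ubound S.
  by exists C => _ [x [_ x1] <-]; apply: le_trans (hC x) _; rewrite -[leRHS]mulr1 ler_pM2l.
have G0 x : G x = 0 -> x = 0.
  by move=> Gx; rewrite -(G_r x) Gx A_0 scaler0 subr0.
pose m := sup S.
have mub x : orth x -> `|G x| <= m * `|x|.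
  move=> ox; have [->|x0] := eqVneq x 0.
    by rewrite -(scale0r x) resolvent_Z !scale0r !normr0 mulr0.
  have n0 : 0 < `|x| by rewrite normr_gt0.
  have -> : G x = `|x| *: G (`|x|^-1 *: x) by rewrite resolvent_Z scalerA divff ?scale1r // gt_eqF.
  rewrite normrZ normr_id mulrC ler_pM2r //; apply: ub_le_sup => //.
  exists (`|x|^-1 *: x) => //; split; first exact: orthZ.
  by rewrite normrZ normfV normr_id mulVf ?gt_eqF.
have m0 : 0 < m.
  have := mub y oy; have : 0 < `|G y| by rewrite normr_gt0; apply: contra y0 => /eqP/G0 ->.
  move=> /lt_le_trans h /h; rewrite pmulr_lgt0 // normr_gt0 //.
have hsS : has_sup S by split=> //; exists `|G 0|, 0 => //; split; [move=> l e _; rewrite ip0l|rewrite normr0].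
have /choice[x hx] n : exists x, (orth x /\ `|x| <= 1) /\ m - `|G x| < (n.+1%:R^-1 : R).
  have [|_ [x hx <-] h] := @sup_adherent R S (n.+1%:R^-1) _ hsS; first by rewrite invr_gt0 ltr0n.
  by exists x; split => //; move: h; rewrite -/m ltrBlDr addrC -ltrBlDr.
have [|p hp] := @compact_cluster_seq R H _ (fun n => G (x n)) G_cpt.
  by move=> n; apply: subset_closure; exists (x n) => //; exact: (hx n).1.2.
have near (e : R) : 0 < e -> exists z, [/\ orth z, `|z| <= 1, `|p - G z| < e & m - `|G z| < e].
  move=> e0; have [N hN] := invS_lt e0; have [n Nn pn] := hp e N e0.
  exists (x n); split => //; [exact: (hx n).1.1|exact: (hx n).1.2|].
  exact: lt_trans (hx n).2 (hN _ Nn).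
have op : orth p.
  move=> l e le; apply: (@small_norm0 R R^o _ `|e|) => d d0.
  have [z [oz _ pz _]] := near d d0.
  have -> : ip p e = ip (p - G z) e by rewrite ipBl (resolvent_orth oz le) subr0.
  apply: le_trans (ip_cauchy_schwarz hip _ _) _.
  by rewrite mulrC ler_wpM2l // ltW.
have p0 : p != 0.
  apply/eqP => p0; have [|z [_ _ h1 h2]] := near (m / 2); first by rewrite divr_gt0.
  by move: h1 h2; rewrite p0 sub0r normrN; gen_norm; lra.
have GGp : G (G p) = (m ^+ 2) *: p.
  apply/subr0_eq; apply: (@small_norm0 R H _ (C ^+ 2 + m ^+ 2 + C)) => s s0.
  (* For |z| <= 1 in the complement, |G^2 z - m^2 z|^2 <= m^2 (m^2 - |G z|^2) because |G^2 z| <= m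
     |G z|. The second bound on [e] makes the right-hand side at most s^2. *)
  pose e := Num.min s (s ^+ 2 / (2 * m ^+ 3)).
  have e0 : 0 < e by rewrite lt_min s0 divr_gt0 ?mulr_gt0 ?exprn_gt0.
  have [z [oz z1 pz mz]] := near e e0.
  have -> : G (G p) - m ^+ 2 *: p = G (G (p - G z)) - m ^+ 2 *: (p - G z) + G (G (G z) - m ^+ 2 *: z).
    rewrite !resolventB resolvent_Z; apply: (ip_inj hip) => t; rewrite !ipE; ring.
  have es : e <= s by rewrite ge_min lexx.
  have es2 : e <= s ^+ 2 / (2 * m ^+ 3) by rewrite ge_min lexx orbT.
  have pzs : `|p - G z| <= s by apply: ltW; apply: lt_le_trans pz es.
  rewrite !mulrDl; apply: le_trans (ler_normD _ _) _; apply: lerD.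
    apply: le_trans (ler_normB _ _) _; apply: lerD.
      apply: le_trans (hC _) _; rewrite expr2 -mulrA ler_pM2l //.
      by apply: le_trans (hC _) _; rewrite ler_pM2l.
    by rewrite normrZ ger0_norm ?sqr_ge0 // ler_pM2l // exprn_gt0.
  apply: le_trans (hC _) _; rewrite ler_pM2l //.
  rewrite -ler_sqr ?nnegrE ?(ltW s0) //.
  rewrite (sqr_normB hip) !ipE normrZ exprMn (ger0_norm (sqr_ge0 _)) resolvent_sym hip.
  have h1 : `|G (G z)| ^+ 2 <= m ^+ 2 * `|G z| ^+ 2.
    by rewrite -exprMn ler_sqr ?nnegrE ?mulr_ge0 ?(ltW m0) //; exact/mub/resolvent_orth.
  have h2 : `|z| ^+ 2 <= 1 by rewrite expr_le1.
  have h3 : `|G z| <= m by apply: le_trans (mub _ oz) _; rewrite -[leRHS]mulr1 ler_pM2l.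
  have h4 : m ^+ 2 * (m ^+ 2 - `|G z| ^+ 2) <= s ^+ 2.
    have -> : m ^+ 2 - `|G z| ^+ 2 = (m - `|G z|) * (m + `|G z|) by ring.
    apply: (@le_trans _ _ (m ^+ 2 * ((s ^+ 2 / (2 * m ^+ 3)) * (2 * m)))); last first.
      by rewrite le_eqVlt; apply/orP; left; apply/eqP; field; rewrite gt_eqF.
    rewrite ler_pM2l ?exprn_gt0 //; apply: ler_pM; rewrite ?subr_ge0 ?addr_ge0 ?(ltW m0) //.
      by apply: le_trans es2; exact: ltW.
    by rewrite mulr_natl mulr2n lerD2l.
  have h5 : m ^+ 2 ^+ 2 * `|z| ^+ 2 <= m ^+ 2 ^+ 2 by rewrite -[leRHS]mulr1 ler_pM2l // !exprn_gt0.
  move: h1 h4 h5; rewrite mulrBr -expr2.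
  move: (m ^+ 2 * `|G z| ^+ 2) (`|G (G z)| ^+ 2) (m ^+ 2 ^+ 2 * `|z| ^+ 2) (m ^+ 2 ^+ 2) (s ^+ 2) => a b c d f.
  lra.
have absurd (u : H) (mu : R) : orth u -> mu != 0 -> G u = mu *: u -> u = 0.
  move=> ou mu0 Gu; have := ou _ _ (resolvent_eigen mu0 Gu).
  by rewrite hip => /eqP; rewrite sqrf_eq0 normr_eq0 => /eqP.
have orthB a b : orth a -> orth b -> orth (a - b).
  by move=> oa ob l e le; rewrite ipBl (oa l) // (ob l) // subrr.
(* (G + m) (G - m) p = 0, so this vector is an eigenvector of [G] for -m unless it vanishes. *)
have z0 : G p - m *: p = 0.
  apply: (absurd _ (- m)); [|by rewrite oppr_eq0 gt_eqF|].
    by apply: orthB; [exact: resolvent_orth|exact: orthZ].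
  rewrite resolventB resolvent_Z GGp; apply: (ip_inj hip) => t; rewrite !ipE; ring.
by move: p0; rewrite (absurd p m op) ?eqxx ?gt_eqF //; apply/subr0_eq.
Qed.

End Resolvent.
Lemma eigenvectors_total y : (forall l e, eigenpair l e -> ip y e = 0) -> y = 0.
Proof.
case: hAcomp => l0 [G [G1 G2 G3]].
apply: (@eigenvectors_total_resolvent l0 G) => // x; first exact: (G1 x).1.
exact: (G1 x).2.
Qed.

(** [positive_op] is not uniform, so compactness has to give the gap. If eigenvalues came
    arbitrarily close to 0, the images under [G] of unit eigenvectors e would cluster at some [p]
    with e close to -l0 p, and in the limit A p = 0 with [p] nonzero. *)
Lemma eigenvalue_lbound : exists2 c : R, 0 < c &
  forall l e, eigenpair l e -> e != 0 -> c <= l.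
Proof.
apply: contrapT => hno.
have /choice[le hle] n : exists le : R * H,
    [/\ eigenpair le.1 le.2, `|le.2| = 1 & le.1 < (n.+1%:R^-1 : R)].
  apply: contrapT => h; apply: hno; exists (n.+1%:R^-1); first by rewrite invr_gt0 ltr0n.
  move=> l e [de Ae] e0; rewrite leNgt; apply/negP => ln; apply: h.
  exists (l, `|e|^-1 *: e); split=> //=.
    by split; [exact: domA_Z|rewrite A_Z // Ae !scalerA mulrC].
  by rewrite normrZ normfV normr_id mulVf // normr_eq0.
case: hAcomp => l0 [G [G1 G2 G3]].
have Gd x := (G1 x).1; have Gr x := (G1 x).2.
have [C C0 hC] := resolvent_bounded Gd Gr G2 G3.
have [|p hp] := @compact_cluster_seq R H _ (fun n => G (le n).2) G3.
  by move=> n; apply: subset_closure; exists (le n).2 => //=; have [_ ->] := hle n.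
(* Since e + l0 p = l p - (l - l0) (p - G e), its norm is at most d |p| + (1 + |l0|) d = d D. *)
pose D := 1 + `|l0| + `|p|; have D0 : 0 < D by rewrite /D -addrA ltr_pwDl // addr_ge0.
have near (d : R) : 0 < d -> d <= 1 -> exists2 e, `|e| = 1 & `|p - G e| < d /\ `|e + l0 *: p| <= d * D.
  move=> d0 d1; have [N hN] := invS_lt d0; have [n Nn pn] := hp d N d0.
  have [[de Ae] e1 ln] := hle n; exists (le n).2 => //; split=> //.
  have e_ne0 : (le n).2 != 0 by rewrite -normr_eq0 e1 oner_eq0.
  have l_gt0 := eigenvalue_gt0 (conj de Ae) e_ne0.
  have ld := lt_trans ln (hN _ Nn).
  have Ge : ((le n).1 - l0) *: G (le n).2 = (le n).2.
    by rewrite -(resolvent_Z Gd Gr G2) scalerBl -Ae G2.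
  have -> : (le n).2 + l0 *: p = (le n).1 *: p - ((le n).1 - l0) *: (p - G (le n).2).
    rewrite -{1}Ge; apply: (ip_inj hip) => t; rewrite !ipE; ring.
  apply: le_trans (ler_normB _ _) _; rewrite !normrZ (gtr0_norm l_gt0).
  have -> : d * D = d * `|p| + (1 + `|l0|) * d by rewrite /D; ring.
  apply: lerD; first by rewrite ler_wpM2r // ltW.
  apply: ler_pM => //; last exact: ltW.
  apply: le_trans (ler_normB _ _) _; rewrite lerD2r (gtr0_norm l_gt0).
  by apply: le_trans d1; exact: ltW.
have Gp : p - G (- l0 *: p) = 0.
  apply: (@small_norm0 R H _ (1 + C * D)) => d d0.
  have m1 : 0 < Num.min d 1 by rewrite lt_min d0 ltr01.
  have [|e e1 [pe epd]] := near _ m1; first by rewrite ge_min lexx orbT.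
  have md : Num.min d 1 <= d by rewrite ge_min lexx.
  have -> : p - G (- l0 *: p) = (p - G e) + G (e + l0 *: p).
    rewrite -(scale1r e) (resolvent_lin Gd Gr G2) !(resolvent_Z Gd Gr G2).
    apply: (ip_inj hip) => t; rewrite !ipE; ring.
  rewrite mulrDl mul1r; apply: le_trans (ler_normD _ _) _; apply: lerD.
    by apply: le_trans md; exact: ltW.
  apply: le_trans (hC _) _; rewrite -mulrA ler_pM2l // (le_trans epd) // mulrC ler_pM2l //.
have pE := subr0_eq Gp.
have p0 : p != 0.
  (* If p = 0, the estimate gives |e| <= d D <= 1/2 for a unit vector e. *)
  apply/eqP => p0; pose d := Num.min 1 (D^-1 / 2).
  have d0 : 0 < d by rewrite lt_min ltr01 divr_gt0 // invr_gt0.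
  have [|e e1 [_]] := near d d0; first by rewrite ge_min lexx.
  rewrite p0 scaler0 addr0 e1 => h.
  have : d * D <= 2^-1.
    rewrite -ler_pdivlMr // mulrC ge_min lexx orbT //.
  by move: (d * D) h => q; lra.
have dp : domA p by rewrite pE.
have Ap : A p = 0.
  by have := Gr (- l0 *: p); rewrite -pE scaleNr => /eqP; rewrite -subr_eq0 opprK subrK => /eqP.
by have := hApos dp p0; rewrite Ap ip0l ltxx.
Qed.

Definition eigenlist (s : seq (R * H)) : Prop :=
  uniq [seq x.1 | x <- s] /\ forall x, x \in s -> eigenpair x.1 x.2.

(* Merging eigenvectors of equal eigenvalue makes the summands orthogonal. *)
Definition eigensum : set H :=
  [set p | exists2 s, eigenlist s & p = \sum_(x <- s) x.2].

Lemma eigenpair_lin (a : R) l e e' : eigenpair l e -> eigenpair l e' -> eigenpair l (a *: e + e').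
Proof.
move=> [de Ae] [de' Ae']; split; first exact: domA_lin.
by rewrite A_lin // Ae Ae' scalerDr !scalerA mulrC.
Qed.

Lemma eigenpair0 l : eigenpair l 0.
Proof. by split; [case: hAsa => -[]|rewrite A_0 scaler0]. Qed.

Lemma eigenlist_add s l e : eigenlist s -> eigenpair l e -> exists s',
  [/\ eigenlist s', \sum_(x <- s') x.2 = e + \sum_(x <- s) x.2 &
      {subset [seq x.1 | x <- s'] <= l :: [seq x.1 | x <- s]}].
Proof.
move=> hs he; elim: s hs => [|[l1 e1] s IH] [/= us es].
  exists [:: (l, e)]; split; rewrite ?big_seq1 ?big_nil ?addr0 //.
  by split=> // x; rewrite inE => /eqP ->.
move: us => /andP[l1s us].
have [ll|ll] := eqVneq l l1.
  exists ((l, e + e1) :: s); split.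
  - split=> [/=|x]; first by rewrite ll l1s.
    rewrite inE => /orP[/eqP ->|xs]; last by apply: es; rewrite inE xs orbT.
    rewrite /= -[e]scale1r; apply: eigenpair_lin => //; rewrite ll.
    by apply: (es (l1, e1)); rewrite inE eqxx.
  - by rewrite !big_cons /= addrA.
  - by move=> x /=; rewrite !inE ll => /orP[->|->] //; rewrite !orbT.
have [|s' [[us' es'] Ss' ks']] := IH.
  by split=> // x xs; apply: es; rewrite inE xs orbT.
exists ((l1, e1) :: s'); split.
- split=> [/=|x].
    rewrite us' andbT; apply/negP => /ks'; rewrite inE eq_sym (negbTE ll) /=.
    by apply/negP.
  rewrite inE => /orP[/eqP ->|]; last exact: es'.
  by apply: es; rewrite inE eqxx.
- by rewrite !big_cons /= Ss' addrCA.
- move=> x /=; rewrite inE => /orP[/eqP ->|/ks']; first by rewrite !inE eqxx orbT.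
  by rewrite !inE => /orP[->|->] //; rewrite !orbT.
Qed.

Lemma eigensum_lin : lin_subspace eigensum.
Proof.
split; first by exists [::]; rewrite ?big_nil.
move=> a _ _ [s hs ->] [s' hs' ->].
elim: s hs => [|[l e] s IH] [/= us es].
  by rewrite big_nil scaler0 add0r; exists s'.
move: us => /andP[ls us]; have [|t ht Et] := IH.
  by split=> // x xs; apply: es; rewrite inE xs orbT.
have he : eigenpair l (a *: e).
  rewrite -[a *: e]addr0; apply: eigenpair_lin; last exact: eigenpair0.
  by apply: (es (l, e)); rewrite inE eqxx.
have [t' [ht' Et' _]] := eigenlist_add ht he.
by exists t' => //; rewrite Et' -Et big_cons /= scalerDr addrA.
Qed.

Lemma eigensum_dense (z : H) (e : R) : 0 < e -> exists2 m, eigensum m & `|z - m| < e.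
Proof.
apply: (dense_of_orthogonal hip eigensum_lin) => y hy; apply: eigenvectors_total => l x lx.
apply: hy; exists [:: (l, x)]; last by rewrite big_seq1.
by split=> // t; rewrite inE => /eqP ->.
Qed.

(** [T x] is the squared norm of the projection [q x] of [x] onto the span of the list, a weighted
    sum of squared coefficients. The clauses are Bessel's inequality, Cauchy-Schwarz against the
    sum, and monotonicity in the squared coefficients. A zero vector in the list gets weight 0 by
    the convention on inverses. *)
Lemma eigenlist_bessel s : eigenlist s -> exists T : H -> R,
  [/\ forall x, 0 <= T x <= `|x| ^+ 2,
      forall z, ip z (\sum_(x <- s) x.2) ^+ 2 <= T z * `|\sum_(x <- s) x.2| ^+ 2 &
      forall (a b : R) z u w, 
       (forall l e, eigenpair l e -> ip z e ^+ 2 <= a * ip u e ^+ 2 + b * ip w e ^+ 2) ->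
       T z <= a * T u + b * T w].
Proof.
move=> [us es].
have uns : uniq s := map_uniq us.
pose cf x (y : R * H) : R := ip x y.2 / `|y.2| ^+ 2.
pose q x : H := \sum_(y <- s) cf x y *: y.2.
pose T x : R := \sum_(y <- s) ip x y.2 ^+ 2 / `|y.2| ^+ 2.
have orth y y' : y \in s -> y' \in s -> y != y' -> ip y.2 y'.2 = 0.
  move=> ys y's yy'; apply: (eigenpair_orth (es _ ys) (es _ y's)).
  apply: contra yy' => /eqP h; apply/eqP; move: us ys y's h; clear.
  elim: s => [//|t s IH] /= /andP[ts us]; rewrite !inE => /orP[/eqP->|ys] /orP[/eqP->|y's] // h.
  - by move: ts; rewrite h (map_f _ y's).
  - by move: ts; rewrite -h (map_f _ ys).
  - exact: IH.
have qe x y : y \in s -> ip (q x) y.2 = ip x y.2.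
  move=> ys; rewrite ipC ip_sumr (bigD1_seq y) //= ipZr hip.
  rewrite big1_seq => [|y' /andP[y'y y's]]; last by rewrite ipZr (orth y y') ?mulr0 // eq_sym.
  rewrite addr0 /cf; have [->|y0] := eqVneq y.2 0; first by rewrite ip0r !mul0r.
  by field; rewrite normr_eq0.
have qp x : ip x (\sum_(y <- s) y.2) = ip (q x) (\sum_(y <- s) y.2).
  by rewrite !ip_sumr; apply: eq_big_seq => y ys; rewrite qe.
have xq x : ip x (q x) = T x.
  rewrite ip_sumr; apply: eq_bigr => y _; rewrite ipZr /cf; ring.
have qq x : `|q x| ^+ 2 = T x.
  rewrite -hip -xq {2}/q ip_sumr [RHS]ip_sumr; apply: eq_big_seq => y ys.
  by rewrite !ipZr qe.
exists T; split=> [x|z|a b z u w h].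
- rewrite -{1}qq sqr_ge0 /=; have := sqr_ge0 `|x - q x|.
  by rewrite (sqr_normB hip) xq qq; move: (T x) (`|x| ^+ 2) => t n; lra.
- rewrite qp -qq -exprMn -(real_normK (num_real _)) ler_sqr ?nnegrE ?mulr_ge0 //.
  exact: ip_cauchy_schwarz.
- rewrite /T !mulr_sumr -big_split /= big_seq [X in _ <= X]big_seq; apply: ler_sum => y ys.
  rewrite (mulrA a (_ ^+ 2)) (mulrA b (_ ^+ 2)) -mulrDl ler_wpM2r ?invr_ge0 ?sqr_ge0 //.
  exact: h (es _ ys).
Qed.

(* Parseval for the eigenfunction expansion, in the only form needed:
   coefficientwise domination implies domination of the norms. *)
Lemma eigen_domination (a b : R) z u w : 0 <= a -> 0 <= b ->
  (forall l e, eigenpair l e -> ip z e ^+ 2 <= a * ip u e ^+ 2 + b * ip w e ^+ 2) ->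
  `|z| ^+ 2 <= a * `|u| ^+ 2 + b * `|w| ^+ 2.
Proof.
move=> a0 b0 h; pose M := a * `|u| ^+ 2 + b * `|w| ^+ 2.
have M0 : 0 <= M by rewrite addr_ge0 // mulr_ge0 // sqr_ge0.
(* On eigensums the hypothesis enters through finite Bessel sums; density then lets [p] approach [z]
   itself. *)
have zp p : eigensum p -> ip z p <= Num.sqrt M * `|p|.
  move=> [s hs ->]; have [T [T1 T2 T3]] := eigenlist_bessel hs.
  apply: le_trans (ler_norm _) _.
  rewrite -ler_sqr ?nnegrE ?mulr_ge0 ?sqrtr_ge0 // real_normK ?num_real // exprMn sqr_sqrtr //.
  apply: le_trans (T2 z) _; apply: ler_wpM2r; first exact: sqr_ge0.
  apply: le_trans (T3 _ _ _ _ _ h) _.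
  by apply: lerD; apply: ler_wpM2l => //; have /andP[] := T1 u; have /andP[] := T1 w.
suff : `|z| <= Num.sqrt M.
  by rewrite -ler_sqr ?nnegrE ?sqrtr_ge0 // sqr_sqrtr.
apply: norm_le_ip (sqrtr_ge0 _) _.
apply/ler_addgt0Pr => e e0; pose D := `|z| + Num.sqrt M + 1.
have D0 : 0 < D by rewrite ltr_wpDl // addr_ge0 // sqrtr_ge0.
have [p Sp zpd] := eigensum_dense z (divr_gt0 e0 D0); move/ltW: zpd; set d := e / D => zpd.
have d0 : 0 < d by rewrite divr_gt0.
have dD : d * D = e by rewrite /d divfK // gt_eqF.
have pz : `|p| <= `|z| + d.
  have -> : p = z - (z - p) by rewrite opprB addrC subrK.
  by apply: le_trans (ler_normB _ _) _; rewrite lerD2l.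
rewrite -hip -{2}(subrK p z) ipDr.
have h1 : ip z (z - p) <= `|z| * d.
  by apply: le_trans (ip_le hip _ _) _; rewrite ler_wpM2l.
have h2 : ip z p <= Num.sqrt M * (`|z| + d).
  by apply: le_trans (zp _ Sp) _; rewrite ler_wpM2l // sqrtr_ge0.
move: h1 h2 dD d0; rewrite /D -/M; move: (Num.sqrt M) (ip z (z - p)) (ip z p) => s x y.
rewrite /D !mulrDr mulr1; gen_norm; move=> h1 h2 h3 h4.
have -> : e = d * n + d * s + d by rewrite -h3.
by rewrite (mulrC d s) (mulrC d n); lra.
Qed.

End Spectral.

(** * Fractional powers of [A] *)

Lemma powR_interpolation (R : realType) (c s eta : R) : 0 < c -> s < 2^-1 -> 0 < eta ->
  exists2 C : R, 0 <= C & forall l : R, c <= l -> (l `^ s) ^+ 2 <= eta * l + C.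
Proof.
move=> c0 s2 eta0; pose r := 1 - 2 * s; have r0 : 0 < r by rewrite /r; lra.
(* The threshold with L^r = 1 / eta: above it l^(2s) = l l^(-r) <= eta l, below it l^(2s) is at most
   its value at [L] if s >= 0. For s < 0 the value at [c] is a bound throughout. *)
pose L := eta^-1 `^ r^-1; have L0 : 0 < L by rewrite powR_gt0 // invr_gt0.
exists ((c `^ s) ^+ 2 + (L `^ s) ^+ 2) => [|l cl]; first by rewrite addr_ge0 // sqr_ge0.
have l0 : 0 < l := lt_le_trans c0 cl.
have sq (x y : R) : 0 < x -> x `^ s <= y `^ s -> (x `^ s) ^+ 2 <= (y `^ s) ^+ 2.
  by move=> x0 h; rewrite ler_sqr ?nnegrE ?powR_ge0.
have el : 0 <= eta * l by rewrite mulr_ge0 // ltW.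
have [s0|s0] := leP 0 s; last first.
  have h : l `^ s <= c `^ s.
    have E (x : R) : x `^ s = (x `^ (- s))^-1 by rewrite -powRN opprK.
    rewrite !E lef_pV2 ?posrE ?powR_gt0 //.
    by apply: ge0_ler_powR; rewrite ?nnegrE ?oppr_ge0 ?(ltW s0) ?(ltW c0) ?(ltW l0).
  by have := sq _ _ l0 h; have := sqr_ge0 (L `^ s); lra.
have [lL|Ll] := leP l L.
  have h : l `^ s <= L `^ s by apply: ge0_ler_powR; rewrite ?nnegrE ?(ltW l0) ?(ltW L0).
  by have := sq _ _ l0 h; have := sqr_ge0 (c `^ s); lra.
have -> : (l `^ s) ^+ 2 = l * (l `^ r)^-1.
  rewrite -powRN -{2}(powRr1 (ltW l0)) -powRD; last by rewrite (gt_eqF l0) implybT.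
  rewrite expr2 -powRD; last by rewrite (gt_eqF l0) implybT.
  by congr (_ `^ _); rewrite /r; ring.
have : l * (l `^ r)^-1 <= eta * l.
  rewrite mulrC ler_pM2r // -(invrK eta) lef_pV2 ?posrE ?powR_gt0 ?invr_gt0 //.
  have -> : eta^-1 = L `^ r by rewrite /L -powRrM mulVf ?powRr1 ?invr_ge0 ?ltW ?gt_eqF.
  by apply: ge0_ler_powR; rewrite ?nnegrE ?(ltW l0) ?(ltW r0) ?(ltW L0) ?(ltW Ll).
by have := sqr_ge0 (L `^ s); have := sqr_ge0 (c `^ s); lra.
Qed.

Section FractionalPowers.
Context {R : realType} {H : completeNormedModType R}.
Variable ip : {dot H for (@idfun R)}.
Hypothesis hip : forall x : H, ip x x = `|x| ^+ 2.
Variables (domA : set H) (A : H -> H).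
Hypothesis hAsa : self_adjoint ip domA A.
Hypothesis hApos : positive_op ip domA A.
Hypothesis hAcomp : compact_resolvent domA A.

Local Notation V := (Hhalf ip domA A).
Local Notation Ah := (frac_pow ip domA A 2^-1).
Local Notation hn := (hnorm ip domA A).
Local Notation graph := (frac_pow_graph ip domA A).

Lemma frac_pow_graph_uniq s u w w' : graph s u w -> graph s u w' -> w = w'.
Proof.
move=> g g'; apply/subr0_eq; apply: (eigenvectors_total hip hAsa hAcomp) => l e [de Ae].
by rewrite ipBl (g l e) // (g' l e) // subrr.
Qed.

Lemma frac_pow_graph_lin s (a : R) u w u' w' :
  graph s u w -> graph s u' w' -> graph s (a *: u + u') (a *: w + w').
Proof. by move=> g g' l e de Ae; rewrite !ipE (g l e) // (g' l e) //; ring. Qed.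

Lemma frac_powE s u w : graph s u w -> frac_pow ip domA A s u = w.
Proof.
move=> g; apply: (@frac_pow_graph_uniq s u) => //.
by apply: xgetPex; exists w.
Qed.

Lemma AhP u : V u -> graph 2^-1 u (Ah u).
Proof. by move=> Vu; apply: xgetPex. Qed.

Lemma V_lin : lin_subspace V.
Proof.
split; first by exists 0 => l e _ _; rewrite !ip0l mulr0.
by move=> a x y [w gw] [w' gw']; exists (a *: w + w'); exact: frac_pow_graph_lin.
Qed.

Lemma V0 : V 0. Proof. exact: V_lin.1. Qed.

Lemma Ah_lin (a : R) x y : V x -> V y -> Ah (a *: x + y) = a *: Ah x + Ah y.
Proof. by move=> Vx Vy; apply: frac_powE; apply: frac_pow_graph_lin; exact: AhP. Qed.

Lemma VZ (a : R) x : V x -> V (a *: x).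
Proof. by move=> Vx; rewrite -[_ *: _]addr0; apply: V_lin.2 => //; exact: V0. Qed.
Lemma VD x y : V x -> V y -> V (x + y).
Proof. by move=> Vx Vy; rewrite -[x]scale1r; apply: V_lin.2. Qed.
Lemma VN x : V x -> V (- x).
Proof. by move=> Vx; rewrite -scaleN1r; exact: VZ. Qed.
Lemma VB x y : V x -> V y -> V (x - y).
Proof. by move=> Vx Vy; apply: VD => //; exact: VN. Qed.

Lemma Ah0 : Ah 0 = 0.
Proof. by apply: frac_powE => l e _ _; rewrite !ip0l mulr0. Qed.
Lemma AhZ (a : R) x : V x -> Ah (a *: x) = a *: Ah x.
Proof. by move=> Vx; rewrite -[_ *: x]addr0 Ah_lin ?Ah0 ?addr0 //; exact: V0. Qed.
Lemma AhD x y : V x -> V y -> Ah (x + y) = Ah x + Ah y.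
Proof. by move=> Vx Vy; rewrite -[x]scale1r Ah_lin // !scale1r. Qed.
Lemma AhN x : V x -> Ah (- x) = - Ah x.
Proof. by move=> Vx; rewrite -scaleN1r AhZ // scaleN1r. Qed.
Lemma AhB x y : V x -> V y -> Ah (x - y) = Ah x - Ah y.
Proof. by move=> Vx Vy; rewrite AhD ?AhN //; exact: VN. Qed.

Lemma powR_half_sqr (l : R) : 0 <= l -> (l `^ 2^-1) ^+ 2 = l.
Proof. by move=> l0; rewrite powR12_sqrt // sqr_sqrtr. Qed.

Lemma hnorm_interpolation (s eta : R) : s < 2^-1 -> 0 < eta ->
  exists2 C : R, 0 <= C & forall u, V u -> hn s u ^+ 2 <= eta * `|Ah u| ^+ 2 + C * `|u| ^+ 2.
Proof.
move=> s2 eta0; have [c c0 hc] := eigenvalue_lbound hip hAsa hApos hAcomp.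
have [C C0 hC] := powR_interpolation c0 s2 eta0; exists C => // u Vu.
have [[w gw]|nw] := pselect (exists w, graph s u w); last first.
  (* Off the domain of the power, [frac_pow] takes its default value 0 and the estimate is
     trivial. *)
  have -> : hn s u = 0 by rewrite /hnorm /frac_pow xgetPN ?normr0 // => w gw; apply: nw; exists w.
  rewrite expr0n /= addr_ge0 // mulr_ge0 // ?sqr_ge0 //; exact: ltW.
rewrite /hnorm (frac_powE gw).
apply: (eigen_domination hip hAsa hAcomp) => //; first exact: ltW.
move=> l e le; have [->|e0] := eqVneq e 0; first by rewrite !ip0r !expr0n /= !mulr0 addr0.
have cl := hc _ _ le e0; have l0 := lt_le_trans c0 cl; have [de Ae] := le.
rewrite (gw l e) // (AhP Vu de Ae) !exprMn powR_half_sqr ?(ltW l0) // (mulrA eta l) -mulrDl.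
by rewrite ler_wpM2r ?sqr_ge0 ?hC.
Qed.

Lemma poincare : exists2 c : R, 0 < c & forall u, V u -> `|u| <= c * `|Ah u|.
Proof.
have [c c0 hc] := eigenvalue_lbound hip hAsa hApos hAcomp.
exists (Num.sqrt c^-1) => [|u Vu]; first by rewrite sqrtr_gt0 invr_gt0.
rewrite -ler_sqr ?nnegrE ?mulr_ge0 ?sqrtr_ge0 // exprMn sqr_sqrtr ?invr_ge0 ?(ltW c0) //.
(* [eigen_domination] has two terms on the right; the second is taken with coefficient 0 at the zero
   vector. *)
rewrite -[leRHS]addr0 -(mul0r (`|0 : H| ^+ 2)).
apply: (eigen_domination hip hAsa hAcomp); rewrite ?invr_ge0 ?(ltW c0) // => l e le.
have [->|e0] := eqVneq e 0; first by rewrite !ip0r !expr0n /= !mulr0 addr0.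
have cl := hc _ _ le e0; have l0 := lt_le_trans c0 cl; have [de Ae] := le.
rewrite mul0r addr0 (AhP Vu de Ae) exprMn powR_half_sqr ?(ltW l0) // (mulrA _ l) -[leLHS]mul1r.
by rewrite ler_wpM2r ?sqr_ge0 // mulrC ler_pdivlMr // mul1r.
Qed.

Lemma V_eigen l e : eigenpair domA A l e -> e != 0 -> V (l `^ (- 2^-1) *: e) /\ Ah (l `^ (- 2^-1) *: e) = e.
Proof.
move=> le e0; have l0 := eigenvalue_gt0 hip hApos le e0.
have g : graph 2^-1 (l `^ (- 2^-1) *: e) e.
  move=> l' e' de' Ae'; rewrite ipZl; have [ll|ll] := eqVneq l l'.
    by rewrite -ll powRN mulrA divff ?mul1r // gt_eqF // powR_gt0.
  by rewrite (eigenpair_orth hAsa le (conj de' Ae') ll) !mulr0.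
by split; [exists e|exact: frac_powE].
Qed.

(** The range contains the eigenvectors, so it is dense. By [poincare], preimages of a convergent
    sequence form a Cauchy sequence, and the graph is closed because it is defined by
    coefficients. *)
Lemma Ah_surj y : exists u, V u /\ Ah u = y.
Proof.
have [c c0 hc] := poincare.
pose S := [set Ah u | u in V].
have Sl : lin_subspace S.
  split; first by exists 0; [exact: V0|exact: Ah0].
  by move=> a _ _ [u Vu <-] [v Vv <-]; exists (a *: u + v); rewrite ?Ah_lin //; apply: V_lin.2.
have Sd := dense_of_orthogonal hip Sl.
have /Sd {}Sd : forall y, (forall m, S m -> ip y m = 0) -> y = 0.
  move=> z hz; apply: (eigenvectors_total hip hAsa hAcomp) => l e le.
  have [->|e0] := eqVneq e 0; first by rewrite ip0r.
  by have [Ve Ae] := V_eigen le e0; apply: hz; exists (l `^ (- 2^-1) *: e).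
have /choice[u hu] n : exists u, V u /\ `|y - Ah u| < (n.+1%:R^-1 : R).
  have [|_ [u Vu <-] hu] := Sd y (n.+1%:R^-1); first by rewrite invr_gt0 ltr0n.
  by exists u.
have [p hp] : exists p : H, u @ \oo --> p.
  apply: norm_cauchy_cvg => e e0.
  have [|N hN] := @invS_lt R (e / (2 * c)); first by rewrite divr_gt0 // mulr_gt0.
  exists N => n m Nn Nm; have [Vn yn] := hu n; have [Vm ym] := hu m.
  apply: le_lt_trans (hc _ (VB Vn Vm)) _; rewrite AhB //.
  have -> : Ah (u n) - Ah (u m) = (y - Ah (u m)) - (y - Ah (u n)).
    by apply: (ip_inj hip) => t; rewrite !ipE; ring.
  rewrite mulrC -ltr_pdivlMr //; apply: le_lt_trans (ler_normB _ _) _.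
  have -> : e / c = e / (2 * c) + e / (2 * c) by field; rewrite gt_eqF.
  by apply: ltrD; [exact: lt_trans ym (hN _ Nm)|exact: lt_trans yn (hN _ Nn)].
have Ahu : (fun n => Ah (u n)) @ \oo --> y.
  apply/cvgrPdist_lt => e e0; have [N hN] := invS_lt e0.
  by exists N => // n /= Nn; apply: lt_trans (hu n).2 (hN _ Nn).
have g : graph 2^-1 p y.
  move=> l e de Ae.
  have h1 : (fun n => ip (Ah (u n)) e) @ \oo --> ip y e by apply: ip_cvg => //; exact: cvg_cst.
  have h2 : (fun n => ip (Ah (u n)) e) @ \oo --> l `^ 2^-1 * ip p e.
    under eq_fun do rewrite (AhP (hu _).1 de Ae).
    by apply: cvgM; [exact: cvg_cst|apply: ip_cvg => //; exact: cvg_cst].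
  by apply: (cvg_unique _ h1 h2); exact: norm_hausdorff.
by exists p; split; [exists y|exact: frac_powE].
Qed.

Lemma V_dense (z : H) (e : R) : 0 < e -> exists2 m, V m & `|z - m| < e.
Proof.
apply: (dense_of_orthogonal hip V_lin) => y hy.
apply: (eigenvectors_total hip hAsa hAcomp) => l x lx.
have [->|x0] := eqVneq x 0; first by rewrite ip0r.
have l0 := eigenvalue_gt0 hip hApos lx x0.
have [Ve _] := V_eigen lx x0; have := hy _ Ve; rewrite ipZr => /eqP.
by rewrite mulf_eq0 gt_eqF ?powR_gt0 // => /eqP.
Qed.

Lemma Ah_sym x y : V x -> V y -> ip (Ah x) y = ip x (Ah y).
Proof.
move=> Vx Vy; have [c c0 hc] := poincare.
(* first for [Ah x] replaced by an eigensum, then by density *)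
have eig m : eigensum domA A m -> exists2 u, V u & Ah u = m /\ forall z, V z -> ip m z = ip u (Ah z).
  have Ms : lin_subspace [set m | exists2 u, V u & Ah u = m /\ forall z, V z -> ip m z = ip u (Ah z)].
    split; first by exists 0; [exact: V0|split; [exact: Ah0|move=> z _; rewrite !ip0l]].
    move=> a _ _ [u Vu [<- hu]] [v Vv [<- hv]]; exists (a *: u + v); first exact: V_lin.2.
    split; first exact: Ah_lin.
    by move=> z Vz; rewrite !ipE hu // hv.
  move=> [s [_ hs] ->]; elim: s hs => [|y' s IH] hs; first by rewrite big_nil; exact: Ms.1.
  rewrite big_cons -[y'.2]scale1r; apply: Ms.2; last first.
    by apply: IH => t ts; apply: hs; rewrite inE ts orbT.
  have le := hs y' (mem_head _ _).
  have [->|e0] := eqVneq y'.2 0; first exact: Ms.1.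
  have [Ve Ae] := V_eigen le e0; exists (y'.1 `^ (- 2^-1) *: y'.2) => //; split=> // z Vz.
  have [de Aee] := le; have l0 := eigenvalue_gt0 hip hApos le e0.
  by rewrite ipZl !(ipC ip y'.2) (AhP Vz de Aee) powRN mulrA mulVf ?mul1r // gt_eqF // powR_gt0.
apply/subr0_eq; apply: (@small_norm0 R R^o _ (`|y| + c * `|Ah y|)) => e e0.
have [m Sm hm] := eigensum_dense hip hAsa hAcomp (Ah x) e0.
have [u Vu [Au hu]] := eig m Sm.
have -> : ip (Ah x) y - ip x (Ah y) = ip (Ah x - m) y - ip (x - u) (Ah y).
  by rewrite !ipE hu //; ring.
apply: le_trans (ler_normB _ _) _; rewrite mulrDl; apply: lerD.
  by apply: le_trans (ip_cauchy_schwarz hip _ _) _; rewrite mulrC ler_wpM2l // ltW.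
apply: le_trans (ip_cauchy_schwarz hip _ _) _.
rewrite mulrAC ler_wpM2r //; apply: le_trans (hc _ (VB Vx Vu)) _.
by rewrite ler_pM2l // AhB // Au ltW.
Qed.

Variables (domK : set H) (K : H -> H).
Hypothesis hKdom : lin_subspace domK /\ V `<=` domK.
Hypothesis hKlin : linear_on domK K.
Hypothesis hKsym : symmetric_on ip domK K.

(* Hellinger-Toeplitz: K A^{-1/2} is everywhere defined and has the densely
   defined adjoint A^{-1/2} K. *)
Lemma symmetric_bounded : exists2 C : R, 0 < C & forall u, V u -> `|K u| <= C * `|Ah u|.
Proof.
have [c c0 hc] := poincare.
have /choice[J hJ] := Ah_surj.
have VJ y := (hJ y).1; have AJ y := (hJ y).2.
have inj x y : V x -> V y -> Ah x = Ah y -> x = y.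
  move=> Vx Vy h; apply/subr0_eq/eqP; rewrite -normr_le0.
  by apply: le_trans (hc _ (VB Vx Vy)) _; rewrite AhB // h subrr normr0 mulr0.
have Jlin (a : R) x y : J (a *: x + y) = a *: J x + J y.
  by apply: inj => //; [exact: V_lin.2|rewrite Ah_lin // !AJ].
have VK x : V x -> domK x by move=> /(hKdom.2).
(* The functionals x -> (K J x, y), where [J] inverts A^{1/2} and [y] runs over the elements of
   H^{1/2} with |y| <= 1. By symmetry each equals x -> (x, J K y) and is bounded; at a fixed x all
   are bounded by |K J x|. Uniform boundedness then bounds K J. *)
pose F : set (H -> R^o) := [set f | exists2 y, V y /\ `|y| <= 1 & f = fun x => ip (K (J x)) y].
have fE y x : V y -> ip (K (J x)) y = ip x (J (K y)).
  move=> Vy; rewrite hKsym; [|exact: VK|exact: VK].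
  by rewrite -{2}(AJ x) Ah_sym // AJ.
have [||M hM] := @Banach_Steinhauss R H R^o F _ _ 1.
- move=> _ [y [Vy y1] ->]; split=> [r|a x x'].
    exists (r * `|J (K y)|) => x xr; rewrite fE //.
    by apply: le_trans (ip_cauchy_schwarz hip _ _) _; rewrite ler_wpM2r.
  rewrite Jlin hKlin; [|exact: VK|exact: VK]; by rewrite !ipE.
- move=> x; exists (`|K (J x)|) => _ [y [Vy y1] ->].
  by apply: le_trans (ip_cauchy_schwarz hip _ _) _; rewrite -[leRHS]mulr1 ler_wpM2l.
have M0 : 0 <= M by apply: le_trans (hM (fun x => ip (K (J x)) 0) _ 0 _); rewrite ?normr0 //; exists 0; rewrite ?normr0 //; split => //; exact: V0.
have K0 : K 0 = 0.
  have d0 := VK _ V0; have := hKlin 1 d0 d0.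
  by rewrite !scale1r addr0 -{1}[K 0]addr0 => /addrI.
have KZ (a : R) x : V x -> K (a *: x) = a *: K x.
  move=> Vx; have := hKlin a (VK _ Vx) (VK _ V0); by rewrite !addr0 K0 addr0.
have kM x y : `|x| <= 1 -> V y -> `|ip (K (J x)) y| <= M * `|y|.
  move=> x1 Vy; have [->|y0] := eqVneq y 0; first by rewrite ip0r !normr0 mulr0.
  have n0 : 0 < `|y| by rewrite normr_gt0.
  have := hM (fun x => ip (K (J x)) (`|y|^-1 *: y)) _ x x1.
  rewrite ipZr normrM normfV normr_id mulrC ler_pdivrMr //; apply.
  exists (`|y|^-1 *: y) => //; split; first exact: VZ.
  by rewrite normrZ normfV normr_id mulVf ?gt_eqF.
(* [kM] controls pairings with elements of H^{1/2} only; density lets [y] approach [k] itself. *)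
have KJ x : `|x| <= 1 -> `|K (J x)| <= M.
  move=> x1; apply: norm_le_ip => //; apply/ler_addgt0Pr => e e0.
  set k := K (J x); pose D := `|k| + M + 1.
  have D0 : 0 < D by rewrite ltr_wpDl // addr_ge0.
  have [y Vy kyd] := V_dense k (divr_gt0 e0 D0); move/ltW: kyd; set d := e / D => kyd.
  have d0 : 0 < d by rewrite divr_gt0.
  have dD : d * D = e by rewrite /d divfK // gt_eqF.
  have yk : `|y| <= `|k| + d.
    have -> : y = k - (k - y) by rewrite opprB addrC subrK.
    by apply: le_trans (ler_normB _ _) _; rewrite lerD2l.
  rewrite -hip -{2}(subrK y k) ipDr.
  have h1 : ip k (k - y) <= `|k| * d.
    by apply: le_trans (ip_le hip _ _) _; rewrite ler_wpM2l.
  have h2 : ip k y <= M * (`|k| + d).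
    apply: le_trans (ler_norm _) _; apply: le_trans (kM _ _ x1 Vy) _.
    by rewrite ler_wpM2l.
  move: h1 h2 dD d0; rewrite /D; move: (ip k (k - y)) (ip k y) => p q.
  rewrite /D !mulrDr mulr1; gen_norm; move=> h1 h2 h3 h4.
  have -> : e = d * n + d * M + d by rewrite -h3.
  by rewrite (mulrC d M) (mulrC d n); lra.
exists (M + 1) => [|u Vu]; first by rewrite ltr_wpDl.
have [u0|u0] := eqVneq (Ah u) 0.
  have -> : u = 0 by apply: inj; [exact: Vu|exact: V0|rewrite Ah0].
  by rewrite K0 Ah0 !normr0 mulr0.
have n0 : 0 < `|Ah u| by rewrite normr_gt0.
have Ju : J (`|Ah u|^-1 *: Ah u) = `|Ah u|^-1 *: u.
  by apply: inj; [exact: VJ|exact: VZ|rewrite AJ AhZ].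
have := KJ (`|Ah u|^-1 *: Ah u); rewrite Ju KZ // !normrZ normfV normr_id.
rewrite mulVf ?gt_eqF // => /(_ (lexx _)); rewrite mulrC ler_pdivrMr // => /le_trans; apply.
by rewrite ler_pM2r // lerDl.
Qed.

End FractionalPowers.

(** * Comparison of integrals off a null set *)

Section AlmostEverywhere.
Context d (T : measurableType d) (R : realType).
Variable mu : {measure set T -> \bar R}.
Import HBNNSimple.

(** The functions may fail to be measurable, so the proof goes through the supremum over simple
    functions: setting a simple function below [f] to 0 on [N] keeps its integral and puts it below
    [g]. *)
Lemma ge0_le_integral_off_null (f g : T -> \bar R) (N : set T) :
  measurable N -> mu N = 0%E -> (forall x, 0 <= f x)%E -> (forall x, 0 <= g x)%E ->
  (forall x, ~ N x -> f x <= g x)%E -> (\int[mu]_x f x <= \int[mu]_x g x)%E.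
Proof.
move=> mN N0 f0 g0 fg; rewrite !ge0_integralTE //.
apply: ge_ereal_sup => _ /= [h hf <-].
have mNc : measurable (~` N) by exact: measurableC.
have e1 : sintegral mu h = (\int[mu]_x (h x)%:E)%E by rewrite integral_nnsfun // patch_setT.
have e2 : sintegral mu (proj_nnsfun h mNc) = (\int[mu]_(x in ~` N) (h x)%:E)%E.
  by rewrite integral_nnsfun // mrestrict.
have -> : sintegral mu h = sintegral mu (proj_nnsfun h mNc).
  rewrite e1 e2 -setTD; apply: ge0_negligible_integral => //.
    by apply/measurable_realfun.measurable_EFinP.
  by move=> x _; rewrite lee_fin; exact: fun_ge0.
apply: ereal_sup_ubound; exists (proj_nnsfun h mNc) => // x.
rewrite -(mrestrict h mNc) patchE; case: ifPn => [|_] //.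
by rewrite inE => /fg; apply: le_trans; exact: hf.
Qed.

Lemma Rintegral_eq_off_null (f g : T -> R) (D N : set T) :
  measurable N -> mu N = 0%E -> (forall x, D x -> ~ N x -> f x = g x) ->
  \int[mu]_(x in D) f x = \int[mu]_(x in D) g x.
Proof.
move=> mN N0 fg; rewrite Rintegral_mkcond [in RHS]Rintegral_mkcond /Rintegral integralE [in RHS]integralE.
have fg' x : ~ N x -> (f \_ D) x = (g \_ D) x.
  by move=> Nx; rewrite !patchE; case: ifPn => // /set_mem Dx; exact: fg.
by congr (fine (_ - _)%E); apply/eqP; rewrite eq_le; apply/andP; split;
  apply: (ge0_le_integral_off_null mN N0) => x //= Nx; rewrite ?funeposE ?funenegE /= fg'.
Qed.

Lemma le_Rintegral_off_null (f g : T -> R) (D N : set T) : measurable D ->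
  measurable N -> mu N = 0%E ->
  mu.-integrable D (EFin \o f) -> mu.-integrable D (EFin \o g) ->
  (forall x, D x -> ~ N x -> f x <= g x) ->
  \int[mu]_(x in D) f x <= \int[mu]_(x in D) g x.
Proof.
move=> mD mN N0 If Ig fg; rewrite -subr_ge0 -RintegralB //.
(* The absolute value is nonnegative at every point, including those of [N]. *)
rewrite (@Rintegral_eq_off_null _ (fun x => `|g x - f x|) D N) //.
  exact: Rintegral_ge0.
by move=> x Dx Nx; rewrite ger0_norm // subr_ge0 fg.
Qed.

End AlmostEverywhere.

(** * Weakly measurable representatives of Bochner derivatives *)

Section WeakDerivative.
Context {R : realType} {H : completeNormedModType R}.
Variable ip : {dot H for (@idfun R)}.
Hypothesis hip : forall x : H, ip x x = `|x| ^+ 2.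
Local Notation mu := (@lebesgue_measure R).

Definition leb_null (N : set R) : Prop := measurable N /\ mu N = 0%E.

Lemma leb_nullU N N' : leb_null N -> leb_null N' -> leb_null (N `|` N').
Proof.
move=> [mN N0] [mN' N'0]; split; first exact: measurableU.
by apply: null_set_setU.
Qed.

Lemma ae_leb_null (P : R -> Prop) : {ae mu, forall t, P t} ->
  exists2 N, leb_null N & forall t, ~ N t -> P t.
Proof.
move=> [N [mN N0 sN]]; exists N => // t Nt; apply: contrapT => Pt; apply: Nt.
exact: sN.
Qed.

Lemma measurable_simple_comp (s : R -> H) (F : H -> R) : finite_set (range s) ->
  (forall x, measurable (s @^-1` [set x])) -> measurable_fun setT (F \o s).
Proof.
move=> fs ms _ Y mY; rewrite setTI.
have -> : (F \o s) @^-1` Y = \bigcup_(x in range s `&` F @^-1` Y) (s @^-1` [set x]).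
  apply/seteqP; split=> [t /= Yt|t [x [_ /= Yx] /= st]]; last by rewrite /= st.
  by exists (s t) => //; split=> //; exists t.
by apply: fin_bigcup_measurable => // ; exact: finite_setIl.
Qed.

(* The Bochner derivative is only a.e. equal to a weakly Borel function, which
   replaces it here. *)
Lemma L1_derivative_weak (a b : R) (f g : R -> H) : L1_derivative ip a b f g ->
  exists g' : R -> H, [/\ forall phi, mu.-integrable `[a, b] (fun r => (ip (g' r) phi)%:E),
    exists2 N, leb_null N & forall r, a <= r <= b -> ~ N r -> g' r = g r,
    forall r, `|g' r| <= `|g r|,
    mu.-integrable `[a, b] (fun r => `|g r|%:E) &
    forall s s' phi, a <= s -> s <= s' -> s' <= b ->
      ip (f s' - f s) phi = \int[mu]_(r in `[s, s']) ip (g' r) phi].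
Proof.
move=> [[[sn [hs /ae_leb_null [N nN hN]]] Ig] hf]; have [mN N0] := nN.
pose D : set R := `[a, b]%classic `\` N.
have mD : measurable D by apply: measurableD.
(* With the value 0 off [D], all pairings of [g'] are Borel: on [D] they are pointwise limits of
   pairings of simple functions. *)
pose g' : R -> H := fun r => if r \in D then g r else 0.
have mg' phi : measurable_fun setT (fun r => ip (g' r) phi).
  have -> : (fun r => ip (g' r) phi) = (fun r => ip (g r) phi) \_ D.
    by apply/funext => r; rewrite patchE /g'; case: ifP => // _; rewrite ip0l.
  apply/(measurable_restrictT _ mD).
  apply: (@measurable_realfun.measurable_fun_cvg _ _ _ _ (fun n r => ip (sn n r) phi)).
    move=> n; have [h1 h2] := hs n.
    apply: (@measurable_funS _ _ _ _ setT) => //.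
    exact: (measurable_simple_comp (fun x => ip x phi) h1 h2).
  move=> r [Er Nr]; apply: ip_cvg => //; first exact: hN.
  exact: cvg_cst.
have g'le r : `|g' r| <= `|g r| by rewrite /g'; case: ifP => //; rewrite normr0.
have Ig' phi : mu.-integrable `[a, b] (fun r => (ip (g' r) phi)%:E).
  have Ic : mu.-integrable `[a, b] (fun r => (`|g r| * `|phi|)%:E).
    rewrite (_ : (fun r => _) = (fun r => `|phi|%:E * `|g r|%:E)%E).
      exact: integrableZl.
    by apply/funext => r; rewrite mulrC EFinM.
  apply: le_integrable Ic => //.
    apply/measurable_realfun.measurable_EFinP; apply: measurable_funS (mg' phi) => //.
  move=> r _; rewrite /= lee_fin (ger0_norm (mulr_ge0 (normr_ge0 _) (normr_ge0 _))).
  apply: le_trans (ip_cauchy_schwarz hip _ _) _.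
  by rewrite ler_wpM2r.
exists g'; split => //.
  by exists N => // r rab Nr; rewrite /g' mem_set //; split.
move=> s s' phi as_ ss' s'b.
have ft t : a <= t <= b -> ip (f t - f a) phi = \int[mu]_(r in `[a, t]) ip (g' r) phi.
  move=> /[dup] tab /hf ->; apply: (@Rintegral_eq_off_null _ _ _ mu _ _ _ N) => //.
  move=> r /= rt Nr; rewrite /g' mem_set //; split => //=.
  move: rt; rewrite !in_itv /= => /andP[-> rt] /=; apply: le_trans rt _.
  by case/andP: tab.
have -> : f s' - f s = (f s' - f a) - (f s - f a) by rewrite opprB addrA subrK.
rewrite ipBl !ft; [|by rewrite as_ (le_trans ss')|by rewrite (le_trans as_)].
rewrite Rintegral_itvB ?bnd_simp //.
  apply: Rintegral_itv_obnd_cbnd; apply: integrableS (Ig' phi) => //.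
  by apply: subset_itv; rewrite bnd_simp.
apply: integrableS (Ig' phi) => //.
by apply: subset_itv; rewrite bnd_simp.
Qed.

End WeakDerivative.

(** * One-sided differential inequalities *)

Section Slopes.
Context {R : realType}.
Local Notation mu := (@lebesgue_measure R).
Implicit Types (a b t s : R) (F G L M h l m : R -> R).

Lemma le_of_eq (x y : R) : x = y -> x <= y.
Proof. by move->. Qed.

Definition primitive a b L l : Prop := mu.-integrable `[a, b] (EFin \o l) /\
  forall s s', a <= s -> s <= s' -> s' <= b -> L s' - L s = \int[mu]_(r in `[s, s']) l r.

(* [h] bounds the upper derivative of [G] up to an arbitrarily small multiple of
   the increments of [M]. *)
Definition slope_le a b M G h : Prop :=
  forall t, a <= t <= b -> forall e, 0 < e -> exists2 d, 0 < d &
    forall s s', a <= s -> s <= t -> t <= s' -> s' <= b -> t - s < d -> s' - t < d ->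
      G s' - G s <= h t * (s' - s) + e * (M s' - M s).

(* [G] is the integral of [lam], up to an error whose density is bounded by [k]. *)
Definition adiff a b M m G (lam k : R -> R) : Prop :=
  forall t, a <= t <= b -> exists L l, primitive a b L l /\
    forall e, 0 < e -> exists2 d, 0 < d & forall s, a <= s <= b -> `|s - t| < d ->
      `|G s - G t - (L s - L t)| <= k t * `|s - t| + e * `|M s - M t| /\
      `|l s - lam s| <= e * m s.

Definition continuous_on a b F : Prop := forall t, a <= t <= b ->
  forall e, 0 < e -> exists2 d, 0 < d & forall s, a <= s <= b -> `|s - t| < d -> `|F s - F t| < e.

(** An error in |s - t| is then also an error in the increments of [M]. In use [M] is a primitive of
    1 plus an integrable majorant of the derivatives, and the summand 1 is there for this
    property. *)
Definition gauge a b M : Prop := forall s s', a <= s -> s <= s' -> s' <= b -> s' - s <= M s' - M s.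

Lemma subitv_integrable a b s s' l : mu.-integrable `[a, b] (EFin \o l) ->
  a <= s -> s' <= b -> mu.-integrable `[s, s'] (EFin \o l).
Proof.
move=> Il as_ s'b; apply: integrableS Il => //.
by apply: subset_itv; rewrite bnd_simp.
Qed.

Lemma integrable_primitive a b l : mu.-integrable `[a, b] (EFin \o l) -> exists L, primitive a b L l.
Proof.
move=> Il; exists (fun t => \int[mu]_(r in `[a, t]) l r); split => // s s' as_ ss' s'b.
rewrite Rintegral_itvB ?bnd_simp //.
  by apply: Rintegral_itv_obnd_cbnd; apply: integrableS (subitv_integrable Il as_ s'b) => //; apply: subset_itv; rewrite bnd_simp.
exact: subitv_integrable Il _ _.
Qed.

Lemma primitiveD a b L l L' l' : primitive a b L l -> primitive a b L' l' ->
  primitive a b (fun t => L t + L' t) (fun t => l t + l' t).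
Proof.
move=> [Il hL] [Il' hL']; split=> [|s s' as_ ss' s'b].
  by rewrite (_ : _ \o _ = ((EFin \o l) \+ (EFin \o l'))%E) //; exact: integrableD.
rewrite RintegralD //; [|exact: subitv_integrable Il _ _|exact: subitv_integrable Il' _ _].
by rewrite -hL // -hL' //; ring.
Qed.

Lemma primitiveZ a b L l (c : R) : primitive a b L l ->
  primitive a b (fun t => c * L t) (fun t => c * l t).
Proof.
move=> [Il hL]; split=> [|s s' as_ ss' s'b].
  by rewrite (_ : _ \o _ = (fun x => c%:E * (EFin \o l) x)%E) //; exact: integrableZl.
by rewrite RintegralZl // -?hL //; [ring|exact: subitv_integrable Il _ _].
Qed.

Lemma primitive_cst a b (c : R) : primitive a b (fun t => c * t) (fun=> c).
Proof.
split=> [|s s' as_ ss' s'b].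
  apply: measurable_bounded_integrable => //.
    by rewrite /= lebesgue_measure_itv /=; case: ifP => _; rewrite ?ltry // -EFinB ltry.
  exists `|c|; split; rewrite ?num_real // => x cx y _ /=; exact: ltW.
rewrite Rintegral_cst //= lebesgue_measure_itv /= lte_fin -mulrBr.
by case: ltP => [_|s's] /=; rewrite -?EFinB //= (_ : s' = s) ?subrr //; apply/eqP; rewrite eq_le ss' s's.
Qed.

Lemma primitive_le a b L l L' l' N s s' : primitive a b L l -> primitive a b L' l' ->
  leb_null N -> a <= s -> s <= s' -> s' <= b ->
  (forall r, s <= r <= s' -> ~ N r -> l r <= l' r) -> L s' - L s <= L' s' - L' s.
Proof.
move=> [Il hL] [Il' hL'] [mN N0] as_ ss' s'b ll'.
have I1 := subitv_integrable Il as_ s'b; have I2 := subitv_integrable Il' as_ s'b.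
rewrite hL // hL' //; apply: (@le_Rintegral_off_null _ _ _ mu _ _ _ N) => //.
Qed.

Lemma leb_null0 : leb_null (set0 : set R).
Proof. by split; [exact: measurable0|exact: measure0]. Qed.

Lemma primitive_gauge a b M m : primitive a b M m -> (forall r, 1 <= m r) -> gauge a b M.
Proof.
move=> pM m1 s s' as_ ss' s'b; have := primitive_le (primitive_cst a b 1) pM leb_null0 as_ ss' s'b.
by rewrite !mul1r; apply.
Qed.

Lemma gauge_le a b M s s' : gauge a b M -> a <= s -> s <= s' -> s' <= b -> M s <= M s'.
Proof.
move=> gM as_ ss' s'b; have := gM _ _ as_ ss' s'b; rewrite -[M s <= _]subr_ge0.
by apply: le_trans; rewrite subr_ge0.
Qed.

(** Near [t] the density of the local primitive is close to [lam], and lam <= h - k almost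
    everywhere. By continuity of [h] and [k] the increments of the primitive have slope at most
    [h t - k t], and the error [k t] of the approximation restores [h t]. *)
Lemma adiff_slope a b M m G lam k h N : primitive a b M m -> (forall r, 1 <= m r) ->
  adiff a b M m G lam k -> continuous_on a b h -> continuous_on a b k ->
  leb_null N -> (forall r, a <= r <= b -> ~ N r -> lam r + k r <= h r) ->
  slope_le a b M G h.
Proof.
move=> pM m1 dG ch ck nN lh t tab e e0; have gM := primitive_gauge pM m1.
have [L [l [pL hL]]] := dG t tab.
(* One quarter for the remainder of [G], one each for the distance of [l] from [lam] and for the
   oscillations of [h] and [k]; the last two become errors in [M] because m >= 1. *)
have e4 : 0 < e / 4 by rewrite divr_gt0.
have [d1 d10 hd1] := hL _ e4; have [d2 d20 hd2] := ch t tab _ e4; have [d3 d30 hd3] := ck t tab _ e4.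
exists (Num.min d1 (Num.min d2 d3)) => [|s s' as_ st ts' s'b]; first by rewrite !lt_min d10 d20.
rewrite !lt_min => /and3P[s1 s2 s3] /and3P[s1' s2' s3'].
have ss' := le_trans st ts'.
have sb : s <= b := le_trans ss' s'b. have as' : a <= s' := le_trans as_ ss'.
have [hs _] : `|G s - G t - (L s - L t)| <= k t * `|s - t| + e / 4 * `|M s - M t| /\ `|l s - lam s| <= e / 4 * m s.
  by apply: hd1; rewrite ?as_ // distrC ger0_norm // subr_ge0.
have [hs' _] : `|G s' - G t - (L s' - L t)| <= k t * `|s' - t| + e / 4 * `|M s' - M t| /\ `|l s' - lam s'| <= e / 4 * m s'.
  by apply: hd1; rewrite ?as' // ger0_norm // subr_ge0.
case/andP: tab => at_ tb.
move: hs hs'; rewrite (distrC s) (distrC (M s)) (ger0_norm (_ : 0 <= t - s)) ?subr_ge0 // (ger0_norm (_ : 0 <= s' - t)) ?subr_ge0 //.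
rewrite (ger0_norm (_ : 0 <= M t - M s)) ?subr_ge0 ?(gauge_le gM) // (ger0_norm (_ : 0 <= M s' - M t)) ?subr_ge0 ?(gauge_le gM) //.
move=> /ler_normlP[hs1 _] /ler_normlP[_ hs'2].
have pR := primitiveD (primitive_cst a b (h t - k t)) (primitiveZ (3 * (e / 4)) pM).
have LM : L s' - L s <= (h t - k t) * (s' - s) + 3 * (e / 4) * (M s' - M s).
  apply: le_trans (primitive_le pL pR nN as_ ss' s'b _) _; last by apply: le_of_eq; ring.
  move=> r /andP[sr rs'] Nr.
  have rab : a <= r <= b by rewrite (le_trans as_ sr) (le_trans rs' s'b).
  have rt d : t - s < d -> s' - t < d -> `|r - t| < d.
    by move=> h1 h2; rewrite ltr_norml; apply/andP; split; lra.
  have [_ /ler_normlP[_ hl]] := hd1 r rab (rt _ s1 s1').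
  have /ltr_normlP[_ hh] := hd2 r rab (rt _ s2 s2').
  have /ltr_normlP[hk _] := hd3 r rab (rt _ s3 s3').
  have := lh r rab Nr; have := m1 r; move: (e / 4) e4 hl hh hk => f f0 hl hh hk m1r lk.
  have : f <= f * m r by rewrite -{1}[f]mulr1 ler_pM2l.
  rewrite -mulrA; move: (f * m r) hl => fm hl hfm; lra.
have eE : e = 4 * (e / 4) by field.
move: hs1 hs'2 LM; rewrite [X in _ -> _ -> _ -> _ <= _ + X * _]eE; move: (e / 4) => f.
rewrite !mulrBr !mulrBl; lra.
Qed.

Lemma slope_le_sub a b M G h a' b' : a <= a' -> b' <= b -> slope_le a b M G h -> slope_le a' b' M G h.
Proof.
move=> aa' b'b hG t /andP[at_ tb] e e0.
have [|d d0 hd] := hG t _ e e0; first by rewrite (le_trans aa' at_) (le_trans tb b'b).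
exists d => // s s' a's st ts' s'b'; apply: hd => //; first exact: le_trans a's.
exact: le_trans b'b.
Qed.

(** A supremum argument for G x - G a' <= e (M x - M a'). As [slope_le] bounds increments that
    straddle [t], the inequality passes directly from points below the supremum to points above it;
    this takes the place of continuity of [G]. *)
Lemma slope_le_nonincreasing a b M G : gauge a b M -> slope_le a b M G (fun=> 0) ->
  forall s s', a <= s -> s <= s' -> s' <= b -> G s' <= G s.
Proof.
have main a' b' : a' <= b' -> gauge a' b' M -> slope_le a' b' M G (fun=> 0) -> G b' <= G a'.
  move=> ab gM hG; suff key e : 0 < e -> G b' - G a' <= e * (M b' - M a').
    rewrite -subr_le0; apply/ler_addgt0Pr => e e0; rewrite add0r.
    have M0 : 0 <= M b' - M a' by rewrite subr_ge0 (gauge_le gM).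
    apply: le_trans (key (e / (M b' - M a' + 1)) _) _; first by rewrite divr_gt0 // ltr_wpDl.
    rewrite mulrAC ler_pdivrMr ?ltr_wpDl // ler_pM2l // lerDl //.
  move=> e0; pose S : set R := [set x | a' <= x <= b' /\ G x - G a' <= e * (M x - M a')].
  have Sa : S a' by split; [rewrite lexx|rewrite !subrr mulr0].
  have hsS : has_sup S by split; [exists a'|exists b' => x [/andP[]]].
  pose c := sup S.
  have ac : a' <= c by apply: ub_le_sup => //; exact: hsS.2.
  have cb : c <= b' by apply: ge_sup; [exists a'|move=> x [/andP[]]].
  have [|d d0 hd] := hG c _ e e0; first by rewrite ac.
  have [x [/andP[a'x xb'] Gx] cx] := sup_adherent d0 hsS.
  have xc : x <= c by apply: ub_le_sup; [exact: hsS.2|split => //; rewrite a'x].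
  have step y : c <= y -> y <= b' -> y - c < d -> S y.
    move=> cy yb' ycd; split; first by rewrite (le_trans ac cy).
    have := hd x y a'x xc cy yb' _ ycd; rewrite mul0r add0r.
    have cxd : c - x < d by rewrite ltrBlDr addrC -ltrBlDr.
    by move=> /(_ cxd); rewrite !mulrBr; move: Gx; rewrite !mulrBr; lra.
  have [cb'|b'c] := ltP c b'.
    pose y := Num.min b' (c + d / 2).
    have cy : c < y by rewrite lt_min cb' ltrDl divr_gt0.
    have yd : y <= c + d / 2 by rewrite ge_min lexx orbT.
    have : S y by apply: step; [exact: ltW|rewrite ge_min lexx|lra].
    by move=> /(ub_le_sup hsS.2); rewrite -/c leNgt cy.
  have cE : c = b' by apply/eqP; rewrite eq_le cb.
  by have [] : S b' by apply: step; rewrite ?cE ?subrr.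
move=> gM hG s s' as_ ss' s'b; apply: main => //.
  by move=> u v su uv vs'; apply: gM => //; [exact: le_trans su|exact: le_trans vs' _].
exact: slope_le_sub hG.
Qed.

Lemma slope_leW a b M G h h' : (forall t, a <= t <= b -> h t <= h' t) ->
  slope_le a b M G h -> slope_le a b M G h'.
Proof.
move=> hh' hG t tab e e0; have [d d0 hd] := hG t tab e e0; exists d => // s s' as_ st ts' s'b ds ds'.
apply: le_trans (hd s s' as_ st ts' s'b ds ds') _; rewrite lerD2r ler_wpM2r ?hh' //.
by rewrite subr_ge0 (le_trans st ts').
Qed.

Lemma slope_leD a b M G G' h h' : slope_le a b M G h -> slope_le a b M G' h' ->
  slope_le a b M (fun t => G t + G' t) (fun t => h t + h' t).
Proof.
move=> hG hG' t tab e e0; have e2 : 0 < e / 2 by rewrite divr_gt0.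
have [d d0 hd] := hG t tab _ e2; have [d' d'0 hd'] := hG' t tab _ e2.
exists (Num.min d d') => [|s s' as_ st ts' s'b]; first by rewrite lt_min d0.
rewrite !lt_min => /andP[s1 s2] /andP[s1' s2'].
have h1 := hd s s' as_ st ts' s'b s1 s1'; have h2 := hd' s s' as_ st ts' s'b s2 s2'.
rewrite opprD addrACA; apply: le_trans (lerD h1 h2) _; by apply: le_of_eq; field.
Qed.

Lemma slope_le_linear a b M (c : R) : gauge a b M -> slope_le a b M (fun t => c * t) (fun=> c).
Proof.
move=> gM t tab e e0; exists 1 => // s s' as_ st ts' s'b _ _.
rewrite -mulrBr lerDl; apply: mulr_ge0; first exact: ltW.
by rewrite subr_ge0; apply: (gauge_le gM) => //; exact: le_trans st ts'.
Qed.

Lemma expR_sub_le (x y : R) : expR x - expR y <= expR x * (x - y).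
Proof.
have := expR_ge1Dx (y - x).
rewrite expRB -(ler_pM2l (expR_gt0 x)) mulrCA divff ?gt_eqF ?expR_gt0 // mulr1.
rewrite mulrDr mulr1 !mulrBr; lra.
Qed.

(** Only upper slopes of [F] and [G] are known. By convexity of the exponential an increment of
    [expR \o F] is at most [expR (F s')] times the increment of [F], and the factor [G s] in front
    of it has to be nonnegative to preserve this inequality. *)
Lemma slope_le_mul_expR a b M G F h f : gauge a b M ->
  continuous_on a b G -> continuous_on a b (expR \o F) ->
  (forall t, a <= t <= b -> 0 <= G t) ->
  slope_le a b M G h -> slope_le a b M F f ->
  slope_le a b M (fun t => G t * expR (F t)) (fun t => expR (F t) * (h t + G t * f t)).
Proof.
move=> gM cG cF G0 hG hF t tab e e0.
have g0 := G0 t tab; have E0 : 0 < expR (F t) by exact: expR_gt0.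
set g := G t in g0 *; set E := expR (F t) in E0 *.
(* [e1] limits the deviation of [expR \o F] and of the product from their values at [t], [e2] the
   slope errors; [e3] is the oscillation of [G] and of [expR \o F] that secures [e1]. *)
pose A := `|h t| + `|f t| + 1.
have A0 : 0 < A by rewrite ltr_wpDl // addr_ge0.
pose e1 := Num.min 1 (e / (2 * A)).
have e10 : 0 < e1 by rewrite lt_min ltr01 divr_gt0 // mulr_gt0.
have e11 : e1 <= 1 by rewrite ge_min lexx.
have e1e : e1 * A <= e / 2.
  rewrite -ler_pdivlMr // /e1 (_ : e / 2 / A = e / (2 * A)); last by field; rewrite gt_eqF.
  by rewrite ge_min lexx orbT.
pose P := E + g * E + 2.
have P0 : 0 < P by rewrite ltr_wpDl // addr_ge0 ?(ltW E0) // mulr_ge0 // ltW.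
pose e2 := e / (2 * P).
have e20 : 0 < e2 by rewrite divr_gt0 // mulr_gt0.
have e2e : e2 * P = e / 2 by rewrite /e2; field; rewrite gt_eqF.
pose Q := 1 + g + E.
have Q0 : 0 < Q by rewrite /Q -addrA ltr_pwDl // addr_ge0 // ltW.
pose e3 := e1 / Q.
have e30 : 0 < e3 by rewrite divr_gt0.
have e3Q : e3 * Q = e1 by rewrite /e3 divfK // gt_eqF.
have e31 : e3 <= e1 by rewrite -e3Q ler_peMr ?(ltW e30) // /Q -addrA lerDl addr_ge0 // ltW.
have [d1 d10 hd1] := hG t tab _ e20; have [d2 d20 hd2] := hF t tab _ e20.
have [d3 d30 hd3] := cG t tab _ e30; have [d4 d40 hd4] := cF t tab _ e30.
exists (Num.min (Num.min d1 d2) (Num.min d3 d4)) => [|s s' as_ st ts' s'b]; first by rewrite !lt_min d10 d20 d30.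
rewrite !lt_min => /andP[/andP[s1 s2] /andP[s3 s4]] /andP[/andP[s1' s2'] /andP[s3' s4']].
have ss' := le_trans st ts'.
have sab : a <= s <= b by rewrite as_ (le_trans ss').
have s'ab : a <= s' <= b by rewrite s'b (le_trans as_).
have hGs := hd1 s s' as_ st ts' s'b s1 s1'; have hFs := hd2 s s' as_ st ts' s'b s2 s2'.
have /ltr_normlP[gs1 gs2] : `|G s - g| < e3 by apply: hd3 => //; rewrite distrC ger0_norm ?subr_ge0.
have /ltr_normlP[es1 es2] : `|expR (F s') - E| < e3 by apply: hd4 => //; rewrite ger0_norm ?subr_ge0.
have Gs0 := G0 s sab; have Es0 := expR_gt0 (F s').
have Ee := expR_sub_le (F s') (F s).
set D := s' - s in hGs hFs *; set DM := M s' - M s in hGs hFs *.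
have D0 : 0 <= D by rewrite subr_ge0.
have DDM : D <= DM := gM _ _ as_ ss' s'b.
have DM0 : 0 <= DM := le_trans D0 DDM.
set x := expR (F s') in es1 es2 Es0 Ee *; set y := G s in gs1 gs2 Gs0 hGs *.
have xy : `|y * x - g * E| <= e1.
  have -> : y * x - g * E = y * (x - E) + (y - g) * E by ring.
  apply: le_trans (ler_normD _ _) _; rewrite !normrM (ger0_norm Gs0) (gtr0_norm E0).
  have h1 : `|x - E| <= e3 by apply/ler_normlP; split; lra.
  have h2 : `|y - g| <= e3 by apply/ler_normlP; split; lra.
  have h3 : y <= 1 + g by lra.
  rewrite -e3Q /Q mulrDr mulrC; apply: lerD; last by rewrite ler_pM2r.
  by apply: ler_pM.
have t1 : G s' * x - y * expR (F s) <= x * (h t * D + e2 * DM) + y * x * (f t * D + e2 * DM).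
  have -> : G s' * x - y * expR (F s) = x * (G s' - y) + y * (x - expR (F s)) by ring.
  apply: lerD; first by rewrite ler_pM2l.
  apply: (le_trans (ler_wpM2l Gs0 Ee)); rewrite mulrA; apply: ler_wpM2l => //.
  by apply: mulr_ge0 => //; exact: ltW.
apply: le_trans t1 _.
have -> : x * (h t * D + e2 * DM) + y * x * (f t * D + e2 * DM) =
   E * (h t + g * f t) * D + ((x - E) * h t + (y * x - g * E) * f t) * D + e2 * (x + y * x) * DM by ring.
rewrite -addrA lerD2l.
have t2 : ((x - E) * h t + (y * x - g * E) * f t) * D <= e / 2 * DM.
  apply: (@le_trans _ _ (e / 2 * D)); last by rewrite ler_wpM2l // divr_ge0 // ltW.
  rewrite ler_wpM2r //; apply: le_trans e1e; apply: le_trans (ler_norm _) _.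
  apply: le_trans (ler_normD _ _) _; rewrite !normrM /A !mulrDr mulr1.
  have h1 : `|x - E| <= e1 by apply/ler_normlP; split; lra.
  rewrite -[leLHS]addr0; apply: lerD; last exact: ltW.
  by apply: lerD; rewrite ler_wpM2r.
have t3 : e2 * (x + y * x) * DM <= e / 2 * DM.
  rewrite ler_wpM2r // -e2e ler_pM2l // /P.
  by move/ler_normlP: xy => [_]; lra.
by rewrite [in leRHS](splitr e) [leRHS]mulrDl; exact: lerD.
Qed.

End Slopes.

(** * Continuity on a closed interval *)

Section ContinuityOn.
Context {R : realType} {H : completeNormedModType R}.

(** Neighbourhoods relative to the closed interval, so that at its ends only one-sided limits are
    meant. *)
Definition seg_nbhs (a b t : R) : set_system R := within [set x | a <= x <= b] (nbhs t).

Definition cvg_on (W : normedModType R) (a b : R) (f : R -> W) : Prop :=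
  forall t, a <= t <= b -> f @ seg_nbhs a b t --> f t.

Definition hcontinuous_on (a b : R) (f : R -> H) : Prop := forall t, a <= t <= b ->
  forall e, 0 < e -> exists2 d, 0 < d & forall s, a <= s <= b -> `|s - t| < d -> `|f s - f t| < e.

Lemma seg_nbhs_filter (a b t : R) : Filter (seg_nbhs a b t).
Proof. exact: within_filter. Qed.

Lemma cvg_on_hcontinuous a b (f : R -> H) : cvg_on a b f -> hcontinuous_on a b f.
Proof.
move=> h t tab e e0; have FF := seg_nbhs_filter a b t.
have /cvgrPdist_lt /(_ e e0) := h t tab.
rewrite /seg_nbhs /= => /nbhs_ballP [d /= d0 hd]; exists d => // s sab st.
by rewrite distrC; apply: hd => //=; rewrite -ball_normE /= distrC.
Qed.

Lemma cvg_on_continuous a b (f : R -> R) : @cvg_on R a b f -> continuous_on a b f.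
Proof.
move=> h t tab e e0; have FF := seg_nbhs_filter a b t.
have /cvgrPdist_lt /(_ e e0) := h t tab.
rewrite /seg_nbhs /= => /nbhs_ballP [d /= d0 hd]; exists d => // s sab st.
by rewrite distrC; apply: hd => //=; rewrite -ball_normE /= distrC.
Qed.

Lemma within_cvg_on (W : normedModType R) (a b a' b' : R) (f : R -> W) : a <= a' -> b' <= b ->
  {within `[a, b], continuous f} -> cvg_on a' b' f.
Proof.
move=> aa' b'b cf t /andP[a't tb'].
have tab : `[a, b]%classic t by rewrite /= in_itv /= (le_trans aa') // (le_trans tb').
have /subspace_continuousP/(_ t tab) := cf; apply: cvg_trans.
apply: cvg_app => P wP; change (nbhs t (fun x => a' <= x <= b' -> P x)).
have wP' : nbhs t (fun x => `[a, b]%classic x -> P x) by exact: wP.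
apply: filterS wP' => x hx /andP[ax xb].
by apply: hx; rewrite /= in_itv /= (le_trans aa') // (le_trans xb).
Qed.

End ContinuityOn.

(** * Linear rules for derivatives known almost everywhere *)

Section AdiffCalculus.
Context {R : realType}.
Local Notation mu := (@lebesgue_measure R).
Variables (a b : R) (M m : R -> R).
Hypotheses (pM : primitive a b M m) (m1 : forall r, 1 <= m r).
Implicit Types (G lam k : R -> R).

Lemma gauge_dist s t : a <= s <= b -> a <= t <= b -> `|s - t| <= `|M s - M t|.
Proof.
have gM := primitive_gauge pM m1.
move=> /andP[as_ sb] /andP[at_ tb]; have [st|ts] := leP s t.
  rewrite distrC (distrC (M s)) !ger0_norm ?subr_ge0 //; last exact: (gauge_le gM).
  exact: gM.
rewrite !ger0_norm ?subr_ge0 ?(ltW ts) //; last by apply: (gauge_le gM) => //; exact: ltW.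
by apply: gM => //; exact: ltW.
Qed.

Lemma adiffD G lam k G' lam' k' : adiff a b M m G lam k -> adiff a b M m G' lam' k' ->
  adiff a b M m (fun t => G t + G' t) (fun t => lam t + lam' t) (fun t => k t + k' t).
Proof.
move=> hG hG' t tab; have [L [l [pL hL]]] := hG t tab; have [L' [l' [pL' hL']]] := hG' t tab.
exists (fun t => L t + L' t), (fun t => l t + l' t); split; first exact: primitiveD.
move=> e e0; have e2 : 0 < e / 2 by rewrite divr_gt0.
have [d d0 hd] := hL _ e2; have [d' d'0 hd'] := hL' _ e2.
exists (Num.min d d') => [|s sab]; first by rewrite lt_min d0.
rewrite lt_min => /andP[s1 s2]; have [h1 h2] := hd s sab s1; have [h3 h4] := hd' s sab s2.
split.
  rewrite (_ : _ - _ = (G s - G t - (L s - L t)) + (G' s - G' t - (L' s - L' t))); last by ring.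
  apply: le_trans (ler_normD _ _) _; apply: le_trans (lerD h1 h3) _.
  by apply: le_of_eq; field.
rewrite (_ : _ - _ = (l s - lam s) + (l' s - lam' s)); last by ring.
apply: le_trans (ler_normD _ _) _; apply: le_trans (lerD h2 h4) _.
by apply: le_of_eq; field.
Qed.

Lemma adiffZ (c : R) G lam k : adiff a b M m G lam k ->
  adiff a b M m (fun t => c * G t) (fun t => c * lam t) (fun t => `|c| * k t).
Proof.
move=> hG t tab; have [L [l [pL hL]]] := hG t tab.
exists (fun t => c * L t), (fun t => c * l t); split; first exact: primitiveZ.
move=> e e0; have c1 : 0 < `|c| + 1 by rewrite ltr_wpDl.
have [d d0 hd] := hL _ (divr_gt0 e0 c1); exists d => // s sab st; have [h1 h2] := hd s sab st.
have ce : `|c| * (e / (`|c| + 1)) <= e.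
  by rewrite mulrA ler_pdivrMr // mulrC ler_pM2l // lerDl.
rewrite -!mulrBr !normrM; split.
  apply: le_trans (ler_wpM2l (normr_ge0 c) h1) _; rewrite mulrDr mulrA lerD2l mulrA.
  by rewrite ler_wpM2r.
apply: le_trans (ler_wpM2l (normr_ge0 c) h2) _; rewrite mulrA ler_wpM2r //.
exact: le_trans ler01 (m1 s).
Qed.

Lemma adiff_ext G lam k G' lam' k' : G =1 G' -> lam =1 lam' -> k =1 k' ->
  adiff a b M m G lam k -> adiff a b M m G' lam' k'.
Proof. by move=> /funext -> /funext -> /funext ->. Qed.

Lemma adiff_classic G lam k : continuous_on a b lam ->
  (forall t, a <= t <= b -> forall e, 0 < e -> exists2 d, 0 < d & forall s, a <= s <= b -> `|s - t| < d ->
    `|G s - G t - lam t * (s - t)| <= k t * `|s - t| + e * `|M s - M t|) ->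
  adiff a b M m G lam k.
Proof.
move=> cl hG t tab; exists (fun s => lam t * s), (fun=> lam t); split; first exact: primitive_cst.
move=> e e0; have [d d0 hd] := hG t tab e e0; have [d' d'0 hd'] := cl t tab e e0.
exists (Num.min d d') => [|s sab]; first by rewrite lt_min d0.
rewrite lt_min => /andP[s1 s2]; split; first by rewrite -mulrBr; exact: hd.
rewrite distrC; apply: le_trans (ltW (hd' s sab s2)) _.
by rewrite -{1}[e]mulr1 ler_pM2l.
Qed.

End AdiffCalculus.

(** * Paths in [H] with weak derivatives *)

Section WeakPaths.
Context {R : realType} {H : completeNormedModType R}.
Variable ip : {dot H for (@idfun R)}.
Hypothesis hip : forall x : H, ip x x = `|x| ^+ 2.
Local Notation mu := (@lebesgue_measure R).
Variables (a b : R).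

Definition wderiv (m : R -> R) (Y Z : R -> H) : Prop :=
  (forall phi, primitive a b (fun t => ip (Y t) phi) (fun r => ip (Z r) phi)) /\
  forall r, `|Z r| <= m r.

Definition hderiv (u ut : R -> H) : Prop :=
  forall t, a <= t <= b -> forall e, 0 < e -> exists2 d, 0 < d & forall s, a <= s <= b ->
    `|s - t| < d -> `|u s - u t - (s - t) *: ut t| <= e * `|s - t|.

Lemma wderivB m m' Y Z Y' Z' : wderiv m Y Z -> wderiv m' Y' Z' ->
  wderiv (fun r => m r + m' r) (fun t => Y t - Y' t) (fun t => Z t - Z' t).
Proof.
move=> [h1 h2] [h1' h2']; split=> [phi|r].
  have := primitiveD (h1 phi) (primitiveZ (-1) (h1' phi)).
  by congr (primitive a b _ _); apply/funext => t; rewrite ipBl mulN1r.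
by apply: le_trans (ler_normB _ _) _; exact: lerD.
Qed.

Lemma hderivB u ut v vt : hderiv u ut -> hderiv v vt ->
  hderiv (fun t => u t - v t) (fun t => ut t - vt t).
Proof.
move=> hu hv t tab e e0; have e2 : 0 < e / 2 by rewrite divr_gt0.
have [d d0 hd] := hu t tab _ e2; have [d' d'0 hd'] := hv t tab _ e2.
exists (Num.min d d') => [|s sab]; first by rewrite lt_min d0.
rewrite lt_min => /andP[s1 s2].
rewrite (_ : _ - _ = (u s - u t - (s - t) *: ut t) - (v s - v t - (s - t) *: vt t)); last first.
  apply: (ip_inj hip) => z; rewrite !ipE; ring.
apply: le_trans (ler_normB _ _) _; apply: le_trans (lerD (hd s sab s1) (hd' s sab s2)) _.
by apply: le_of_eq; field.
Qed.

Lemma hderiv_continuous u ut : hderiv u ut -> hcontinuous_on a b u.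
Proof.
move=> hu t tab e e0; have [d d0 hd] := hu t tab 1 ltr01.
pose C := `|ut t| + 1; have C0 : 0 < C by rewrite ltr_wpDl.
exists (Num.min d (e / C)) => [|s sab]; first by rewrite lt_min d0 divr_gt0.
rewrite lt_min => /andP[s1 s2].
rewrite -(subrK ((s - t) *: ut t) (u s - u t)).
apply: le_lt_trans (ler_normD _ _) _; rewrite normrZ.
apply: (@le_lt_trans _ _ (C * `|s - t|)).
  have := hd s sab s1; rewrite /C mulrDl (mulrC `|s - t|); gen_norm; lra.
by rewrite mulrC -ltr_pdivlMr.
Qed.

Variables (M m : R -> R).
Hypotheses (pM : primitive a b M m) (m1 : forall r, 1 <= m r).

(** The weak primitive is tested with the increment [p] itself. *)
Lemma wderiv_dist Y Z s t : wderiv m Y Z -> a <= s <= b -> a <= t <= b -> `|Y s - Y t| <= `|M s - M t|.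
Proof.
move=> [hY hZ]; have gM := primitive_gauge pM m1.
have main s' t' : a <= s' -> s' <= t' -> t' <= b -> `|Y t' - Y s'| <= M t' - M s'.
  move=> as_ st tb; apply: norm_le_ip.
    by rewrite subr_ge0 (gauge_le gM).
  set p := Y t' - Y s'; have -> : `|p| ^+ 2 = ip (Y t') p - ip (Y s') p by rewrite -hip -ipBl.
  apply: le_trans (primitive_le (hY p) (primitiveZ `|p| pM) leb_null0 as_ st tb _) _.
    move=> r _ _; apply: le_trans (ip_le hip _ _) _.
    by rewrite mulrC ler_wpM2l.
  by rewrite -mulrBr mulrC.
move=> /andP[as_ sb] /andP[at_ tb]; have [st|ts] := leP s t.
  rewrite distrC (distrC (M s)) [leRHS]ger0_norm ?subr_ge0 ?(gauge_le gM) //.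
  exact: main.
by rewrite [leRHS]ger0_norm ?subr_ge0 ?(gauge_le gM) ?(ltW ts) //; apply: main => //; exact: ltW.
Qed.

(** The local primitive freezes one factor at [t]. The remainder is a product of two increments, one
    small by continuity and one bounded by the increment of [M]; as the derivatives are only
    integrable, [adiff] has to measure errors by [M] and not by time alone. *)
Lemma adiff_ip Y Z Y' Z' : wderiv m Y Z -> wderiv m Y' Z' ->
  hcontinuous_on a b Y -> hcontinuous_on a b Y' ->
  adiff a b M m (fun t => ip (Y t) (Y' t)) (fun t => ip (Z t) (Y' t) + ip (Z' t) (Y t)) (fun=> 0).
Proof.
move=> hY hY' cY cY' t tab.
exists (fun s => ip (Y s) (Y' t) + ip (Y' s) (Y t)), (fun r => ip (Z r) (Y' t) + ip (Z' r) (Y t)).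
split; first by apply: primitiveD; [exact: hY.1|exact: hY'.1].
move=> e e0; have e2 : 0 < e / 2 by rewrite divr_gt0.
have [d d0 hd] := cY t tab _ e2; have [d' d'0 hd'] := cY' t tab _ e2.
exists (Num.min d d') => [|s sab]; first by rewrite lt_min d0.
rewrite lt_min => /andP[s1 s2].
have dY := hd s sab s1; have dY' := hd' s sab s2; split.
  rewrite (_ : _ - _ = ip (Y s - Y t) (Y' s - Y' t)); last first.
    by rewrite !ipE !(ipC ip (Y' _)); ring.
  apply: le_trans (ip_cauchy_schwarz hip _ _) _; rewrite mul0r add0r mulrC.
  apply: ler_pM => //; last exact: wderiv_dist hY _ _.
  by apply: le_trans (ltW dY') _; rewrite ler_pdivrMr // ler_peMr ?(ltW e0) // ler1n.
rewrite (_ : _ - _ = ip (Z s) (Y' t - Y' s) + ip (Z' s) (Y t - Y s)); last first.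
  by rewrite !ipE; ring.
apply: le_trans (ler_normD _ _) _; rewrite [in leRHS](splitr e) mulrDl; apply: lerD.
  apply: le_trans (ip_cauchy_schwarz hip _ _) _; rewrite mulrC; apply: ler_pM => //.
    by rewrite distrC ltW.
  exact: hY.2.
apply: le_trans (ip_cauchy_schwarz hip _ _) _; rewrite mulrC; apply: ler_pM => //.
  by rewrite distrC ltW.
exact: hY'.2.
Qed.

Lemma adiff_grad (G k : R -> R) (u ut psi : R -> H) : hderiv u ut ->
  cvg_on a b ut -> cvg_on a b psi ->
  (forall t, a <= t <= b -> forall e, 0 < e -> exists2 d, 0 < d & forall s, a <= s <= b -> `|s - t| < d ->
    `|G s - G t - ip (psi t) (u s - u t)| <= k t * `|s - t| + e * `|M s - M t|) ->
  adiff a b M m G (fun t => ip (psi t) (ut t)) k.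
Proof.
move=> hu cut cpsi hG; apply: (adiff_classic m1).
  apply: cvg_on_continuous => t tab.
  by apply: (@ip_cvg _ _ _ hip _ _ (seg_nbhs_filter a b t)); [exact: cpsi|exact: cut].
move=> t tab e e0; have e2 : 0 < e / 2 by rewrite divr_gt0.
pose C := `|psi t| + 1; have C0 : 0 < C by rewrite ltr_wpDl.
have [d d0 hd] := hG t tab _ e2; have [d' d'0 hd'] := hu t tab _ (divr_gt0 e2 C0).
exists (Num.min d d') => [|s sab]; first by rewrite lt_min d0.
rewrite lt_min => /andP[s1 s2].
have h1 := hd s sab s1; have h2 := hd' s sab s2.
rewrite (_ : _ - _ = (G s - G t - ip (psi t) (u s - u t)) + ip (psi t) (u s - u t - (s - t) *: ut t)); last first.
  by rewrite !ipE; ring.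
apply: le_trans (ler_normD _ _) _.
have h3 : `|ip (psi t) (u s - u t - (s - t) *: ut t)| <= e / 2 * `|M s - M t|.
  apply: le_trans (ip_cauchy_schwarz hip _ _) _.
  apply: (@le_trans _ _ (C * (e / 2 / C * `|s - t|))).
    by apply: ler_pM => //; rewrite /C lerDl.
  rewrite mulrA mulrCA divff ?gt_eqF // mulr1 ler_pM2l //.
  exact: (gauge_dist pM m1).
apply: le_trans (lerD h1 h3) _; apply: le_of_eq; by field.
Qed.

End WeakPaths.

(** * The space H^{1/2} and the derivatives of the energy terms *)

Section EnergySpace.
Context {R : realType} {H : completeNormedModType R}.
Variable ip : {dot H for (@idfun R)}.
Hypothesis hip : forall x : H, ip x x = `|x| ^+ 2.
Variables (domA : set H) (A : H -> H).
Hypothesis hAsa : self_adjoint ip domA A.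
Hypothesis hApos : positive_op ip domA A.
Hypothesis hAcomp : compact_resolvent domA A.
Local Notation mu := (@lebesgue_measure R).
Local Notation V := (Hhalf ip domA A).
Local Notation Ah := (frac_pow ip domA A 2^-1).
Local Notation hn := (hnorm ip domA A).

Definition vcvg (I : Type) (F : set_system I) (x : I -> H) (u : H) : Prop :=
  [/\ V u, \forall i \near F, V (x i) & (fun i => Ah (x i)) @ F --> Ah u].

Definition vbounded (T : H -> H) : Prop := linear_on V T /\
  exists2 C : R, 0 < C & forall u, V u -> `|T u| <= C * `|Ah u|.

Lemma vboundedB T x y : vbounded T -> V x -> V y -> T (x - y) = T x - T y.
Proof.
move=> [lT _] Vx Vy; rewrite addrC -scaleN1r lT // scaleN1r addrC //.
Qed.

Section Filters.
Variables (I : Type) (F : set_system I).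
Context {FF : Filter F}.

Lemma vcvg_Ah x u : vcvg F x u -> (fun i => Ah (x i)) @ F --> Ah u.
Proof. by case. Qed.

Lemma vcvg_hdist x u (e : R) : vcvg F x u -> 0 < e -> \forall i \near F, V (x i) /\ `|Ah (x i - u)| < e.
Proof.
move=> [Vu nV /cvgrPdist_lt/(_ e)] h e0; have {}h := h e0.
by near=> i; have Vi : V (x i); [near: i|split => //; rewrite (AhB hip hAsa hAcomp) // distrC; near: i].
Unshelve. all: by end_near. Qed.

Lemma vcvg_norm x u : vcvg F x u -> x @ F --> u.
Proof.
move=> xu; have [Vu _ _] := xu; have [c c0 hc] := poincare hip hAsa hApos hAcomp.
apply/cvgrPdist_lt => e e0; have h := vcvg_hdist xu (divr_gt0 e0 c0).
near=> i; have [Vi di] : V (x i) /\ `|Ah (x i - u)| < e / c by near: i.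
rewrite distrC; apply: le_lt_trans (hc _ (VB Vi Vu)) _.
by rewrite mulrC -ltr_pdivlMr.
Unshelve. all: by end_near. Qed.

Lemma vcvg_vbounded T x u : vbounded T -> vcvg F x u -> (fun i => T (x i)) @ F --> T u.
Proof.
move=> bT xu; have [Vu _ _] := xu; have [_ [C C0 hC]] := bT.
apply/cvgrPdist_lt => e e0; have h := vcvg_hdist xu (divr_gt0 e0 C0).
near=> i; have [Vi di] : V (x i) /\ `|Ah (x i - u)| < e / C by near: i.
rewrite distrC -vboundedB //; apply: le_lt_trans (hC _ (VB Vi Vu)) _.
by rewrite mulrC -ltr_pdivlMr.
Unshelve. all: by end_near. Qed.

Lemma vcvgB x u y v : vcvg F x u -> vcvg F y v -> vcvg F (fun i => x i - y i) (u - v).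
Proof.
move=> [Vu nx cx] [Vv ny cy]; split; first exact: VB.
  by near=> i; apply: VB; near: i.
rewrite (AhB hip hAsa hAcomp) //.
have h : (fun i => Ah (x i) - Ah (y i)) @ F --> Ah u - Ah v by exact: cvgB.
apply: cvg_trans h; apply: near_eq_cvg.
by near=> i; rewrite (AhB hip hAsa hAcomp) //; near: i.
Unshelve. all: by end_near. Qed.

Lemma vcvg_lipschitz B x u : lipschitz_on_balls ip domA A 2^-1 B -> vcvg F x u -> (fun i => B (x i)) @ F --> B u.
Proof.
move=> lB xu; have [Vu _ _] := xu.
have [|L hL] := lB (`|Ah u| + 1); first by rewrite ltr_wpDl.
pose L' := `|L| + 1; have L'0 : 0 < L' by rewrite ltr_wpDl.
apply/cvgrPdist_lt => e e0.
have d0 : 0 < Num.min 1 (e / L') by rewrite lt_min ltr01 divr_gt0.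
have h := vcvg_hdist xu d0.
near=> i; have [Vi] : V (x i) /\ `|Ah (x i - u)| < Num.min 1 (e / L') by near: i.
rewrite lt_min => /andP[d1 d2]; rewrite distrC.
apply: (@le_lt_trans _ _ (L' * `|Ah (x i - u)|)); last by rewrite mulrC -ltr_pdivlMr.
have -> : `|Ah (x i - u)| = hn 2^-1 (x i - u) by [].
apply: le_trans (hL _ _ Vi Vu _ _) _; rewrite /hnorm ?lerDl //.
  rewrite -(subrK (Ah u) (Ah (x i))) addrC; apply: le_trans (ler_normD _ _) _.
  by rewrite lerD2l -(AhB hip hAsa hAcomp) // ltW.
by rewrite ler_wpM2r // /L'; have := ler_norm L; gen_norm; lra.
Unshelve. all: by end_near. Qed.

Lemma vcvg_potential B Pi x u : frechet_potential ip domA A B Pi -> vcvg F x u ->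
  (fun i => Pi (x i)) @ F --> Pi u.
Proof.
move=> pB xu; have [Vu _ _] := xu; have [c c0 hc] := poincare hip hAsa hApos hAcomp.
have [d d0 hd] := pB u Vu 1 ltr01.
pose C := `|B u| * c + 1; have C0 : 0 < C by rewrite ltr_wpDl // mulr_ge0 // ltW.
apply/cvgrPdist_lt => e e0.
have e10 : 0 < Num.min d (e / C) by rewrite lt_min d0 divr_gt0.
have h := vcvg_hdist xu e10.
near=> i; have [Vi] : V (x i) /\ `|Ah (x i - u)| < Num.min d (e / C) by near: i.
rewrite lt_min => /andP[d1 d2]; rewrite distrC.
have Vd := VB Vi Vu; have := hd _ Vd d1; rewrite (addrC u) subrK mul1r => hh.
rewrite (_ : _ - _ = Pi (x i) - Pi u - ip (B u) (x i - u) + ip (B u) (x i - u)); last by rewrite subrK.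
apply: le_lt_trans (ler_normD _ _) _.
apply: (@le_lt_trans _ _ (C * `|Ah (x i - u)|)); last by rewrite mulrC -ltr_pdivlMr.
rewrite /C mulrDl mul1r addrC; apply: lerD => //.
apply: le_trans (ip_cauchy_schwarz hip _ _) _; rewrite -mulrA ler_wpM2l //.
exact: hc.
Unshelve. all: by end_near. Qed.

End Filters.

Section Spath.
Variables (a b : R).

(** For strong solutions [Zx] and [Zu] represent A^{1/2} u_t and u_tt: they agree with them almost
    everywhere only, but are dominated by [m] everywhere. *)
Definition spath (m : R -> R) (u ut Zx Zu : R -> H) : Prop :=
  [/\ forall t, a <= t <= b -> V (u t),
      wderiv ip a b m (fun t => Ah (u t)) Zx /\ wderiv ip a b m ut Zu,
      cvg_on a b (fun t => Ah (u t)), cvg_on a b ut & hderiv a b u ut].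

Lemma wderivW m m' Y Z : (forall r, m r <= m' r) -> wderiv ip a b m Y Z -> wderiv ip a b m' Y Z.
Proof. by move=> mm [h1 h2]; split=> // r; apply: le_trans (mm r). Qed.

Lemma spathW m m' u ut Zx Zu : (forall r, m r <= m' r) -> spath m u ut Zx Zu -> spath m' u ut Zx Zu.
Proof. by move=> mm [h1 [h2 h3] h4 h5 h6]; split=> //; split; exact: wderivW mm _. Qed.

Lemma primitive_eq L l L' l' : (forall t, a <= t <= b -> L t = L' t) -> primitive a b L l -> l =1 l' ->
  primitive a b L' l'.
Proof.
move=> LL [h1 h2] /funext <-; split => // s s' as_ ss' s'b.
by rewrite -!LL ?h2 // ?as_ ?s'b ?(le_trans ss' s'b) ?(le_trans as_ ss').
Qed.

Lemma spathB m m' u ut Zx Zu v vt Zy Zv : spath m u ut Zx Zu -> spath m' v vt Zy Zv ->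
  spath (fun r => m r + m' r) (fun t => u t - v t) (fun t => ut t - vt t)
    (fun t => Zx t - Zy t) (fun t => Zu t - Zv t).
Proof.
move=> [h1 [h2 h3] h4 h5 h6] [k1 [k2 k3] k4 k5 k6].
have E t : a <= t <= b -> Ah (u t) - Ah (v t) = Ah (u t - v t).
  by move=> tab; rewrite (AhB hip hAsa hAcomp) //; [exact: h1|exact: k1].
split.
- by move=> t tab; apply: VB; [exact: h1|exact: k1].
- split; last exact: wderivB.
  have [q1 q2] := wderivB h2 k2; split=> // phi; apply: primitive_eq (q1 phi) _ => // t tab.
  by rewrite E.
- move=> t tab; rewrite -E //; have FF := seg_nbhs_filter a b t.
  have h : (fun t => Ah (u t) - Ah (v t)) @ seg_nbhs a b t --> Ah (u t) - Ah (v t).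
    by apply: cvgB; [exact: h4|exact: k4].
  apply: cvg_trans h; apply: near_eq_cvg; rewrite /seg_nbhs.
  by apply: (@nearW _ (nbhs t)) => s sab; exact: E.
- move=> t tab; have FF := seg_nbhs_filter a b t.
  by apply: cvgB; [exact: h5|exact: k5].
- exact: hderivB.
Qed.

Lemma spath_vcvg m u ut Zx Zu t : spath m u ut Zx Zu -> a <= t <= b ->
  vcvg (seg_nbhs a b t) u (u t).
Proof.
move=> [h1 _ h4 _ _] tab; split; [exact: h1| |exact: h4].
by apply: (@nearW _ (nbhs t)) => s sab; exact: h1.
Qed.

Variables (M m : R -> R).
Hypotheses (pM : primitive a b M m) (m1 : forall r, 1 <= m r).
Variables (u ut Zx Zu : R -> H).
Hypothesis hu : spath m u ut Zx Zu.

Let Vu t : a <= t <= b -> V (u t). Proof. by case: hu => h _ _ _ _; exact: h. Qed.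
Let wx : wderiv ip a b m (fun t => Ah (u t)) Zx. Proof. by case: hu => _ []. Qed.
Let wu : wderiv ip a b m ut Zu. Proof. by case: hu => _ []. Qed.
Let cx : hcontinuous_on a b (fun t => Ah (u t)).
Proof. by apply: cvg_on_hcontinuous; case: hu. Qed.
Let cut : cvg_on a b ut. Proof. by case: hu. Qed.
Let du : hderiv a b u ut. Proof. by case: hu. Qed.

Lemma adiff_kinetic : adiff a b M m (fun t => ip (ut t) (ut t)) (fun t => 2 * ip (Zu t) (ut t)) (fun=> 0).
Proof.
have := adiff_ip hip pM m1 wu wu (cvg_on_hcontinuous cut) (cvg_on_hcontinuous cut).
by move=> h; apply: (adiff_ext _ _ _ h) => // t; ring.
Qed.

Lemma adiff_potential : adiff a b M m (fun t => ip (Ah (u t)) (Ah (u t))) (fun t => 2 * ip (Zx t) (Ah (u t))) (fun=> 0).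
Proof.
have := adiff_ip hip pM m1 wx wx cx cx.
by move=> h; apply: (adiff_ext _ _ _ h) => // t; ring.
Qed.

(** Here [u] has a classical derivative in [H]: in the local primitive the part of [ut] is kept as a
    weak primitive, and the part of [u] is linearised at [t]. *)
Lemma adiff_cross : adiff a b M m (fun t => ip (ut t) (u t)) (fun t => ip (Zu t) (u t) + ip (ut t) (ut t)) (fun=> 0).
Proof.
move=> t tab.
exists (fun s => ip (ut s) (u t) + ip (ut t) (ut t) * s), (fun r => ip (Zu r) (u t) + ip (ut t) (ut t)).
split; first by apply: primitiveD; [exact: wu.1|exact: primitive_cst].
move=> e e0; have [d1 d10 hd1] := hderiv_continuous du tab (divr_gt0 e0 (ltr0n R 2)).
pose C := `|ut t| + 1; have C0 : 0 < C by rewrite ltr_wpDl.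
have e2 : 0 < e / 2 by rewrite divr_gt0.
have [d2 d20 hd2] := du tab (divr_gt0 e2 C0).
have cc : continuous_on a b (fun t => ip (ut t) (ut t)).
  apply: cvg_on_continuous => s sab; have FF := seg_nbhs_filter a b s.
  by apply: ip_cvg => //; exact: cut.
have [d3 d30 hd3] := cc t tab _ e2.
exists (Num.min d1 (Num.min d2 d3)) => [|s sab]; first by rewrite !lt_min d10 d20.
rewrite !lt_min => /and3P[s1 s2 s3]; have h1 := hd1 s sab s1; have h2 := hd2 s sab s2.
have h3 := hd3 s sab s3; split.
  rewrite (_ : _ - _ = ip (ut s - ut t) (u s - u t) + ip (ut t) (u s - u t - (s - t) *: ut t)); last first.
    by rewrite !ipE; ring.
  rewrite mul0r add0r [in leRHS](splitr e) mulrDl; apply: le_trans (ler_normD _ _) _; apply: lerD.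
    apply: le_trans (ip_cauchy_schwarz hip _ _) _; rewrite mulrC; apply: ler_pM => //; first exact: ltW.
    exact: (wderiv_dist hip pM m1 wu).
  apply: le_trans (ip_cauchy_schwarz hip _ _) _.
  apply: (@le_trans _ _ (C * (e / 2 / C * `|s - t|))).
    by apply: ler_pM => //; rewrite /C lerDl.
  rewrite mulrA mulrCA divff ?gt_eqF // mulr1 ler_pM2l //.
  exact: (gauge_dist pM m1).
rewrite (_ : _ - _ = - ip (Zu s) (u s - u t) - (ip (ut s) (ut s) - ip (ut t) (ut t))); last first.
  by rewrite !ipE; ring.
apply: le_trans (ler_normB _ _) _; rewrite normrN [in leRHS](splitr e) mulrDl; apply: lerD.
  apply: le_trans (ip_cauchy_schwarz hip _ _) _; rewrite mulrC; apply: ler_pM => //; first exact: ltW.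
  exact: wu.2.
apply: le_trans (ltW h3) _; rewrite -[leLHS]mulr1 ler_pM2l //.
Qed.

(** [T] is bounded on H^{1/2} only. In the remainder (T d, d) with d = u s - u t, the first factor
    is controlled by the increment of [M], and the second is small in [H]. *)
Lemma adiff_form T : vbounded T -> symmetric_on ip V T ->
  adiff a b M m (fun t => ip (T (u t)) (u t)) (fun t => 2 * ip (T (u t)) (ut t)) (fun=> 0).
Proof.
move=> bT sT; have [lT [C C0 hC]] := bT.
apply: (@adiff_ext _ _ _ _ _ _ (fun t => ip (2 *: T (u t)) (ut t)) (fun=> 0)) => //.
  by move=> t; rewrite ipZl.
apply: (adiff_grad hip pM m1 du cut).
  move=> t tab; have FF := seg_nbhs_filter a b t.
  by apply: cvgZ; [exact: cvg_cst|exact: vcvg_vbounded bT (spath_vcvg hu tab)].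
move=> t tab e e0; have [d d0 hd] := hderiv_continuous du tab (divr_gt0 e0 C0).
exists d => // s sab st; rewrite mul0r add0r.
rewrite (_ : _ - _ = ip (T (u s - u t)) (u s - u t)); last first.
  have Vs := Vu sab; have Vt := Vu tab.
  by rewrite (vboundedB bT Vs Vt) !ipE (sT (u s) (u t)) // (ipC ip (u s)); ring.
apply: le_trans (ip_cauchy_schwarz hip _ _) _.
have h1 : `|T (u s - u t)| <= C * `|M s - M t|.
  apply: le_trans (hC _ (VB (Vu sab) (Vu tab))) _; rewrite ler_pM2l // (AhB hip hAsa hAcomp (Vu sab) (Vu tab)).
  exact: (wderiv_dist hip pM m1 wx).
apply: le_trans (ler_pM _ _ h1 (ltW (hd s sab st))) _ => //.
by apply: le_of_eq; field; rewrite gt_eqF.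
Qed.

Lemma adiff_Pi B Pi : lipschitz_on_balls ip domA A 2^-1 B -> frechet_potential ip domA A B Pi ->
  adiff a b M m (fun t => Pi (u t)) (fun t => ip (B (u t)) (ut t)) (fun=> 0).
Proof.
move=> lB pB; apply: (adiff_grad hip pM m1 du cut).
  move=> t tab; have FF := seg_nbhs_filter a b t.
  exact: vcvg_lipschitz lB (spath_vcvg hu tab).
move=> t tab e e0; have [d d0 hd] := pB _ (Vu tab) e e0; have [d' d'0 hd'] := cx tab d0.
exists d' => // s sab st; rewrite mul0r add0r.
have Vd := VB (Vu sab) (Vu tab).
have := hd _ Vd; rewrite /hnorm (AhB hip hAsa hAcomp (Vu sab) (Vu tab)) => /(_ (hd' s sab st)).
rewrite (addrC (u t)) subrK => /le_trans; apply; rewrite ler_pM2l //.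
exact: (wderiv_dist hip pM m1 wx).
Qed.

End Spath.
End EnergySpace.

(** * Strong solutions as weak paths *)

Section StrongSolutions.
Context {R : realType} {H : completeNormedModType R}.
Variable ip : {dot H for (@idfun R)}.
Hypothesis hip : forall x : H, ip x x = `|x| ^+ 2.
Variables (domA : set H) (A : H -> H).
Local Notation mu := (@lebesgue_measure R).
Local Notation V := (Hhalf ip domA A).
Local Notation Ah := (frac_pow ip domA A 2^-1).

Lemma is_derive_hderiv (a b : R) (u ut : R -> H) :
  (forall t, a <= t <= b -> is_derive t 1 u (ut t)) -> hderiv a b u ut.
Proof.
move=> hu t tab e e0; have [du Du] := hu t tab.
have : (fun h : R => h^-1 *: (u (h + t) - u t)) @ 0^' --> ut t.
  rewrite -Du; apply: cvg_trans du; apply: near_eq_cvg.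
  by apply: nearW => h /=; rewrite /GRing.scale /= mulr1.
move=> /cvgrPdist_le /(_ e e0); rewrite /dnbhs /within /= => /nbhs_ballP [d /= d0 hd].
exists d => // s sab st; have [->|ne] := eqVneq s t; first by rewrite !subrr scale0r subrr !normr0 mulr0.
have n0 : s - t != 0 by rewrite subr_eq0.
have := hd (s - t); rewrite -ball_normE /= sub0r normrN subrK => /(_ st n0) h.
rewrite (_ : _ - _ = (s - t) *: ((s - t)^-1 *: (u s - u t) - ut t)).
  by rewrite normrZ mulrC ler_wpM2r // distrC.
by rewrite scalerBr scalerA divff // scale1r.
Qed.

Lemma strong_spath (T a b : R) u ut utt : strong_class ip domA A T u ut utt ->
  0 < a -> a < b -> b < T -> exists m Zx Zu N,
  [/\ mu.-integrable `[a, b] (EFin \o m), spath ip domA A a b m u ut Zx Zu, leb_null N &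
    forall r, a <= r <= b -> ~ N r -> [/\ V (ut r), Zx r = Ah (ut r) & Zu r = utt r]].
Proof.
move=> [[hV cA cut du] hs] a0 ab bT; have [aeV dA du'] := hs a b a0 ab bT.
have [Zx [Ix [N1 n1 E1] l1 i1 p1]] := L1_derivative_weak hip dA.
have [Zu [Iu [N2 n2 E2] l2 i2 p2]] := L1_derivative_weak hip du'.
have [N3 n3 E3] := ae_leb_null aeV.
pose m r := `|Ah (ut r)| + `|utt r|.
have inT t : a <= t <= b -> 0 <= t <= T /\ 0 < t < T.
  move=> /andP[at_ tb]; have t0 := lt_le_trans a0 at_; have tT := le_lt_trans tb bT.
  by rewrite t0 tT !ltW.
exists m, Zx, Zu, (N1 `|` (N2 `|` N3)); split.
- rewrite (_ : _ \o _ = ((fun t => `|Ah (ut t)|%:E) \+ (fun t => `|utt t|%:E))%E) //.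
  exact: integrableD.
- split.
  + by move=> t /inT[tT _]; exact: hV.
  + by split; split => [phi|r]; [split=> [|s s' as_ ss' s'b]; [exact: Ix|rewrite -p1 // ipBl]|
      apply: le_trans (l1 r) _; rewrite lerDl|
      split=> [|s s' as_ ss' s'b]; [exact: Iu|rewrite -p2 // ipBl]|
      apply: le_trans (l2 r) _; rewrite lerDr].
  + by apply: (within_cvg_on _ _ cA); exact: ltW.
  + by apply: (within_cvg_on _ _ cut); exact: ltW.
  + by apply: is_derive_hderiv => t /inT[_ tT]; exact: du.
- by do 2?[apply: leb_nullU => //].
- move=> r rab Nr; split.
  + by apply: E3; [move=> N3r; apply: Nr; right; right|].
  + by apply: E1 => // N1r; apply: Nr; left.
  + by apply: E2 => // N2r; apply: Nr; right; left.
Qed.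

Variables (nu : R) (K D B : H -> H).

(* The equation for one component, in weak form: [d] collects the damping and
   [k] the coupling terms. *)
Definition weak_eq (x z d k : H) : Prop :=
  forall phi, V phi -> ip z phi = - (nu * ip (Ah x) (Ah phi)) - ip d phi - ip k phi - ip (B x) phi.

Lemma elliptic_weak_eq (u d f k z : H) : elliptic_eq ip domA A nu u d f -> z + f + k + B u = 0 ->
  weak_eq u z d k.
Proof.
move=> he h phi Vphi; have := he phi Vphi.
have -> : z = - (f + k + B u) by apply/eqP; rewrite -addr_eq0 !addrA; apply/eqP.
by rewrite !ipE => <-; ring.
Qed.

(** The form in which strong solutions are used: on a compact subinterval, with one integrable
    majorant for both components and one null set off which the equations and the regularity of U_t
    hold. *)
Definition coupled_data (alpha kappa a b : R) (m : R -> R) (U Ut : R -> H * H) (Zx Zu Zy Zv : R -> H)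
    (N : set R) : Prop :=
  [/\ mu.-integrable `[a, b] (EFin \o m) /\ leb_null N,
    spath ip domA A a b m (fun t => (U t).1) (fun t => (Ut t).1) Zx Zu,
    spath ip domA A a b m (fun t => (U t).2) (fun t => (Ut t).2) Zy Zv &
    forall r, a <= r <= b -> ~ N r ->
     [/\ V (Ut r).1 /\ V (Ut r).2, Zx r = Ah (Ut r).1 /\ Zy r = Ah (Ut r).2,
      weak_eq (U r).1 (Zu r) (D (Ut r).1 + alpha *: K ((Ut r).1 - (Ut r).2)) (kappa *: K ((U r).1 - (U r).2)) &
      weak_eq (U r).2 (Zv r) (D (Ut r).2 + alpha *: K ((Ut r).2 - (Ut r).1)) (kappa *: K ((U r).2 - (U r).1))]].

Lemma coupled_strong_data (alpha kappa T a b : R) U Ut :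
  coupled_strong ip domA A nu K D B alpha kappa T U Ut -> 0 < a -> a < b -> b < T ->
  exists m Zx Zu Zy Zv N, coupled_data alpha kappa a b m U Ut Zx Zu Zy Zv N.
Proof.
move=> [utt [vtt [su sv /ae_leb_null [N nN hN]]]] a0 ab bT.
have [m1 [Zx [Zu [N1 [I1 p1 n1 h1]]]]] := strong_spath su a0 ab bT.
have [m2 [Zy [Zv [N2 [I2 p2 n2 h2]]]]] := strong_spath sv a0 ab bT.
have m10 r : 0 <= m1 r by case: p1 => _ [[_ h] _] _ _ _; apply: le_trans (h r).
have m20 r : 0 <= m2 r by case: p2 => _ [[_ h] _] _ _ _; apply: le_trans (h r).
exists (fun r => m1 r + m2 r), Zx, Zu, Zy, Zv, (N1 `|` (N2 `|` N)); split.
- split; last by do 2?[apply: leb_nullU => //].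
  rewrite (_ : _ \o _ = ((EFin \o m1) \+ (EFin \o m2))%E) //; exact: integrableD.
- by apply: spathW p1 => r; rewrite lerDl.
- by apply: spathW p2 => r; rewrite lerDr.
move=> r rab Nr.
have Nr1 : ~ N1 r by move=> ?; apply: Nr; left.
have Nr2 : ~ N2 r by move=> ?; apply: Nr; right; left.
have Nr3 : ~ N r by move=> ?; apply: Nr; right; right.
have [V1 -> ->] := h1 r rab Nr1.
have [V2 -> ->] := h2 r rab Nr2.
have rT : `]0, T[%classic r.
  by case/andP: rab => ar rb; rewrite /= in_itv /= (lt_le_trans a0 ar) (le_lt_trans rb bT).
have := hN r Nr3 rT; case: (U r) (Ut r) V1 V2 => [u v] [ut vt] /= V1 V2.
move=> [f [g [e1 e2 q1 q2]]]; split => //.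
  exact: elliptic_weak_eq e1 q1.
exact: elliptic_weak_eq e2 q2.
Qed.

Lemma gauge_exists (a b : R) (m : R -> R) : mu.-integrable `[a, b] (EFin \o m) ->
  exists M, primitive a b M (fun r => 1 + m r).
Proof.
move=> Im; apply: integrable_primitive; have [I1 _] := primitive_cst a b (1 : R).
by rewrite (_ : _ \o _ = ((EFin \o (fun=> 1%R)) \+ (EFin \o m))%E) //; exact: integrableD.
Qed.

End StrongSolutions.

Ltac gen_ip := repeat match goal with
  |- context [@Dot.sort ?A ?B ?C ?D ?x ?y] => let n := fresh "n" in move: (@Dot.sort A B C D x y) => n
  end.

(** * The Lyapunov function of the coupled system *)

Section Lyapunov.
Context {R : realType} {H : completeNormedModType R}.
Variable ip : {dot H for (@idfun R)}.
Hypothesis hip : forall x : H, ip x x = `|x| ^+ 2.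
Variables (domA : set H) (A : H -> H).
Hypothesis hAsa : self_adjoint ip domA A.
Hypothesis hApos : positive_op ip domA A.
Hypothesis hAcomp : compact_resolvent domA A.
Local Notation mu := (@lebesgue_measure R).
Local Notation V := (Hhalf ip domA A).
Local Notation Ah := (frac_pow ip domA A 2^-1).
Local Notation vbnd := (vbounded ip domA A).
Local Notation vcv := (vcvg ip domA A).
Variables (nu : R) (K D B : H -> H) (Pi : H -> R).
Hypotheses (bK : vbnd K) (sK : symmetric_on ip V K) (bD : vbnd D) (sD : symmetric_on ip V D).
Hypotheses (lB : lipschitz_on_balls ip domA A 2^-1 B) (pB : frechet_potential ip domA A B Pi).

Definition energy (kappa : R) (X Xt : H * H) : R :=
  2^-1 * (ip Xt.1 Xt.1 + ip Xt.2 Xt.2) + nu / 2 * (ip (Ah X.1) (Ah X.1) + ip (Ah X.2) (Ah X.2))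
  + kappa / 2 * ip (K (X.1 - X.2)) (X.1 - X.2) + (Pi X.1 + Pi X.2).

(** The forms of [D] and [K] in the bracket have as derivatives the damping terms tested with [U],
    so that these cancel and are absent from [lyap_rate]. *)
Definition lyap (alpha kappa eps : R) (X Xt : H * H) : R :=
  energy kappa X Xt + eps * ((ip Xt.1 X.1 + ip Xt.2 X.2)
   + 2^-1 * (ip (D X.1) X.1 + ip (D X.2) X.2) + alpha / 2 * ip (K (X.1 - X.2)) (X.1 - X.2)).

Definition lyap_rate (kappa c0 eps : R) (X Xt : H * H) : R :=
  - c0 * (ip Xt.1 Xt.1 + ip Xt.2 Xt.2) + eps * (ip Xt.1 Xt.1 + ip Xt.2 Xt.2
   - nu * (ip (Ah X.1) (Ah X.1) + ip (Ah X.2) (Ah X.2)) - kappa * ip (K (X.1 - X.2)) (X.1 - X.2)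
   - (ip (B X.1) X.1 + ip (B X.2) X.2)).

Definition state_cvg (I : Type) (F : set_system I) (X Xt : I -> H * H) (x xt : H * H) : Prop :=
  [/\ vcv F (fun i => (X i).1) x.1, vcv F (fun i => (X i).2) x.2,
      (fun i => (Xt i).1) @ F --> xt.1 & (fun i => (Xt i).2) @ F --> xt.2].

Section Continuity.
Variables (I : Type) (F : set_system I) (X Xt : I -> H * H) (x xt : H * H).
Context {FF : Filter F}.
Hypothesis hX : state_cvg F X Xt x xt.

Let cvgc (c : R) (f : I -> R) (l : R) : f @ F --> l -> (fun i => c * f i) @ F --> c * l.
Proof. by move=> h; apply: cvgM h; exact: cvg_cst. Qed.

Let a1 : (fun i => Ah (X i).1) @ F --> Ah x.1. Proof. by case: hX => /vcvg_Ah. Qed.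
Let a2 : (fun i => Ah (X i).2) @ F --> Ah x.2. Proof. by case: hX => _ /vcvg_Ah. Qed.
Let n1 : (fun i => (X i).1) @ F --> x.1.
Proof. by case: hX => h _ _ _; exact: (vcvg_norm hip hAsa hApos hAcomp h). Qed.
Let n2 : (fun i => (X i).2) @ F --> x.2.
Proof. by case: hX => _ h _ _; exact: (vcvg_norm hip hAsa hApos hAcomp h). Qed.
Let t1 : (fun i => (Xt i).1) @ F --> xt.1. Proof. by case: hX. Qed.
Let t2 : (fun i => (Xt i).2) @ F --> xt.2. Proof. by case: hX. Qed.
Let d1 : (fun i => D (X i).1) @ F --> D x.1.
Proof. by case: hX => h _ _ _; exact: (vcvg_vbounded hip hAsa hAcomp bD h). Qed.
Let d2 : (fun i => D (X i).2) @ F --> D x.2.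
Proof. by case: hX => _ h _ _; exact: (vcvg_vbounded hip hAsa hAcomp bD h). Qed.
Let b1 : (fun i => B (X i).1) @ F --> B x.1.
Proof. by case: hX => h _ _ _; exact: (vcvg_lipschitz hip hAsa hAcomp lB h). Qed.
Let b2 : (fun i => B (X i).2) @ F --> B x.2.
Proof. by case: hX => _ h _ _; exact: (vcvg_lipschitz hip hAsa hAcomp lB h). Qed.
Let p1 : (fun i => Pi (X i).1) @ F --> Pi x.1.
Proof. by case: hX => h _ _ _; exact: (vcvg_potential hip hAsa hApos hAcomp pB h). Qed.
Let p2 : (fun i => Pi (X i).2) @ F --> Pi x.2.
Proof. by case: hX => _ h _ _; exact: (vcvg_potential hip hAsa hApos hAcomp pB h). Qed.
Let w : (fun i => (X i).1 - (X i).2) @ F --> x.1 - x.2.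
Proof. exact: cvgB. Qed.
Let k : (fun i => K ((X i).1 - (X i).2)) @ F --> K (x.1 - x.2).
Proof.
case: hX => h h' _ _.
exact: (vcvg_vbounded hip hAsa hAcomp bK (vcvgB hip hAsa hAcomp h h')).
Qed.
Let ipc (f g : I -> H) y z : f @ F --> y -> g @ F --> z -> (fun i => ip (f i) (g i)) @ F --> ip y z.
Proof. exact: ip_cvg. Qed.
Let cD (f g : I -> R) (y z : R) : f @ F --> y -> g @ F --> z -> (fun i => f i + g i) @ F --> y + z.
Proof. exact: cvgD. Qed.
Let cB (f g : I -> R) (y z : R) : f @ F --> y -> g @ F --> z -> (fun i => f i - g i) @ F --> y - z.
Proof. exact: cvgB. Qed.

Lemma energy_cvg kappa : (fun i => energy kappa (X i) (Xt i)) @ F --> energy kappa x xt.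
Proof.
exact: (cD (cD (cD (cvgc (cD (ipc t1 t1) (ipc t2 t2))) (cvgc (cD (ipc a1 a1) (ipc a2 a2))))
  (cvgc (ipc k w))) (cD p1 p2)).
Qed.

Lemma lyap_cvg alpha kappa eps : (fun i => lyap alpha kappa eps (X i) (Xt i)) @ F --> lyap alpha kappa eps x xt.
Proof.
exact: (cD (@energy_cvg _) (cvgc (cD (cD (cD (ipc t1 n1) (ipc t2 n2))
  (cvgc (cD (ipc d1 n1) (ipc d2 n2)))) (cvgc (ipc k w))))).
Qed.

Lemma lyap_rate_cvg kappa c0 eps : (fun i => lyap_rate kappa c0 eps (X i) (Xt i)) @ F --> lyap_rate kappa c0 eps x xt.
Proof.
exact: (cD (cvgc (cD (ipc t1 t1) (ipc t2 t2)))
  (cvgc (cB (cB (cB (cD (ipc t1 t1) (ipc t2 t2)) (cvgc (cD (ipc a1 a1) (ipc a2 a2))))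
     (cvgc (ipc k w))) (cD (ipc b1 n1) (ipc b2 n2))))).
Qed.

End Continuity.

Variables (alphabar c0 : R).
Hypothesis pK : forall u, V u -> 0 <= ip (K u) u.
Hypothesis h1 : forall u v, V u -> V v -> c0 * (`|u| ^+ 2 + `|v| ^+ 2) <=
  ip (D u) u + ip (D v) v + alphabar * ip (K (u - v)) (u - v).

Lemma spath_state_cvg (a b : R) m (U Ut : R -> H * H) Zx Zu Zy Zv t :
  spath ip domA A a b m (fun t => (U t).1) (fun t => (Ut t).1) Zx Zu ->
  spath ip domA A a b m (fun t => (U t).2) (fun t => (Ut t).2) Zy Zv ->
  a <= t <= b -> state_cvg (seg_nbhs a b t) U Ut (U t) (Ut t).
Proof.
move=> p1 p2 tab; split.
- exact: spath_vcvg p1 tab.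
- exact: spath_vcvg p2 tab.
- by case: p1 => _ _ _ h _; exact: h.
- by case: p2 => _ _ _ h _; exact: h.
Qed.

Lemma vbounded_opp T x y : vbnd T -> V x -> V y -> T (x - y) = - T (y - x).
Proof. by move=> bT Vx Vy; rewrite !(vboundedB bT) // opprB. Qed.

(** Hypothesis (1) is stated at [alphabar]; as [alpha] is not smaller, the surplus (alpha -
    alphabar) (K w_t, w_t) of the damping has the right sign. The majorant [m r + m r] covers each
    component as well as their difference, so one gauge serves all terms. *)
Lemma lyap_slope (alpha kappa eps a b : R) (M m : R -> R) U Ut Zx Zu Zy Zv N :
  alphabar <= alpha -> 0 <= eps ->
  coupled_data ip domA A nu K D B alpha kappa a b m U Ut Zx Zu Zy Zv N ->
  primitive a b M (fun r => 1 + (m r + m r)) ->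
  slope_le a b M (fun t => lyap alpha kappa eps (U t) (Ut t))
    (fun t => lyap_rate kappa c0 eps (U t) (Ut t)).
Proof.
move=> al ep [[Im nN] p1 p2 ae] pM.
have m0 r : 0 <= m r by case: p1 => _ [[_ h] _] _ _ _; apply: le_trans (h r).
have M1 r : 1 <= 1 + (m r + m r) by rewrite lerDl addr_ge0.
have mm r : m r <= 1 + (m r + m r) by have := m0 r; lra.
have mm2 r : m r + m r <= 1 + (m r + m r) by lra.
have q1 := spathW mm p1; have q2 := spathW mm p2.
have qw := spathW mm2 (spathB hip hAsa hAcomp p1 p2).
have k1 := adiff_kinetic hip pM M1 q1; have k2 := adiff_kinetic hip pM M1 q2.
have x1 := adiff_potential hip pM M1 q1; have x2 := adiff_potential hip pM M1 q2.
have c1 := adiff_cross hip pM M1 q1; have c2 := adiff_cross hip pM M1 q2.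
have d1 := adiff_form hip hAsa hAcomp pM M1 q1 bD sD.
have d2 := adiff_form hip hAsa hAcomp pM M1 q2 bD sD.
have kw := adiff_form hip hAsa hAcomp pM M1 qw bK sK.
have pi1 := adiff_Pi hip hAsa hAcomp pM M1 q1 lB pB.
have pi2 := adiff_Pi hip hAsa hAcomp pM M1 q2 lB pB.
have dE := adiffD (adiffD (adiffD (adiffZ M1 2^-1 (adiffD k1 k2)) (adiffZ M1 (nu / 2) (adiffD x1 x2)))
  (adiffZ M1 (kappa / 2) kw)) (adiffD pi1 pi2).
have dL := adiffD dE (adiffZ M1 eps (adiffD (adiffD (adiffD c1 c2) (adiffZ M1 2^-1 (adiffD d1 d2))) (adiffZ M1 (alpha / 2) kw))).
have st t : a <= t <= b -> state_cvg (seg_nbhs a b t) U Ut (U t) (Ut t).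
  exact: spath_state_cvg p1 p2.
apply: (adiff_slope pM M1 dL (N := N)) => //.
- apply: cvg_on_continuous => t tab; have FF := seg_nbhs_filter a b t.
  exact: (lyap_rate_cvg (st t tab)).
- move=> t tab e e0; exists 1 => // s sab _.
  by rewrite !mulr0 !addr0 mulr0 addr0 subrr normr0.
move=> r rab Nr; have [[V1 V2] [-> ->] e1 e2] := ae r rab Nr.
have [VU1 _ _ _ _] := p1; have [VU2 _ _ _ _] := p2.
have {VU1} W1 := VU1 r rab; have {VU2} W2 := VU2 r rab.
rewrite !mulr0 !addr0 mulr0 addr0 /lyap_rate.
rewrite (e1 _ V1) (e2 _ V2) (e1 _ W1) (e2 _ W2).
case: (U r) (Ut r) V1 V2 W1 W2 {e1 e2} => [u v] [ut vt] /= V1 V2 W1 W2.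
have al0 : 0 <= alpha - alphabar by rewrite subr_ge0.
have := mulr_ge0 al0 (pK (VB V1 V2)); have := h1 V1 V2; rewrite -!hip.
rewrite (vbounded_opp bK W2 W1) (vbounded_opp bK V2 V1).
have := sK (VB V1 V2) (VB W1 W2); have := sD V1 W1; have := sD V2 W2.
rewrite !ipE (ipC ip (Ah ut) (Ah u)) (ipC ip (Ah vt) (Ah v)).
rewrite !(ipC ip _ (D _)) !(ipC ip _ (K (u - v))) => -> -> eK hc hK.
have {eK} -> : ip (K (ut - vt)) u = ip (K (ut - vt)) v + (ip (K (u - v)) ut - ip (K (u - v)) vt).
  by rewrite -eK; ring.
move: hc hK; gen_ip.
lra.
Qed.

End Lyapunov.

(** * The functional for u - v, and differences of two solutions *)

Section Differences.
Context {R : realType} {H : completeNormedModType R}.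
Variable ip : {dot H for (@idfun R)}.
Hypothesis hip : forall x : H, ip x x = `|x| ^+ 2.
Variables (domA : set H) (A : H -> H).
Hypothesis hAsa : self_adjoint ip domA A.
Hypothesis hApos : positive_op ip domA A.
Hypothesis hAcomp : compact_resolvent domA A.
Local Notation mu := (@lebesgue_measure R).
Local Notation V := (Hhalf ip domA A).
Local Notation Ah := (frac_pow ip domA A 2^-1).
Local Notation vbnd := (vbounded ip domA A).
Local Notation vcv := (vcvg ip domA A).
Variables (nu : R) (K D B : H -> H) (Pi : H -> R).
Hypotheses (bK : vbnd K) (sK : symmetric_on ip V K) (bD : vbnd D) (sD : symmetric_on ip V D).
Hypotheses (lB : lipschitz_on_balls ip domA A 2^-1 B).
Hypothesis pK : forall u, V u -> 0 <= ip (K u) u.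

(** The equation of w = u - v contains 2 alpha K w_t and 2 kappa K w, hence no factor 1/2 at [kappa]
    and [alpha]. The slot [q] receives a correction whose derivative compensates the work of B(u) -
    B(v). *)
Definition diffun (alpha kappa eps : R) (w wt : H) (q : R) : R :=
  2^-1 * ip wt wt + nu / 2 * ip (Ah w) (Ah w) + kappa * ip (K w) w + q
  + eps * (ip wt w + 2^-1 * ip (D w) w + alpha * ip (K w) w).

Definition diffun_rate (kappa c0 eps : R) (w wt db : H) : R :=
  - c0 * ip wt wt + eps * (ip wt wt - nu * ip (Ah w) (Ah w) - 2 * kappa * ip (K w) w - ip db w).

Section Continuity.
Variables (I : Type) (F : set_system I).
Context {FF : Filter F}.

Let cvgc (c : R) (f : I -> R) (l : R) : f @ F --> l -> (fun i => c * f i) @ F --> c * l.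
Proof. by move=> h; apply: cvgM h; exact: cvg_cst. Qed.
Let ipc (f g : I -> H) y z : f @ F --> y -> g @ F --> z -> (fun i => ip (f i) (g i)) @ F --> ip y z.
Proof. exact: ip_cvg. Qed.
Let cD (f g : I -> R) (y z : R) : f @ F --> y -> g @ F --> z -> (fun i => f i + g i) @ F --> y + z.
Proof. exact: cvgD. Qed.
Let cB (f g : I -> R) (y z : R) : f @ F --> y -> g @ F --> z -> (fun i => f i - g i) @ F --> y - z.
Proof. exact: cvgB. Qed.

Lemma diffun_cvg alpha kappa eps (w wt : I -> H) (q : I -> R) w' wt' q' :
  vcv F w w' -> wt @ F --> wt' -> q @ F --> q' ->
  (fun i => diffun alpha kappa eps (w i) (wt i) (q i)) @ F --> diffun alpha kappa eps w' wt' q'.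
Proof.
move=> hw ht hq; have a := vcvg_Ah hw.
have n : w @ F --> w' by exact: vcvg_norm hw.
have k : (fun i => K (w i)) @ F --> K w' by exact: vcvg_vbounded bK hw.
have d : (fun i => D (w i)) @ F --> D w' by exact: vcvg_vbounded bD hw.
exact: (cD (cD (cD (cD (cvgc (ipc ht ht)) (cvgc (ipc a a))) (cvgc (ipc k n))) hq)
  (cvgc (cD (cD (ipc ht n) (cvgc (ipc d n))) (cvgc (ipc k n))))).
Qed.

Lemma diffun_rate_cvg kappa c0 eps (w wt db : I -> H) w' wt' db' :
  vcv F w w' -> wt @ F --> wt' -> db @ F --> db' ->
  (fun i => diffun_rate kappa c0 eps (w i) (wt i) (db i)) @ F --> diffun_rate kappa c0 eps w' wt' db'.
Proof.
move=> hw ht hq; have a := vcvg_Ah hw.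
have n : w @ F --> w' by exact: vcvg_norm hw.
have k : (fun i => K (w i)) @ F --> K w' by exact: vcvg_vbounded bK hw.
exact: (cD (cvgc (ipc ht ht)) (cvgc (cB (cB (cB (ipc ht ht) (cvgc (ipc a a))) (cvgc (ipc k n))) (ipc hq n)))).
Qed.

End Continuity.

Variables (alphabar c0 : R).
Hypothesis h1 : forall u v, V u -> V v -> c0 * (`|u| ^+ 2 + `|v| ^+ 2) <=
  ip (D u) u + ip (D v) v + alphabar * ip (K (u - v)) (u - v).

(** Hypothesis (1) at the pair (w, -w), where the coupling form is evaluated at 2 w. *)
Lemma difference_damping w : V w -> c0 * ip w w <= ip (D w) w + 2 * alphabar * ip (K w) w.
Proof.
move=> Vw; have D0 := vboundedB bD Vw Vw; rewrite !subrr in D0.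
have DN : D (- w) = - D w.
  by rewrite -[- w]sub0r (vboundedB bD (V0 ip domA A) Vw) D0 sub0r.
have KK : K (w - - w) = K w + K w.
  have K0 := vboundedB bK Vw Vw; rewrite !subrr in K0.
  rewrite (vboundedB bK Vw (VN Vw)) -[- w]sub0r (vboundedB bK (V0 ip domA A) Vw) K0 sub0r opprK //.
have := h1 Vw (VN Vw); rewrite DN KK -!hip !ipE; gen_ip; lra.
Qed.

Lemma diffun_slope (alpha kappa eps a b : R) (M m Q k : R -> R) U Ut Zx Zu Zy Zv N :
  alphabar <= alpha -> 0 <= eps ->
  coupled_data ip domA A nu K D B alpha kappa a b m U Ut Zx Zu Zy Zv N ->
  primitive a b M (fun r => 1 + (m r + m r)) ->
  adiff a b M (fun r => 1 + (m r + m r)) Q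
    (fun t => ip (B (U t).1 - B (U t).2) ((Ut t).1 - (Ut t).2)) k ->
  continuous_on a b k ->
  slope_le a b M (fun t => diffun alpha kappa eps ((U t).1 - (U t).2) ((Ut t).1 - (Ut t).2) (Q t))
    (fun t => diffun_rate kappa c0 eps ((U t).1 - (U t).2) ((Ut t).1 - (Ut t).2) (B (U t).1 - B (U t).2) + k t).
Proof.
move=> al ep [[Im nN] p1 p2 ae] pM aQ ck.
have m0 r : 0 <= m r by case: p1 => _ [[_ h] _] _ _ _; apply: le_trans (h r).
have M1 r : 1 <= 1 + (m r + m r) by rewrite lerDl addr_ge0.
have mm2 r : m r + m r <= 1 + (m r + m r) by lra.
have qw := spathW mm2 (spathB hip hAsa hAcomp p1 p2).
have k1 := adiff_kinetic hip pM M1 qw.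
have x1 := adiff_potential hip pM M1 qw.
have c1 := adiff_cross hip pM M1 qw.
have d1 := adiff_form hip hAsa hAcomp pM M1 qw bD sD.
have kw := adiff_form hip hAsa hAcomp pM M1 qw bK sK.
have dE := adiffD (adiffD (adiffD (adiffD (adiffZ M1 2^-1 k1) (adiffZ M1 (nu / 2) x1)) (adiffZ M1 kappa kw)) aQ)
  (adiffZ M1 eps (adiffD (adiffD c1 (adiffZ M1 2^-1 d1)) (adiffZ M1 alpha kw))).
have st t : a <= t <= b -> state_cvg ip domA A (seg_nbhs a b t) U Ut (U t) (Ut t).
  exact: spath_state_cvg p1 p2.
have kE t : `|2^-1| * 0 + `|nu / 2| * 0 + `|kappa| * 0 + k t + `|eps| * (0 + `|2^-1| * 0 + `|alpha| * 0) = k t by ring.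
apply: (adiff_slope pM M1 (adiff_ext _ _ kE dE) (N := N)) => //.
  apply: cvg_on_continuous => t tab; have FF := seg_nbhs_filter a b t.
  have [s1 s2 s3 s4] := st t tab.
  apply: cvgD; last first.
    apply/cvgrPdist_lt => e e0; have [d d0 hd] := ck t tab e e0.
    rewrite /seg_nbhs /=; exists d => //= s; rewrite /= => st' sab.
    by rewrite distrC; apply: hd => //; rewrite distrC.
  apply: diffun_rate_cvg.
  - exact: vcvgB s1 s2.
  - exact: cvgB.
  - by apply: cvgB; [exact: (vcvg_lipschitz hip hAsa hAcomp lB s1)|exact: (vcvg_lipschitz hip hAsa hAcomp lB s2)].
move=> r rab Nr; have [[V1 V2] [-> ->] e1 e2] := ae r rab Nr.
have [VU1 _ _ _ _] := p1; have [VU2 _ _ _ _] := p2.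
have {VU1} W1 := VU1 r rab; have {VU2} W2 := VU2 r rab.
rewrite /diffun_rate lerD2r.
have Ww := VB W1 W2; have Vw := VB V1 V2.
rewrite !(ipBl ip (Zu r)) (e1 _ Vw) (e2 _ Vw) (e1 _ Ww) (e2 _ Ww).
case: (U r) (Ut r) V1 V2 W1 W2 Ww Vw {e1 e2} => [u v] [ut vt] /= V1 V2 W1 W2 Ww Vw.
have al0 : 0 <= alpha - alphabar by rewrite subr_ge0.
have := mulr_ge0 al0 (pK Vw); have := difference_damping Vw.
rewrite (vbounded_opp bK W2 W1) (vbounded_opp bK V2 V1).
rewrite -(AhB hip hAsa hAcomp V1 V2) (AhB hip hAsa hAcomp W1 W2).
have := sK Vw Ww; have := sD Vw Ww.
rewrite !(AhB hip hAsa hAcomp V1 V2) !(vboundedB bD V1 V2) !(vboundedB bD W1 W2).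
rewrite !ipE !(ipC ip _ (D _)) !(ipC ip _ (K (u - v))) (ipC ip (Ah ut) (Ah u)) (ipC ip (Ah vt) (Ah v)).
rewrite (ipC ip (Ah ut) (Ah v)) (ipC ip (Ah vt) (Ah u)) (ipC ip (Ah v) (Ah u)).
rewrite (ipC ip vt ut).
move=> eD eK hc hK.
have {eK} E1 : ip (K (ut - vt)) u = ip (K (ut - vt)) v + (ip (K (u - v)) ut - ip (K (u - v)) vt).
  by rewrite -eK; ring.
have {eD} E2 : ip (D ut) u = ip (D u) ut - ip (D v) ut - (ip (D u) vt - ip (D v) vt) + ip (D vt) u + ip (D ut) v - ip (D vt) v.
  move: eD; gen_ip; lra.
rewrite E1 E2.
move: hc hK; clear; gen_ip.
lra.
Qed.

Definition uniq_energy (kappa : R) (X Xt : H * H) : R :=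
  2^-1 * (ip Xt.1 Xt.1 + ip Xt.2 Xt.2) + nu / 2 * (ip (Ah X.1) (Ah X.1) + ip (Ah X.2) (Ah X.2))
  + kappa / 2 * ip (K (X.1 - X.2)) (X.1 - X.2).

Hypothesis pD : forall u, V u -> 0 <= ip (D u) u.

(** The damping of the difference of two solutions is nonnegative and is dropped; what remains is
    the work of the nonlinearity, which a Lipschitz bound controls by the energy. *)
Lemma uniq_slope (alpha kappa a b : R) (M m m' : R -> R) U Ut Zx Zu Zy Zv N U' Ut' Zx' Zu' Zy' Zv' N' :
  0 <= alpha ->
  coupled_data ip domA A nu K D B alpha kappa a b m U Ut Zx Zu Zy Zv N ->
  coupled_data ip domA A nu K D B alpha kappa a b m' U' Ut' Zx' Zu' Zy' Zv' N' ->
  primitive a b M (fun r => 1 + ((m r + m' r) + (m r + m' r))) ->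
  slope_le a b M (fun t => uniq_energy kappa (U t - U' t) (Ut t - Ut' t))
    (fun t => - ip (B (U t).1 - B (U' t).1) ((Ut t).1 - (Ut' t).1)
              - ip (B (U t).2 - B (U' t).2) ((Ut t).2 - (Ut' t).2)).
Proof.
move=> al [[Im nN] p1 p2 ae] [[Im' nN'] p1' p2' ae'] pM.
have m0 r : 0 <= m r by case: p1 => _ [[_ h] _] _ _ _; apply: le_trans (h r).
have m0' r : 0 <= m' r by case: p1' => _ [[_ h] _] _ _ _; apply: le_trans (h r).
pose mm r := m r + m' r; have mm0 r : 0 <= mm r by rewrite addr_ge0.
have M1 r : 1 <= 1 + (mm r + mm r) by rewrite lerDl addr_ge0.
have mmW r : mm r <= 1 + (mm r + mm r) by have := mm0 r; lra.
have mm2 r : mm r + mm r <= 1 + (mm r + mm r) by lra.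
have z1 := spathB hip hAsa hAcomp p1 p1'; have z2 := spathB hip hAsa hAcomp p2 p2'.
have qw := spathW mm2 (spathB hip hAsa hAcomp z1 z2).
have q1 := spathW mmW z1; have q2 := spathW mmW z2.
have k1 := adiff_kinetic hip pM M1 q1; have k2 := adiff_kinetic hip pM M1 q2.
have x1 := adiff_potential hip pM M1 q1; have x2 := adiff_potential hip pM M1 q2.
have kw := adiff_form hip hAsa hAcomp pM M1 qw bK sK.
have dE := adiffD (adiffD (adiffZ M1 2^-1 (adiffD k1 k2)) (adiffZ M1 (nu / 2) (adiffD x1 x2)))
  (adiffZ M1 (kappa / 2) kw).
have kE (t : R) : `|2^-1| * (0 + 0) + `|nu / 2| * (0 + 0) + `|kappa / 2| * 0 = 0 :> R by ring.
apply: (adiff_slope pM M1 (adiff_ext _ _ kE dE) (N := N `|` N')) => //.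
- apply: cvg_on_continuous => t tab; have FF := seg_nbhs_filter a b t.
  have [s1 s2 s3 s4] := spath_state_cvg p1 p2 tab; have [s1' s2' s3' s4'] := spath_state_cvg p1' p2' tab.
  have lb := vcvg_lipschitz hip hAsa hAcomp lB.
  apply: cvgB; [apply: cvgN|]; apply: ip_cvg => //; apply: cvgB => //.
  + exact: lb s1. + exact: lb s1'. + exact: lb s2. + exact: lb s2'.
- by move=> t tab e e0; exists 1 => // s sab _; rewrite subrr normr0.
- exact: leb_nullU.
move=> r rab Nr.
have [|[V1 V2] [-> ->] e1 e2] := ae r rab; first by move=> ?; apply: Nr; left.
have [|[V1' V2'] [-> ->] e1' e2'] := ae' r rab; first by move=> ?; apply: Nr; right.
have Vz := VB V1 V1'; have Vy := VB V2 V2'; have Vw := VB Vz Vy.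
have [W1 _ _ _ _] := p1; have [W2 _ _ _ _] := p2; have [W1' _ _ _ _] := p1'; have [W2' _ _ _ _] := p2'.
have {}W1 := W1 r rab; have {}W2 := W2 r rab; have {}W1' := W1' r rab; have {}W2' := W2' r rab.
rewrite !(ipBl ip (Zu r)) !(ipBl ip (Zv r)) (e1 _ Vz) (e2 _ Vy) (e1' _ Vz) (e2' _ Vy).
case: (U r) (Ut r) (U' r) (Ut' r) V1 V2 V1' V2' Vz Vy Vw W1 W2 W1' W2' {e1 e2 e1' e2'} => [u v] [ut vt] [u' v'] [ut' vt'] /= V1 V2 V1' V2' Vz Vy Vw W1 W2 W1' W2'.
have := pD Vz; have := pD Vy; have := mulr_ge0 al (pK Vw).
rewrite (vbounded_opp bK W2 W1) (vbounded_opp bK V2 V1) (vbounded_opp bK W2' W1') (vbounded_opp bK V2' V1').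
rewrite (vboundedB bK Vz Vy) !(vboundedB bK V1 V1') !(vboundedB bK V2 V2') (vboundedB bK V1 V2) (vboundedB bK V1' V2').
rewrite (vboundedB bK (VB W1 W1') (VB W2 W2')) !(vboundedB bK W1 W1') !(vboundedB bK W2 W2') (vboundedB bK W1 W2) (vboundedB bK W1' W2').
rewrite !(vboundedB bD V1 V1') !(vboundedB bD V2 V2').
rewrite !(AhB hip hAsa hAcomp V1 V1') !(AhB hip hAsa hAcomp V2 V2') !(AhB hip hAsa hAcomp W1 W1') !(AhB hip hAsa hAcomp W2 W2').
rewrite !ipE.
rewrite !(ipC ip (Ah ut)) !(ipC ip (Ah ut')) !(ipC ip (Ah vt)) !(ipC ip (Ah vt')).
rewrite addr0.
clear; gen_ip.
lra.
Qed.

End Differences.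

Lemma cvg_le_limits (R : realType) (I : Type) (F : set_system I) {FF : ProperFilter F}
  (f g : I -> R) (x y : R) : f @ F --> x -> g @ F --> y -> (\forall i \near F, f i <= g i) -> x <= y.
Proof.
move=> fx gy fg; rewrite -subr_ge0.
have h : (fun i => g i - f i) @ F --> y - x by exact: cvgB.
by apply: (cvgr_to_ge h); near=> i; rewrite subr_ge0; near: i.
Unshelve. all: by end_near. Qed.

(** * Generalized solutions as limits of strong ones *)

Section Solutions.
Context {R : realType} {H : completeNormedModType R}.
Variable ip : {dot H for (@idfun R)}.
Hypothesis hip : forall x : H, ip x x = `|x| ^+ 2.
Variables (domA : set H) (A : H -> H).
Hypothesis hAsa : self_adjoint ip domA A.
Hypothesis hApos : positive_op ip domA A.
Hypothesis hAcomp : compact_resolvent domA A.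
Local Notation mu := (@lebesgue_measure R).
Local Notation V := (Hhalf ip domA A).
Local Notation Ah := (frac_pow ip domA A 2^-1).
Local Notation vbnd := (vbounded ip domA A).
Local Notation vcv := (vcvg ip domA A).
Local Notation scv := (state_cvg ip domA A).
Variables (nu : R) (K D B : H -> H) (Pi : H -> R).
Hypothesis nu0 : 0 < nu.
Local Notation solution := (coupled_solution ip domA A nu K D B).
Local Notation strong := (coupled_strong ip domA A nu K D B).

Lemma norm2_ge1 (x : H * H) : `|x.1| <= norm2 x.
Proof.
have h : Num.sqrt (`|x.1| ^+ 2) <= norm2 x by rewrite ler_wsqrtr // lerDl sqr_ge0.
by move: h; rewrite sqrtr_sqr normr_id.
Qed.

Lemma norm2_ge2 (x : H * H) : `|x.2| <= norm2 x.
Proof.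
have h : Num.sqrt (`|x.2| ^+ 2) <= norm2 x by rewrite ler_wsqrtr // lerDr sqr_ge0.
by move: h; rewrite sqrtr_sqr normr_id.
Qed.

(** The last clause is uniform in time: it keeps whole approximating trajectories in a ball slightly
    larger than that of the limit, where the estimates for strong solutions are available. *)
Lemma generalized_approx (alpha kappa T : R) U Ut :
  coupled_generalized ip domA A nu K D B alpha kappa T U Ut ->
  exists Un Utn : nat -> R -> H * H,
  [/\ forall n, strong alpha kappa T (Un n) (Utn n),
    forall t, 0 <= t <= T -> scv \oo (fun n => Un n t) (fun n => Utn n t) (U t) (Ut t) &
    forall e, 0 < e -> \forall n \near \oo, forall t, 0 <= t <= T ->
      `|Ah (Un n t).1| <= `|Ah (U t).1| + e /\ `|Ah (Un n t).2| <= `|Ah (U t).2| + e].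
Proof.
move=> [[eV1 _ _ _] [eV2 _ _ _] [Un [Utn [hs hc]]]].
have snu : 0 < Num.sqrt nu by rewrite sqrtr_gt0.
have sV n t : 0 <= t <= T -> V (Un n t).1 /\ V (Un n t).2.
  move=> tT; have [utt [vtt [[[h1 _ _ _] _] [[h2 _ _ _] _] _]]] := hs n.
  by split; [exact: h1|exact: h2].
have near e : 0 < e -> \forall n \near \oo, forall t, 0 <= t <= T ->
   [/\ `|(Ut t).1 - (Utn n t).1| < e, `|(Ut t).2 - (Utn n t).2| < e,
       `|Ah (U t).1 - Ah (Un n t).1| < e & `|Ah (U t).2 - Ah (Un n t).2| < e].
  (* The second bound undoes the factor [Num.sqrt nu] in the definition of generalized solutions. *)
  move=> e0; pose d := Num.min e (Num.sqrt nu * e).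
  have d0 : 0 < d by rewrite lt_min e0 mulr_gt0.
  have de : d <= e by rewrite ge_min lexx.
  have dne : d <= Num.sqrt nu * e by rewrite ge_min lexx orbT.
  have := hc d d0; apply: filterS => n hn t tT; have := hn t tT.
  set p := norm2 _; set q := norm2 _ => pq.
  have [W1 W2] := sV n t tT.
  have p0 : 0 <= p by exact: sqrtr_ge0.
  have q0 : 0 <= q by exact: sqrtr_ge0.
  have pe : p < e.
    by apply: lt_le_trans de; apply: le_lt_trans pq; rewrite lerDl mulr_ge0 // ltW.
  have qe : q < e.
    rewrite -(ltr_pM2l snu); apply: lt_le_trans dne; apply: le_lt_trans pq.
    by rewrite lerDr.
  split.
  - exact: le_lt_trans (norm2_ge1 (Ut t - Utn n t)) pe.
  - exact: le_lt_trans (norm2_ge2 (Ut t - Utn n t)) pe.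
  - rewrite -(AhB hip hAsa hAcomp (eV1 t tT) W1).
    exact: le_lt_trans (norm2_ge1 (Ah (U t - Un n t).1, Ah (U t - Un n t).2)) qe.
  - rewrite -(AhB hip hAsa hAcomp (eV2 t tT) W2).
    exact: le_lt_trans (norm2_ge2 (Ah (U t - Un n t).1, Ah (U t - Un n t).2)) qe.
exists Un, Utn; split=> // [t tT|e e0].
  split; [split|split| |].
  - exact: eV1.
  - by apply: nearW => n; exact: (sV n t tT).1.
  - by apply/cvgrPdist_lt => e /near; apply: filterS => n /(_ t tT)[].
  - exact: eV2.
  - by apply: nearW => n; exact: (sV n t tT).2.
  - by apply/cvgrPdist_lt => e /near; apply: filterS => n /(_ t tT)[].
  - by apply/cvgrPdist_lt => e /near; apply: filterS => n /(_ t tT)[].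
  - by apply/cvgrPdist_lt => e /near; apply: filterS => n /(_ t tT)[].
have := near e e0; apply: filterS => n hn t tT; have [_ _ h1 h2] := hn t tT.
have tri (x y : H) : `|x - y| < e -> `|y| <= `|x| + e.
  move=> xy; have -> : y = x - (x - y) by rewrite opprB addrC subrK.
  by apply: le_trans (ler_normB _ _) _; rewrite lerD2l ltW.
by split; exact: tri.
Qed.

Lemma solution_V alpha kappa U Ut t : solution alpha kappa U Ut -> 0 <= t -> V (U t).1 /\ V (U t).2.
Proof.
move=> /(_ (t + 1)) h t0; have [|[h1 _ _ _] [h2 _ _ _] _] := h; first by rewrite ltr_wpDl.
by split; [apply: h1|apply: h2]; rewrite t0 lerDl ler01.
Qed.

Lemma solution_cvg0 alpha kappa U Ut : solution alpha kappa U Ut ->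
  scv (seg_nbhs 0 1 0) U Ut (U 0) (Ut 0).
Proof.
move=> /(_ 1 ltr01) [[h1 h2 h3 _] [k1 k2 k3 _] _].
have z : 0 <= (0 : R) <= 1 by rewrite lexx ler01.
split.
- split; [exact: h1|by apply: (@nearW _ (nbhs 0)) => s; exact: h1|].
  exact: (within_cvg_on _ _ h2).
- split; [exact: k1|by apply: (@nearW _ (nbhs 0)) => s; exact: k1|].
  exact: (within_cvg_on _ _ k2).
- exact: (within_cvg_on _ _ h3).
- exact: (within_cvg_on _ _ k3).
Qed.

(* Estimates hold for positive times first, as strong solutions are only
   differentiable in the open interval. *)
Lemma right_limit_le (G : R -> R) (x d0 : R) : 0 < d0 -> G @ seg_nbhs 0 1 0 --> G 0 ->
  (forall s, 0 < s -> s < d0 -> x <= G s) -> x <= G 0.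
Proof.
move=> d00 cG h; apply/ler_addgt0Pr => e e0; have FF := @seg_nbhs_filter R 0 1 0.
have /cvgrPdist_lt /(_ e e0) := cG; rewrite /seg_nbhs /= => /nbhs_ballP [d /= dp hd].
pose m := Num.min 1 (Num.min d d0); pose s := m / 2.
have m0 : 0 < m by rewrite !lt_min ltr01 dp.
have [m1 [md md0]] : m <= 1 /\ m <= d /\ m <= d0.
  have := lexx m; rewrite {2}/m !le_min => /and3P[*] //.
have s0 : 0 < s by rewrite divr_gt0.
have sm : s < m by rewrite ltr_pdivrMr // ltr_pMr // ltr1n.
have xs := h s s0 (lt_le_trans sm md0).
have := hd s; rewrite -ball_normE /= sub0r normrN (gtr0_norm s0) => /(_ (lt_le_trans sm md)).
have s01 : 0 <= s <= 1 by rewrite ltW //= ltW // (lt_le_trans sm).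
move=> /(_ s01) /ltr_normlP[h1 _]; apply: (le_trans xs).
by move: h1; rewrite opprB ltrBlDl => /ltW.
Qed.

End Solutions.

(** * Multiples and exponentials in slope inequalities *)

Section MoreSlopes.
Context {R : realType}.
Implicit Types (a b : R) (M G h : R -> R).

Lemma slope_leC a b M G h (c : R) : slope_le a b M G h -> slope_le a b M (fun t => G t + c) h.
Proof.
move=> hG t tab e e0; have [d d0 hd] := hG t tab e e0; exists d => // s s' as_ st ts' s'b ds ds'.
by rewrite (_ : _ - _ = G s' - G s); [exact: hd|ring].
Qed.

Lemma slope_leZ a b M G h (c : R) : 0 <= c -> gauge a b M -> slope_le a b M G h ->
  slope_le a b M (fun t => c * G t) (fun t => c * h t).
Proof.
move=> c0 gM hG t tab e e0; have c1 : 0 < c + 1 by rewrite ltr_wpDl.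
have [d d0 hd] := hG t tab _ (divr_gt0 e0 c1); exists d => // s s' as_ st ts' s'b ds ds'.
rewrite -mulrBr; apply: le_trans (ler_wpM2l c0 (hd s s' as_ st ts' s'b ds ds')) _.
rewrite mulrDr !mulrA lerD2l ler_wpM2r //.
  by rewrite subr_ge0 (gauge_le gM) //; exact: le_trans st ts'.
by rewrite ler_pdivrMr // mulrC ler_pM2l // lerDl.
Qed.

Lemma cvg_on_expR a b (F : R -> R) : @cvg_on R R a b F -> @cvg_on R R a b (expR \o F).
Proof.
move=> cF t tab; have FF := seg_nbhs_filter a b t.
exact: continuous_cvg (@continuous_expR R (F t)) (cF t tab).
Qed.

Lemma cvg_on_linear a b (c : R) : @cvg_on R R a b (fun t => c * t).
Proof.
move=> t tab; have FF := seg_nbhs_filter a b t; apply: cvgM; first exact: cvg_cst.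
exact: cvg_within.
Qed.

(** The source term of Gronwall's inequality becomes a separate summand: [slope_le_mul_expR] asks
    for a nonnegative factor, and the Lyapunov function minus C1 / gamma may change sign. *)
Lemma slope_le_oppexp a b M (c g : R) : 0 <= c -> 0 <= g -> gauge a b M ->
  slope_le a b M (fun t => - (c * expR (g * t))) (fun t => - (c * g * expR (g * t))).
Proof.
move=> c0 g0 gM t tab e e0; have cg1 : 0 < c * g + 1 by rewrite ltr_wpDl // mulr_ge0.
have := cvg_on_continuous (cvg_on_expR (@cvg_on_linear a b g)) tab (divr_gt0 e0 cg1).
move=> [d d0 hd]; exists d => // s s' as_ st ts' s'b ds ds'.
have ss' := le_trans st ts'.
have sab : a <= s <= b by rewrite as_ (le_trans ss' s'b).
have /= /ltr_normlP[h1 _] : `|expR (g * s) - expR (g * t)| < e / (c * g + 1).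
  by apply: hd => //; rewrite distrC ger0_norm // subr_ge0.
have h2 := expR_sub_le (g * s) (g * s').
rewrite -opprD -mulrBr -mulrN opprB.
have D0 : 0 <= s' - s by rewrite subr_ge0.
apply: (@le_trans _ _ (c * (expR (g * s) * (g * s - g * s')))); first by rewrite ler_wpM2l.
rewrite (_ : c * _ = - (c * g * expR (g * t)) * (s' - s) + c * g * (expR (g * t) - expR (g * s)) * (s' - s)); last by ring.
rewrite lerD2l; apply: (@le_trans _ _ (e * (s' - s))).
  rewrite ler_wpM2r //; apply: (@le_trans _ _ (c * g * (e / (c * g + 1)))).
    by rewrite ler_wpM2l ?mulr_ge0 // ltW // -opprB.
  by rewrite mulrA ler_pdivrMr // mulrC ler_wpM2l ?(ltW e0) // lerDl.
by rewrite ler_pM2l //; exact: gM.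
Qed.

End MoreSlopes.

(** * Dissipation, synchronization and uniqueness of solutions *)

Section Estimates.
Context {R : realType} {H : completeNormedModType R}.
Variable ip : {dot H for (@idfun R)}.
Hypothesis hip : forall x : H, ip x x = `|x| ^+ 2.
Variables (domA : set H) (A : H -> H).
Hypothesis hAsa : self_adjoint ip domA A.
Hypothesis hApos : positive_op ip domA A.
Hypothesis hAcomp : compact_resolvent domA A.
Local Notation mu := (@lebesgue_measure R).
Local Notation V := (Hhalf ip domA A).
Local Notation Ah := (frac_pow ip domA A 2^-1).
Local Notation vbnd := (vbounded ip domA A).
Local Notation scv := (state_cvg ip domA A).
Variables (nu : R) (K D B : H -> H) (Pi : H -> R).
Hypothesis nu0 : 0 < nu.
Hypotheses (bK : vbnd K) (sK : symmetric_on ip V K) (bD : vbnd D) (sD : symmetric_on ip V D).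
Hypotheses (lB : lipschitz_on_balls ip domA A 2^-1 B) (pB : frechet_potential ip domA A B Pi).
Variables (alphabar c0 : R).
Hypothesis pK : forall u, V u -> 0 <= ip (K u) u.
Hypothesis h1 : forall u v, V u -> V v -> c0 * (`|u| ^+ 2 + `|v| ^+ 2) <=
  ip (D u) u + ip (D v) v + alphabar * ip (K (u - v)) (u - v).
Variables (alpha kappa : R).
Hypothesis al : alphabar <= alpha.
Local Notation solution := (coupled_solution ip domA A nu K D B alpha kappa).
Local Notation strong := (coupled_strong ip domA A nu K D B alpha kappa).
Local Notation lyap := (lyap ip domA A nu K D Pi alpha kappa).
Local Notation energy := (energy ip domA A nu K Pi kappa).
Local Notation lyap_rate := (lyap_rate ip domA A nu K B kappa c0).
Local Notation diffun := (diffun ip domA A nu K D alpha kappa).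
Local Notation diffun_rate := (diffun_rate ip domA A nu K kappa c0).

Lemma data_majorant_ge0 a b m U Ut Zx Zu Zy Zv N :
  coupled_data ip domA A nu K D B alpha kappa a b m U Ut Zx Zu Zy Zv N -> forall r, 0 <= m r.
Proof. by move=> [_ p1 _ _] r; case: p1 => _ [[_ h] _] _ _ _; apply: le_trans (h r). Qed.

Section Dissipation.
Variables (eps gamma C0 C1 : R).
Hypotheses (ep : 0 <= eps) (g0 : 0 < gamma) (C10 : 0 <= C1).
Hypothesis lyap_ge0 : forall X Xt, V X.1 -> V X.2 -> 0 <= lyap eps X Xt + C0.
Hypothesis rate : forall X Xt, V X.1 -> V X.2 ->
  lyap_rate eps X Xt <= - gamma * (lyap eps X Xt + C0) + C1.

Lemma strong_dissipation T U Ut s t : strong T U Ut -> 0 < s -> s < t -> t < T ->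
  (lyap eps (U t) (Ut t) + C0 - C1 / gamma) * expR (gamma * t) <=
  (lyap eps (U s) (Ut s) + C0 - C1 / gamma) * expR (gamma * s).
Proof.
move=> sU s0 st tT.
have [m [Zx [Zu [Zy [Zv [N data]]]]]] := coupled_strong_data hip sU s0 st tT.
have m0 := data_majorant_ge0 data; have [[Im nN] p1 p2 ae] := data.
have [M pM] : exists M, primitive s t M (fun r => 1 + (m r + m r)).
  apply: gauge_exists; rewrite (_ : _ \o _ = ((EFin \o m) \+ (EFin \o m))%E) //.
  exact: integrableD.
have gM : gauge s t M by apply: (primitive_gauge pM) => r; rewrite lerDl addr_ge0.
have sl := slope_leC C0 (lyap_slope hip hAsa hApos hAcomp bK sK bD sD lB pB pK h1 al ep data pM).
have sc r : s <= r <= t -> scv (seg_nbhs s t r) U Ut (U r) (Ut r) by exact: spath_state_cvg p1 p2.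
have VU r : s <= r <= t -> V (U r).1 /\ V (U r).2.
  by move=> rst; have [[? _ _] [? _ _] _ _] := sc r rst.
have cG : @cvg_on R R s t (fun r => lyap eps (U r) (Ut r) + C0).
  move=> r rst; have FF := seg_nbhs_filter s t r; apply: cvgD; last exact: cvg_cst.
  exact: (lyap_cvg hip hAsa hApos hAcomp bK bD pB (sc r rst)).
have sF := slope_le_linear gamma gM.
have := slope_le_mul_expR gM (cvg_on_continuous cG) (cvg_on_continuous (cvg_on_expR (@cvg_on_linear R s t gamma))) _ sl sF.
move=> /(_ _)/wrap[]; first by move=> r /VU[]; exact: lyap_ge0.
move=> sGE; have sE := slope_le_oppexp (divr_ge0 C10 (ltW g0)) (ltW g0) gM.
have sT : slope_le s t M (fun r => (lyap eps (U r) (Ut r) + C0) * expR (gamma * r) + - (C1 / gamma * expR (gamma * r))) (fun=> 0).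
  apply: slope_leW (slope_leD sGE sE) => r rst /=.
  have [V1 V2] := VU r rst; have := rate (Ut r) V1 V2.
  rewrite divfK ?gt_eqF // => hr; rewrite mulrC -mulrBl pmulr_lle0 ?expR_gt0 //.
  by move: hr; move: (lyap _ _ _) (lyap_rate _ _ _) => p q; rewrite mulNr (mulrC gamma); lra.
have := slope_le_nonincreasing gM sT (lexx s) (ltW st) (lexx t).
by rewrite -!mulrBl.
Qed.

Lemma solution_dissipation U Ut t : solution U Ut -> 0 <= t ->
  lyap eps (U t) (Ut t) + C0 <= C1 / gamma + (lyap eps (U 0) (Ut 0) + C0) * expR (- (gamma * t)).
Proof.
move=> sU t0.
pose P s := (lyap eps (U s) (Ut s) + C0 - C1 / gamma) * expR (gamma * s).
have posi s t' : 0 < s -> s < t' -> P t' <= P s.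
  move=> s0 st; have T0 : 0 < t' + 1 by rewrite ltr_wpDl // ltW // (lt_trans s0).
  have [Un [Utn [hs hc _]]] := generalized_approx hip hAsa hAcomp nu0 (sU _ T0).
  have cv r : 0 <= r <= t' + 1 -> (fun n => (lyap eps (Un n r) (Utn n r) + C0 - C1 / gamma) * expR (gamma * r)) @ \oo --> P r.
    move=> rT; apply: cvgM; last exact: cvg_cst.
    apply: cvgB; last exact: cvg_cst; apply: cvgD; last exact: cvg_cst.
    exact: (lyap_cvg hip hAsa hApos hAcomp bK bD pB (hc r rT)).
  apply: (cvg_le_limits (cv t' _) (cv s _)).
  - by rewrite lerDl ler01 andbT ltW // (lt_trans s0).
  - by rewrite (ltW s0) ltW // (lt_trans st) // ltrDl.
  by apply: nearW => n; apply: (strong_dissipation (hs n)) => //; rewrite ltrDl.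
have at0 : P t <= P 0.
  have [->|tn] := eqVneq t 0; first exact: lexx.
  have tp : 0 < t by rewrite lt_def tn.
  apply: (right_limit_le tp) => [|s s0 st]; last exact: posi.
  apply: cvgM; last first.
    by apply: (cvg_on_expR (@cvg_on_linear R 0 1 gamma)); rewrite lexx ler01.
  have FF := @seg_nbhs_filter R 0 1 0.
  apply: cvgB; last exact: cvg_cst; apply: cvgD; last exact: cvg_cst.
  exact: (lyap_cvg hip hAsa hApos hAcomp bK bD pB (solution_cvg0 sU)).
move: at0; rewrite /P mulr0 expR0 mulr1 -ler_pdivlMr ?expR_gt0 // -expRN.
set e := expR _; set g := lyap _ _ _ + C0; set p := lyap _ _ _ + C0.
have e0 : 0 < e by exact: expR_gt0.
have : 0 <= C1 / gamma * e by rewrite mulr_ge0 ?divr_ge0 // ltW.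
by rewrite lerBlDl mulrBl; move: (C1 / gamma * e) (g * e) => x y; lra.
Qed.

End Dissipation.

Section Synchronization.
Variables (eps omega k rho : R) (Q : H -> H -> R) (kq : H * H -> H * H -> R).
Hypotheses (ep : 0 <= eps) (k0 : 0 <= k) (om0 : 0 <= omega).
Local Notation inball X := (V X.1 /\ V X.2 /\ `|Ah X.1| <= rho + 1 /\ `|Ah X.2| <= rho + 1).
Local Notation Phi X Xt := (diffun eps (X.1 - X.2) (Xt.1 - Xt.2) (Q X.1 X.2)).
Hypothesis Q_cvg : forall (I : Type) (F : set_system I) (FF : Filter F) X Xt x xt,
  scv F X Xt x xt -> (fun i => Q (X i).1 (X i).2) @ F --> Q x.1 x.2.
Hypothesis kq_cvg : forall (I : Type) (F : set_system I) (FF : Filter F) X Xt x xt,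
  scv F X Xt x xt -> (fun i => kq (X i) (Xt i)) @ F --> kq x xt.
Hypothesis Q_adiff : forall a b M m U Ut Zx Zu Zy Zv,
  primitive a b M (fun r => 1 + (m r + m r)) -> (forall r, 0 <= m r) ->
  spath ip domA A a b m (fun t => (U t).1) (fun t => (Ut t).1) Zx Zu ->
  spath ip domA A a b m (fun t => (U t).2) (fun t => (Ut t).2) Zy Zv ->
  (forall t, a <= t <= b -> `|Ah (U t).1| <= rho + 1 /\ `|Ah (U t).2| <= rho + 1) ->
  adiff a b M (fun r => 1 + (m r + m r)) (fun t => Q (U t).1 (U t).2)
    (fun t => ip (B (U t).1 - B (U t).2) ((Ut t).1 - (Ut t).2)) (fun t => kq (U t) (Ut t)).
Hypothesis Phi_ge0 : forall X Xt, inball X -> 0 <= Phi X Xt.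
Hypothesis Phi_rate : forall X Xt, inball X ->
  diffun_rate eps (X.1 - X.2) (Xt.1 - Xt.2) (B X.1 - B X.2) + kq X Xt
  + Phi X Xt * (k * (- c0 * (ip Xt.1 Xt.1 + ip Xt.2 Xt.2)) + omega) <= 0.

Lemma Phi_cvg (I : Type) (F : set_system I) (FF : Filter F) X Xt x xt :
  scv F X Xt x xt -> (fun i => Phi (X i) (Xt i)) @ F --> Phi x xt.
Proof.
move=> /[dup] hX [x1 x2 t1 t2].
apply: (diffun_cvg hip hAsa hApos hAcomp bK bD).
- exact: vcvgB x1 x2.
- exact: cvgB.
- exact: (Q_cvg _ hX).
Qed.

(** The slope of the energy is at most -c0 (|u_t|^2 + |v_t|^2), so [Phi_rate] says precisely that
    the product rule yields a nonpositive slope. *)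
Lemma strong_synchronization T U Ut s t : strong T U Ut -> 0 < s -> s < t -> t < T ->
  (forall r, s <= r <= t -> `|Ah (U r).1| <= rho + 1 /\ `|Ah (U r).2| <= rho + 1) ->
  Phi (U t) (Ut t) * expR (k * energy (U t) (Ut t) + omega * t) <=
  Phi (U s) (Ut s) * expR (k * energy (U s) (Ut s) + omega * s).
Proof.
move=> sU s0 st tT ball.
have [m [Zx [Zu [Zy [Zv [N data]]]]]] := coupled_strong_data hip sU s0 st tT.
have m0 := data_majorant_ge0 data; have [[Im nN] p1 p2 ae] := data.
have [M pM] : exists M, primitive s t M (fun r => 1 + (m r + m r)).
  apply: gauge_exists; rewrite (_ : _ \o _ = ((EFin \o m) \+ (EFin \o m))%E) //.
  exact: integrableD.
have gM : gauge s t M by apply: (primitive_gauge pM) => r; rewrite lerDl addr_ge0.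
(* The energy is the Lyapunov function for [eps] = 0. *)
have sE : slope_le s t M (fun t => energy (U t) (Ut t)) (fun t => - c0 * (ip (Ut t).1 (Ut t).1 + ip (Ut t).2 (Ut t).2)).
  have := lyap_slope hip hAsa hApos hAcomp bK sK bD sD lB pB pK h1 al (lexx 0) data pM.
  by congr (slope_le s t M _ _); apply/funext => r; rewrite ?/lyap ?/lyap_rate mul0r addr0.
have sc r : s <= r <= t -> scv (seg_nbhs s t r) U Ut (U r) (Ut r) by exact: spath_state_cvg p1 p2.
have VU r : s <= r <= t -> inball (U r).
  move=> rst; have [[? _ _] [? _ _] _ _] := sc r rst; have [? ?] := ball r rst.
  by do ?split.
have aQ := Q_adiff pM m0 p1 p2 ball.
have ck : continuous_on s t (fun t => kq (U t) (Ut t)).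
  by apply: cvg_on_continuous => r rst; exact: (kq_cvg (seg_nbhs_filter s t r) (sc r rst)).
have sP := diffun_slope hip hAsa hApos hAcomp bK sK bD sD lB pK h1 al ep data pM aQ ck.
have sF := slope_leD (slope_leZ k0 gM sE) (slope_le_linear omega gM).
have cP : continuous_on s t (fun r => Phi (U r) (Ut r)).
  by apply: cvg_on_continuous => r rst; exact: (Phi_cvg (seg_nbhs_filter s t r) (sc r rst)).
have cF : @cvg_on R R s t (fun r => k * energy (U r) (Ut r) + omega * r).
  move=> r rst; have FF := seg_nbhs_filter s t r.
  apply: cvgD; last exact: (@cvg_on_linear R s t omega r rst).
  apply: cvgM; first exact: cvg_cst.
  exact: (energy_cvg hip hAsa hApos hAcomp bK pB (sc r rst)).
have P0 r : s <= r <= t -> 0 <= Phi (U r) (Ut r) by move=> /VU; exact: Phi_ge0.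
have sPE := slope_le_mul_expR gM cP (cvg_on_continuous (cvg_on_expR cF)) P0 sP sF.
have sT : slope_le s t M (fun r => Phi (U r) (Ut r) * expR (k * energy (U r) (Ut r) + omega * r)) (fun=> 0).
  apply: slope_leW sPE => r rst /=.
  by rewrite pmulr_rle0 ?expR_gt0 //; exact: Phi_rate (VU r rst).
by have h := slope_le_nonincreasing gM sT (lexx s) (ltW st) (lexx t); exact: h.
Qed.

(** The solution stays in the ball of radius [rho], while the estimates are assumed on that of
    radius [rho + 1]: strong approximations within distance 1 remain where the estimates hold. *)
Lemma solution_synchronization U Ut s t : solution U Ut -> 0 < s -> s < t ->
  (forall r, s <= r -> `|Ah (U r).1| <= rho /\ `|Ah (U r).2| <= rho) ->
  Phi (U t) (Ut t) * expR (k * energy (U t) (Ut t) + omega * t) <=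
  Phi (U s) (Ut s) * expR (k * energy (U s) (Ut s) + omega * s).
Proof.
move=> sU s0 st ball; have t0 := lt_trans s0 st.
have T0 : 0 < t + 1 by rewrite ltr_wpDl // ltW.
have [Un [Utn [hs hc hb]]] := generalized_approx hip hAsa hAcomp nu0 (sU _ T0).
pose P X Xt r := Phi X Xt * expR (k * energy X Xt + omega * r).
have cv r : 0 <= r <= t + 1 -> (fun n => P (Un n r) (Utn n r) r) @ \oo --> P (U r) (Ut r) r.
  move=> rT; apply: cvgM; first exact: Phi_cvg (hc r rT).
  have hk : (fun n => k * energy (Un n r) (Utn n r) + omega * r) @ \oo --> k * energy (U r) (Ut r) + omega * r.
    apply: cvgD; last exact: cvg_cst.
    apply: cvgM; first exact: cvg_cst.
    exact: (energy_cvg hip hAsa hApos hAcomp bK pB (hc r rT)).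
  exact: continuous_cvg (@continuous_expR R _) hk.
apply: (cvg_le_limits (cv t _) (cv s _)).
- by rewrite lerDl ler01 andbT ltW.
- by rewrite (ltW s0) ltW // (lt_trans st) // ltrDl.
have := hb 1 ltr01; apply: filterS => n hn.
apply: (strong_synchronization (hs n)) => // [|r /andP[sr rt]]; first by rewrite ltrDl.
have [|b1 b2] := hn r; first by rewrite (le_trans (ltW s0) sr) (le_trans rt) // lerDl ler01.
have [c1 c2] := ball r sr.
by split; [apply: le_trans b1 _|apply: le_trans b2 _]; rewrite lerD2r.
Qed.

End Synchronization.

Section Uniqueness.
Variables (rho L : R).
Hypothesis pD : forall u, V u -> 0 <= ip (D u) u.
Hypotheses (al0 : 0 <= alpha) (ka0 : 0 <= kappa) (L0 : 0 <= L).
Hypothesis hL : forall u v, V u -> V v -> `|Ah u| <= rho + 1 -> `|Ah v| <= rho + 1 ->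
  `|B u - B v| <= L * `|Ah (u - v)|.
Local Notation E := (uniq_energy ip domA A nu K kappa).

Lemma uniq_energy_ge (X Xt : H * H) : V X.1 -> V X.2 ->
  2^-1 * (`|Xt.1| ^+ 2 + `|Xt.2| ^+ 2) + nu / 2 * (`|Ah X.1| ^+ 2 + `|Ah X.2| ^+ 2) <= E X Xt.
Proof.
move=> V1 V2; rewrite /uniq_energy -!hip lerDl mulr_ge0 ?divr_ge0 //.
by apply: pK; exact: VB.
Qed.

Let lam := L * (1 + nu^-1).

Lemma uniq_rate (X X' Xt Xt' : H * H) : V X.1 -> V X.2 -> V X'.1 -> V X'.2 ->
  `|Ah X.1| <= rho + 1 -> `|Ah X.2| <= rho + 1 -> `|Ah X'.1| <= rho + 1 -> `|Ah X'.2| <= rho + 1 ->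
  - ip (B X.1 - B X'.1) (Xt.1 - Xt'.1) - ip (B X.2 - B X'.2) (Xt.2 - Xt'.2) <= lam * E (X - X') (Xt - Xt').
Proof.
move=> V1 V2 V1' V2' b1 b2 b1' b2'.
have := @uniq_energy_ge (X - X') (Xt - Xt') (VB V1 V1') (VB V2 V2').
set e := E _ _ => /=.
have one (x x' xt xt' : H) : V x -> V x' -> `|Ah x| <= rho + 1 -> `|Ah x'| <= rho + 1 ->
    - ip (B x - B x') (xt - xt') <= L * (2^-1 * (`|xt - xt'| ^+ 2 + `|Ah (x - x')| ^+ 2)).
  move=> Vx Vx' bx bx'; apply: le_trans (ler_norm _) _; rewrite normrN.
  apply: le_trans (ip_cauchy_schwarz hip _ _) _.
  apply: le_trans (ler_wpM2r (normr_ge0 _) (hL Vx Vx' bx bx')) _; rewrite -mulrA ler_wpM2l //.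
  set p := `|Ah _|; set q := `|xt - xt'|; have := sqr_ge0 (p - q); rewrite sqrrB; lra.
have o1 := one _ _ Xt.1 Xt'.1 V1 V1' b1 b1'; have o2 := one _ _ Xt.2 Xt'.2 V2 V2' b2 b2'.
move=> he; apply: le_trans (lerD o1 o2) _; rewrite -mulrDr /lam -mulrA ler_wpM2l //.
move: he; set p := `|_| ^+ 2; set q := `|_| ^+ 2; set p' := `|_| ^+ 2; set q' := `|_| ^+ 2 => he.
have pp : 0 <= p + q by rewrite addr_ge0 ?sqr_ge0.
have qq : 0 <= p' + q' by rewrite addr_ge0 ?sqr_ge0.
have n0 : 0 < nu^-1 by rewrite invr_gt0.
have : 2^-1 * (p' + q') <= nu^-1 * e.
  rewrite -(ler_pM2l nu0) [leRHS]mulrA mulfV ?gt_eqF // mul1r.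
  by apply: le_trans he; rewrite mulrA ler_wpDl // mulr_ge0 // invr_ge0.
have : 2^-1 * (p + q) <= e.
  by apply: le_trans he; rewrite lerDl mulr_ge0 // divr_ge0 // ltW.
by rewrite mulrDl mul1r; move: (nu^-1 * e) => z; lra.
Qed.

Lemma uniq_energy_cvg (I : Type) (F : set_system I) (FF : Filter F) X Xt X' Xt' x xt x' xt' :
  scv F X Xt x xt -> scv F X' Xt' x' xt' ->
  (fun i => E (X i - X' i) (Xt i - Xt' i)) @ F --> E (x - x') (xt - xt').
Proof.
move=> [x1 x2 t1 t2] [x1' x2' t1' t2'].
have d1 : vcvg ip domA A F (fun i => (X i).1 - (X' i).1) (x.1 - x'.1) by exact: vcvgB.
have d2 : vcvg ip domA A F (fun i => (X i).2 - (X' i).2) (x.2 - x'.2) by exact: vcvgB.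
have dw : vcvg ip domA A F (fun i => ((X i).1 - (X' i).1) - ((X i).2 - (X' i).2)) ((x.1 - x'.1) - (x.2 - x'.2)) by exact: vcvgB.
have cM (c : R) (f : I -> R) (l : R) : f @ F --> l -> (fun i => c * f i) @ F --> c * l.
  by move=> h; apply: cvgM h; exact: cvg_cst.
apply: cvgD; [apply: cvgD|]; apply: cM.
- by apply: cvgD; apply: ip_cvg => //; exact: cvgB.
- by apply: cvgD; apply: ip_cvg => //; [exact: (vcvg_Ah d1)|exact: (vcvg_Ah d1)|exact: (vcvg_Ah d2)|exact: (vcvg_Ah d2)].
- apply: ip_cvg => //; last exact: (vcvg_norm hip hAsa hApos hAcomp dw).
  exact: (vcvg_vbounded hip hAsa hAcomp bK dw).
Qed.

Lemma strong_uniqueness T U Ut U' Ut' s t : strong T U Ut -> strong T U' Ut' -> 0 < s -> s < t -> t < T ->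
  (forall r, s <= r <= t -> `|Ah (U r).1| <= rho + 1 /\ `|Ah (U r).2| <= rho + 1) ->
  (forall r, s <= r <= t -> `|Ah (U' r).1| <= rho + 1 /\ `|Ah (U' r).2| <= rho + 1) ->
  E (U t - U' t) (Ut t - Ut' t) * expR (- lam * t) <= E (U s - U' s) (Ut s - Ut' s) * expR (- lam * s).
Proof.
move=> sU sU' s0 st tT ball ball'.
have [m [Zx [Zu [Zy [Zv [N data]]]]]] := coupled_strong_data hip sU s0 st tT.
have [m' [Zx' [Zu' [Zy' [Zv' [N' data']]]]]] := coupled_strong_data hip sU' s0 st tT.
have m0 := data_majorant_ge0 data; have [[Im nN] p1 p2 ae] := data.
have m0' := data_majorant_ge0 data'; have [[Im' nN'] p1' p2' ae'] := data'.
have Imm : mu.-integrable `[s, t] (EFin \o (fun r => m r + m' r)).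
  by rewrite (_ : _ \o _ = ((EFin \o m) \+ (EFin \o m'))%E) //; exact: integrableD.
have [M pM] : exists M, primitive s t M (fun r => 1 + ((m r + m' r) + (m r + m' r))).
  apply: gauge_exists; rewrite (_ : _ \o _ = ((EFin \o (fun r => (m r + m' r)%R)) \+ (EFin \o (fun r => (m r + m' r)%R)))%E) //.
  exact: integrableD.
have gM : gauge s t M by apply: (primitive_gauge pM) => r; rewrite lerDl !addr_ge0.
have sc r : s <= r <= t -> scv (seg_nbhs s t r) U Ut (U r) (Ut r) by exact: spath_state_cvg p1 p2.
have sc' r : s <= r <= t -> scv (seg_nbhs s t r) U' Ut' (U' r) (Ut' r) by exact: spath_state_cvg p1' p2'.
have sE := uniq_slope hip hAsa hAcomp bK sK bD lB pK pD al0 data data' pM.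
have sF := slope_le_linear (- lam) gM.
have cE : continuous_on s t (fun r => E (U r - U' r) (Ut r - Ut' r)).
  by apply: cvg_on_continuous => r rst; exact: (uniq_energy_cvg (seg_nbhs_filter s t r) (sc r rst) (sc' r rst)).
have VU r : s <= r <= t -> [/\ V (U r).1, V (U r).2, V (U' r).1 & V (U' r).2].
  by move=> rst; have [[? _ _] [? _ _] _ _] := sc r rst; have [[? _ _] [? _ _] _ _] := sc' r rst.
have E0 r : s <= r <= t -> 0 <= E (U r - U' r) (Ut r - Ut' r).
  move=> /VU[V1 V2 V1' V2'].
  apply: le_trans (@uniq_energy_ge (U r - U' r) (Ut r - Ut' r) (VB V1 V1') (VB V2 V2')).
  by rewrite addr_ge0 ?mulr_ge0 ?divr_ge0 ?addr_ge0 ?sqr_ge0 ?invr_ge0 // ltW.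
have sPE := slope_le_mul_expR gM cE (cvg_on_continuous (cvg_on_expR (@cvg_on_linear R s t (- lam)))) E0 sE sF.
have sT : slope_le s t M (fun r => E (U r - U' r) (Ut r - Ut' r) * expR (- lam * r)) (fun=> 0).
  apply: slope_leW sPE => r rst /=; have [V1 V2 V1' V2'] := VU r rst.
  have [b1 b2] := ball r rst; have [b1' b2'] := ball' r rst.
  rewrite pmulr_rle0 ?expR_gt0 // mulrN subr_le0 mulrC.
  exact: (uniq_rate (Ut r) (Ut' r) V1 V2 V1' V2' b1 b2 b1' b2').
by have h := slope_le_nonincreasing gM sT (lexx s) (ltW st) (lexx t); exact: h.
Qed.

(** Gronwall's inequality for [uniq_energy]. The bounds on both solutions hold for all times and
    give one Lipschitz constant for [B]. *)
Lemma solution_uniqueness U Ut U' Ut' : solution U Ut -> solution U' Ut' ->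
  U 0 = U' 0 -> Ut 0 = Ut' 0 ->
  (forall r, 0 <= r -> `|Ah (U r).1| <= rho /\ `|Ah (U r).2| <= rho) ->
  (forall r, 0 <= r -> `|Ah (U' r).1| <= rho /\ `|Ah (U' r).2| <= rho) ->
  forall t, 0 <= t -> U t = U' t /\ Ut t = Ut' t.
Proof.
move=> sU sU' e0 e1 ball ball'.
pose P r := E (U r - U' r) (Ut r - Ut' r) * expR (- lam * r).
have posi s t : 0 < s -> s < t -> P t <= P s.
  move=> s0 st; have t0 := lt_trans s0 st; have T0 : 0 < t + 1 by rewrite ltr_wpDl // ltW.
  have [Un [Utn [hs hc hb]]] := generalized_approx hip hAsa hAcomp nu0 (sU _ T0).
  have [Un' [Utn' [hs' hc' hb']]] := generalized_approx hip hAsa hAcomp nu0 (sU' _ T0).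
  have cv r : 0 <= r <= t + 1 ->
      (fun n => E (Un n r - Un' n r) (Utn n r - Utn' n r) * expR (- lam * r)) @ \oo --> P r.
    by move=> rT; apply: cvgM; [exact: uniq_energy_cvg (hc r rT) (hc' r rT)|exact: cvg_cst].
  apply: (cvg_le_limits (cv t _) (cv s _)).
  - by rewrite lerDl ler01 andbT ltW.
  - by rewrite (ltW s0) ltW // (lt_trans st) // ltrDl.
  move: (hb 1 ltr01) (hb' 1 ltr01); apply: filterS2 => n hn hn'.
  apply: (strong_uniqueness (hs n) (hs' n)) => // [|r /andP[sr rt]|r /andP[sr rt]]; first by rewrite ltrDl.
    have [|b1 b2] := hn r; first by rewrite (le_trans (ltW s0) sr) (le_trans rt) // lerDl ler01.
    have [c1 c2] := ball r (le_trans (ltW s0) sr).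
    by split; [apply: le_trans b1 _|apply: le_trans b2 _]; rewrite lerD2r.
  have [|b1 b2] := hn' r; first by rewrite (le_trans (ltW s0) sr) (le_trans rt) // lerDl ler01.
  have [c1 c2] := ball' r (le_trans (ltW s0) sr).
  by split; [apply: le_trans b1 _|apply: le_trans b2 _]; rewrite lerD2r.
move=> t t0; have Pt : P t <= 0.
  have P0 : P 0 = 0.
    rewrite /P e0 e1 !subrr /uniq_energy /= subrr (Ah0 hip hAsa hAcomp) !ip0r !addr0 !mulr0 !addr0 mul0r //.
  have [->|tn] := eqVneq t 0; first by rewrite P0.
  have tp : 0 < t by rewrite lt_def tn.
  rewrite -P0; apply: (right_limit_le tp) => [|s s0 st]; last exact: posi.
  apply: cvgM; last by apply: (cvg_on_expR (@cvg_on_linear R 0 1 (- lam))); rewrite lexx ler01.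
  exact: (uniq_energy_cvg (seg_nbhs_filter 0 1 0) (solution_cvg0 sU) (solution_cvg0 sU')).
have [V1 V2] := solution_V sU t0; have [V1' V2'] := solution_V sU' t0.
have := @uniq_energy_ge (U t - U' t) (Ut t - Ut' t) (VB V1 V1') (VB V2 V2').
move: Pt; rewrite /P pmulr_lle0 ?expR_gt0 // => Et /le_trans/(_ Et) /=.
set p := `|_| ^+ 2; set q := `|_| ^+ 2; set p' := `|_| ^+ 2; set q' := `|_| ^+ 2 => he.
have pp : 0 <= p by exact: sqr_ge0. have qq : 0 <= q by exact: sqr_ge0.
have pp' : 0 <= p' by exact: sqr_ge0. have qq' : 0 <= q' by exact: sqr_ge0.
have nq : 0 <= nu / 2 * (p' + q') by rewrite mulr_ge0 ?addr_ge0 // divr_ge0 // ltW.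
have hq : nu / 2 * (p' + q') <= 0 by move: nq he; move: (nu / 2 * _) => z; lra.
have pq' : p' + q' = 0.
  apply/eqP; rewrite eq_le addr_ge0 // andbT.
  by move: hq; rewrite pmulr_rle0 // divr_gt0.
have z0 (x : H) : `|x| ^+ 2 = 0 -> x = 0.
  by move=> /eqP; rewrite sqrf_eq0 normr_eq0 => /eqP.
have [c cp hc] := poincare hip hAsa hApos hAcomp.
have inj x y : V x -> V y -> Ah (x - y) = 0 -> x = y.
  move=> Vx Vy h; apply/subr0_eq/eqP; rewrite -normr_le0.
  by apply: le_trans (hc _ (VB Vx Vy)) _; rewrite h normr0 mulr0.
have pz : p = 0 by move: he nq; move: (nu / 2 * _) => z; lra.
have qz : q = 0 by move: he nq; move: (nu / 2 * _) => z; lra.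
have pz' : p' = 0 by lra.
have qz' : q' = 0 by lra.
rewrite [U t]surjective_pairing [U' t]surjective_pairing [Ut t]surjective_pairing [Ut' t]surjective_pairing.
by split; congr (_, _); [apply: inj => //; exact: z0|apply: inj => //; exact: z0|
  apply/subr0_eq; exact: z0|apply/subr0_eq; exact: z0].
Qed.

End Uniqueness.
End Estimates.

(** * Mean value and Taylor estimates on the unit interval *)

Section MeanValue.
Context {R : realType}.
Implicit Types (f g : R -> R).

Definition deriv01 f g : Prop := forall t, 0 <= t <= 1 -> forall e, 0 < e -> exists2 d, 0 < d &
  forall s, 0 <= s <= 1 -> `|s - t| < d -> `|f s - f t - g t * (s - t)| <= e * `|s - t|.

(** An instance of [slope_le_nonincreasing] for f - c t, with the identity as gauge. *)
Lemma deriv01_le f g (c x : R) : deriv01 f g -> 0 <= x <= 1 ->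
  (forall t, 0 <= t <= x -> g t <= c) -> f x - f 0 <= c * x.
Proof.
move=> fg /andP[x0 x1] gc.
have gI : gauge 0 x (id : R -> R) by move=> s s' *; exact: lexx.
have sl : slope_le 0 x id (fun t => f t + - c * t) (fun=> 0).
  move=> t /andP[t0 tx] e e0; have [|d d0 hd] := fg t _ e e0; first by rewrite t0 (le_trans tx).
  exists d => // s s' s0 st ts' s'x ds ds'; rewrite mul0r add0r.
  have := hd s; have := hd s'; rewrite (distrC s) (ger0_norm (_ : 0 <= s' - t)) ?subr_ge0 //.
  rewrite (ger0_norm (_ : 0 <= t - s)) ?subr_ge0 //.
  have s01 : 0 <= s <= 1 by rewrite s0 (le_trans st) // (le_trans tx).
  have s'01 : 0 <= s' <= 1 by rewrite (le_trans t0 ts') (le_trans s'x).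
  move=> /(_ s'01 ds') /ler_normlP[_ h1] /(_ s01 ds) /ler_normlP[h2 _].
  have gt : g t <= c by apply: gc; rewrite t0.
  have : g t * (s' - s) <= c * (s' - s) by rewrite ler_wpM2r // subr_ge0 (le_trans st).
  move: h1 h2; rewrite /= !mulrBr; lra.
have := slope_le_nonincreasing gI sl (lexx 0) x0 (lexx x).
by rewrite mulr0 addr0 mulNr lerBlDr lerBlDl addrC.
Qed.

Lemma deriv01_norm_le f g (c x : R) : deriv01 f g -> 0 <= x <= 1 ->
  (forall t, 0 <= t <= x -> `|g t| <= c) -> `|f x - f 0| <= c * x.
Proof.
move=> fg x01 gc; apply/ler_normlP; split.
  have fg' : deriv01 (fun t => - f t) (fun t => - g t).
    move=> t t01 e e0; have [d d0 hd] := fg t t01 e e0; exists d => // s s01 st.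
    by have := hd s s01 st; rewrite -normrN; congr (`|_| <= _); ring.
  have := @deriv01_le _ _ c x fg' x01; rewrite opprB opprK addrC; apply => t /gc /ler_normlP[h _] //.
by apply: (deriv01_le fg x01) => t /gc /ler_normlP[_ h].
Qed.

(** Two uses of the mean value inequality; they give [c] instead of the sharp c / 2, which is enough
    here. *)
Lemma deriv01_taylor f g k (c : R) : deriv01 f g -> deriv01 g k ->
  (forall t, 0 <= t <= 1 -> `|k t| <= c) -> `|f 1 - f 0 - g 0| <= c.
Proof.
move=> fg gk kc.
have c0 : 0 <= c by apply: le_trans (kc 0 _) => //; rewrite lexx ler01.
have gc t : 0 <= t <= 1 -> `|g t - g 0| <= c.
  move=> /[dup] t01 /andP[t0 t1]; apply: (@le_trans _ _ (c * t)).
    by apply: (deriv01_norm_le gk t01) => r /andP[r0 rt]; apply: kc; rewrite r0 (le_trans rt).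
  by rewrite -[leRHS]mulr1 ler_wpM2l.
have h : deriv01 (fun t => f t - g 0 * t) (fun t => g t - g 0).
  move=> t t01 e e0; have [d d0 hd] := fg t t01 e e0; exists d => // s s01 st.
  by have := hd s s01 st; congr (`|_| <= _); ring.
have := @deriv01_norm_le _ _ c 1 h; rewrite lexx ler01 => /(_ isT gc).
by rewrite !mulr1 mulr0 subr0; congr (`|_| <= _); ring.
Qed.

End MeanValue.

(** * Potentials of class C^3 *)

Section CThree.
Context {R : realType} {H : completeNormedModType R}.
Variable ip : {dot H for (@idfun R)}.
Hypothesis hip : forall x : H, ip x x = `|x| ^+ 2.
Variables (domA : set H) (A : H -> H).
Hypothesis hAsa : self_adjoint ip domA A.
Hypothesis hApos : positive_op ip domA A.
Hypothesis hAcomp : compact_resolvent domA A.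
Local Notation V := (Hhalf ip domA A).
Local Notation Ah := (frac_pow ip domA A 2^-1).
Local Notation hn := (hnorm ip domA A).
Variables (B : H -> H) (Pi : H -> R) (P : H -> seq H -> R).
Hypotheses (pB : frechet_potential ip domA A B Pi) (hP : frechet_Ck ip domA A 3 Pi P).

Let sub0 : [set` ([::] : seq H)] `<=` V. Proof. by move=> x. Qed.
Let sub1 x : V x -> [set` [:: x]] `<=` V.
Proof. by move=> Vx y /=; rewrite inE => /eqP ->. Qed.
Let sub2 x y : V x -> V y -> [set` [:: x; y]] `<=` V.
Proof. by move=> Vx Vy z /=; rewrite !inE => /orP[] /eqP ->. Qed.

Lemma P_lin1 u (a : R) x y : V u -> V x -> V y -> P u [:: a *: x + y] = a * P u [:: x] + P u [:: y].
Proof.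
move=> Vu Vx Vy; have [_ h _ _ _] := hP.
exact: (h u Vu [::] [::] a x y isT sub0 sub0 Vx Vy).
Qed.

Lemma P_lin2l u (a : R) x y z : V u -> V x -> V y -> V z ->
  P u [:: a *: x + y; z] = a * P u [:: x; z] + P u [:: y; z].
Proof.
move=> Vu Vx Vy Vz; have [_ h _ _ _] := hP.
exact: (h u Vu [::] [:: z] a x y isT sub0 (sub1 Vz) Vx Vy).
Qed.

Lemma P_lin3 u (a : R) x y z1 z2 : V u -> V x -> V y -> V z1 -> V z2 ->
  P u [:: a *: x + y; z1; z2] = a * P u [:: x; z1; z2] + P u [:: y; z1; z2].
Proof.
move=> Vu Vx Vy Vz1 Vz2; have [_ h _ _ _] := hP.
exact: (h u Vu [::] [:: z1; z2] a x y isT sub0 (sub2 Vz1 Vz2) Vx Vy).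
Qed.

Let VV0 : V 0 := V0 ip domA A.

Lemma P_Z1 u (a : R) x : V u -> V x -> P u [:: a *: x] = a * P u [:: x].
Proof.
move=> Vu Vx; have z : P u [:: 0] = 0.
  by have := P_lin1 1 Vu VV0 VV0; rewrite scale1r addr0 mul1r -{1}[P u _]addr0 => /addrI.
by have := P_lin1 a Vu Vx VV0; rewrite addr0 z addr0.
Qed.

Lemma P_Z2l u (a : R) x y : V u -> V x -> V y -> P u [:: a *: x; y] = a * P u [:: x; y].
Proof.
move=> Vu Vx Vy; have z : P u [:: 0; y] = 0.
  by have := P_lin2l 1 Vu VV0 VV0 Vy; rewrite scale1r addr0 mul1r -{1}[P u _]addr0 => /addrI.
by have := P_lin2l a Vu Vx VV0 Vy; rewrite addr0 z addr0.
Qed.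

Lemma P_Z3 u (a : R) x y z : V u -> V x -> V y -> V z -> P u [:: a *: x; y; z] = a * P u [:: x; y; z].
Proof.
move=> Vu Vx Vy Vz; have q : P u [:: 0; y; z] = 0.
  by have := P_lin3 1 Vu VV0 VV0 Vy Vz; rewrite scale1r addr0 mul1r -{1}[P u _]addr0 => /addrI.
by have := P_lin3 a Vu Vx VV0 Vy Vz; rewrite addr0 q addr0.
Qed.

Lemma P_diff u e s : V u -> 0 < e -> (size s < 3)%N -> [set` s] `<=` V -> exists2 d, 0 < d &
  forall w, V w -> `|Ah w| < d -> `|P (u + w) s - P u s - P u (w :: s)| <= e * `|Ah w|.
Proof.
move=> Vu e0 s3 sV; have [_ _ _ h _] := hP.
pose c := \prod_(x <- s) hn 2^-1 x; have c0 : 0 <= c by apply: prodr_ge0 => x _; exact: normr_ge0.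
have c1 : 0 < c + 1 by rewrite ltr_wpDl.
have [d d0 hd] := h u Vu _ (divr_gt0 e0 c1); exists d => // w Vw wd.
apply: le_trans (hd w s Vw wd s3 sV) _; rewrite -/c mulrAC ler_wpM2r //; first exact: normr_ge0.
by rewrite mulrAC ler_pdivrMr // ler_pM2l // lerDl.
Qed.

Lemma P_grad u phi : V u -> V phi -> P u [:: phi] = ip (B u) phi.
Proof.
move=> Vu Vp; apply/subr0_eq; apply: (@small_norm0 R R^o _ (2 * `|Ah phi|)) => e e0.
have [d d0 hd] := P_diff Vu e0 (isT : (size ([::] : seq H) < 3)%N) sub0.
have [d' d'0 hd'] := pB Vu e0.
(* At [h *: phi] both expansions of [Pi] are valid; subtracting them and dividing by [h] compares
   the two derivatives. *)
pose h := Num.min d d' / (`|Ah phi| + 1).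
have n1 : 0 < `|Ah phi| + 1 by rewrite ltr_wpDl.
have h0 : 0 < h by rewrite divr_gt0 // lt_min d0.
have Ahh : `|Ah (h *: phi)| = h * `|Ah phi| by rewrite (AhZ hip hAsa hAcomp) // normrZ gtr0_norm.
have hm : `|Ah (h *: phi)| < Num.min d d'.
  rewrite Ahh /h mulrAC ltr_pdivrMr // ltr_pM2l ?lt_min ?d0 //.
  by rewrite ltrDl.
move: (hm); rewrite lt_min => /andP[m1 m2].
have Vh := VZ h Vp; have := hd _ Vh m1; have := hd' _ Vh m2; rewrite /hnorm Ahh.
have [P0 _ _ _ _] := hP; rewrite !P0 //; last exact: VD.
rewrite P_Z1 // ipZr; set D := Pi _ - Pi u => h1 h2.
have : h * `|P u [:: phi] - ip (B u) phi| <= h * (2 * `|Ah phi| * e).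
  rewrite -{1}(gtr0_norm h0) -normrM.
  rewrite (_ : h * (P u [:: phi] - ip (B u) phi) = (D - h * ip (B u) phi) - (D - h * P u [:: phi])); last by ring.
  apply: le_trans (ler_normB _ _) _; apply: le_trans (lerD h1 h2) _.
  by apply: le_of_eq; ring.
by rewrite ler_pM2l.
Qed.

Lemma P_line_deriv u w s : V u -> V w -> (size s < 3)%N -> [set` s] `<=` V ->
  (forall z (a : R), V z -> P z (a *: w :: s) = a * P z (w :: s)) ->
  deriv01 (fun t => P (u + t *: w) s) (fun t => P (u + t *: w) (w :: s)).
Proof.
move=> Vu Vw s3 sV hz t t01 e e0.
have Vt := VD Vu (VZ t Vw).
have n1 : 0 < `|Ah w| + 1 by rewrite ltr_wpDl.
have [d d0 hd] := P_diff Vt (divr_gt0 e0 n1) s3 sV.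
exists (d / (`|Ah w| + 1)) => [|r r01 rt]; first by rewrite divr_gt0.
have Vr := VZ (r - t) Vw.
have E : u + r *: w = u + t *: w + (r - t) *: w by apply: (ip_inj hip) => z; rewrite !ipE; ring.
have An : `|Ah ((r - t) *: w)| = `|r - t| * `|Ah w| by rewrite (AhZ hip hAsa hAcomp) // normrZ.
have := hd _ Vr; rewrite -E hz // An => hh.
rewrite (mulrC (P _ _)); apply: le_trans (hh _) _.
  apply: (@le_lt_trans _ _ (`|r - t| * (`|Ah w| + 1))); first by rewrite ler_wpM2l // lerDl.
  by rewrite -ltr_pdivlMr.
rewrite [in leLHS]mulrCA mulrC ler_wpM2r // mulrC mulrA.
by rewrite ler_pdivrMr // mulrC ler_pM2l // lerDl.
Qed.

(** Second-order expansion of (B(u + w), phi). The remainder contains [w] twice and [phi] once, so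
    that (4a) can bound it by |A^{1/2} w|^2 times the norm of [phi] in [H]. *)
Lemma P_taylor u w phi (C : R) : V u -> V w -> V phi ->
  (forall t, 0 <= t <= 1 -> `|P (u + t *: w) [:: w; w; phi]| <= C) ->
  `|ip (B (u + w)) phi - ip (B u) phi - P u [:: w; phi]| <= C.
Proof.
move=> Vu Vw Vp hC.
have d1 : deriv01 (fun t => P (u + t *: w) [:: phi]) (fun t => P (u + t *: w) [:: w; phi]).
  by apply: P_line_deriv => // [|z a Vz]; [exact: sub1|exact: P_Z2l].
have d2 : deriv01 (fun t => P (u + t *: w) [:: w; phi]) (fun t => P (u + t *: w) [:: w; w; phi]).
  by apply: P_line_deriv => // [|z a Vz]; [exact: sub2|exact: P_Z3].
have := deriv01_taylor d1 d2 hC; rewrite scale1r scale0r addr0 !P_grad //.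
exact: VD.
Qed.

(** The second difference is the increment of [f] over the unit interval. The derivative of [f]
    compares first derivatives of [Pi] at points [h *: y] apart and is therefore close to h^2 P u
    [y; x]. *)
Lemma P_second_difference u x y e : V u -> V x -> V y -> 0 < e -> exists2 d, 0 < d & forall h, 0 < h -> h < d ->
  `|Pi (u + h *: x + h *: y) - Pi (u + h *: x) - (Pi (u + h *: y) - Pi u) - h ^+ 2 * P u [:: y; x]| <= e * h ^+ 2.
Proof.
move=> Vu Vx Vy e0; pose c := `|Ah x| + `|Ah y| + 1.
have c1 : 0 < c by rewrite ltr_wpDl // addr_ge0.
have e20 : 0 < e / (2 * c) by rewrite divr_gt0 // mulr_gt0.
have [d d0 hd] := P_diff Vu e20 (isT : (size [:: x] < 3)%N) (sub1 Vx).
exists (d / c) => [|h h0 hdc]; first by rewrite divr_gt0.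
have hc : h * c < d by rewrite -ltr_pdivlMr.
have Vhx := VZ h Vx; have Vhy := VZ h Vy.
have [P0 _ _ _ _] := hP.
pose f t := P (u + h *: y + t *: (h *: x)) [::] - P (u + t *: (h *: x)) [::].
pose g t := P (u + h *: y + t *: (h *: x)) [:: h *: x] - P (u + t *: (h *: x)) [:: h *: x].
have fg : deriv01 f g.
  have l1 : deriv01 (fun t => P (u + h *: y + t *: (h *: x)) [::]) (fun t => P (u + h *: y + t *: (h *: x)) [:: h *: x]).
    by apply: P_line_deriv => // [|z a Vz]; [exact: VD|exact: P_Z1].
  have l2 : deriv01 (fun t => P (u + t *: (h *: x)) [::]) (fun t => P (u + t *: (h *: x)) [:: h *: x]).
    by apply: P_line_deriv => // z a Vz; exact: P_Z1.
  move=> t t01 q q0; have q2 : 0 < q / 2 by rewrite divr_gt0.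
  have [a a0 ha] := l1 t t01 _ q2; have [b b0 hb] := l2 t t01 _ q2.
  exists (Num.min a b) => [|s s01]; first by rewrite lt_min a0.
  rewrite lt_min => /andP[sa sb]; rewrite /f /g.
  rewrite (_ : _ - _ = (P (u + h *: y + s *: (h *: x)) [::] - P (u + h *: y + t *: (h *: x)) [::] - P (u + h *: y + t *: (h *: x)) [:: h *: x] * (s - t)) -
    (P (u + s *: (h *: x)) [::] - P (u + t *: (h *: x)) [::] - P (u + t *: (h *: x)) [:: h *: x] * (s - t))); last by ring.
  apply: le_trans (ler_normB _ _) _; apply: le_trans (lerD (ha s s01 sa) (hb s s01 sb)) _.
  by apply: le_of_eq; field.
have gb t : 0 <= t <= 1 -> `|g t - h ^+ 2 * P u [:: y; x]| <= e * h ^+ 2.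
  move=> /andP[t0 t1].
  have th : 0 <= t * h <= h by rewrite mulr_ge0 ?(ltW h0) //= -[leRHS]mul1r ler_pM2r.
  have Vt := VZ (t * h) Vx.
  have A1 : `|Ah ((t * h) *: x)| <= h * `|Ah x|.
    rewrite (AhZ hip hAsa hAcomp) // normrZ ger0_norm ?ler_wpM2r //; by case/andP: th.
  have A2 : `|Ah (h *: y + (t * h) *: x)| <= h * (`|Ah x| + `|Ah y|).
    rewrite (AhD hip hAsa hAcomp) //; apply: le_trans (ler_normD _ _) _.
    by rewrite (AhZ hip hAsa hAcomp _ Vy) normrZ gtr0_norm // mulrDr addrC lerD2r.
  have B1 : h * (`|Ah x| + `|Ah y|) < d.
    by apply: le_lt_trans hc; rewrite ler_pM2l // /c lerDl.
  have A1' : h * `|Ah x| <= h * (`|Ah x| + `|Ah y|) by rewrite ler_pM2l // lerDl.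
  have r1 := hd _ Vt (le_lt_trans (le_trans A1 A1') B1).
  have Vs := VD Vhy Vt; have r2 := hd _ Vs (le_lt_trans A2 B1).
  rewrite /g !scalerA !P_Z1 //; [|exact: VD|by rewrite -(addrA u); exact: VD].
  rewrite -(addrA u).
  have lin : P u [:: h *: y + (t * h) *: x; x] = h * P u [:: y; x] + P u [:: (t * h) *: x; x].
    exact: P_lin2l.
  rewrite (_ : _ - _ = h * ((P (u + (h *: y + (t * h) *: x)) [:: x] - P u [:: x] - P u [:: h *: y + (t * h) *: x; x])
     - (P (u + (t * h) *: x) [:: x] - P u [:: x] - P u [:: (t * h) *: x; x]))); last by rewrite lin; ring.
  rewrite normrM (gtr0_norm h0) expr2 mulrA (mulrC e) -mulrA ler_pM2l //.
  apply: le_trans (ler_normB _ _) _; apply: le_trans (lerD r2 r1) _.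
  rewrite -mulrDr; apply: (@le_trans _ _ (e / (2 * c) * (2 * c * h))).
    rewrite ler_wpM2l ?(ltW e20) //; apply: le_trans (lerD A2 A1) _.
    rewrite /c; have := mulr_ge0 (ltW h0) (normr_ge0 (Ah y)).
    by move: h0; gen_norm; lra.
  by rewrite mulrA divfK // gt_eqF // mulr_gt0.
have fg' : deriv01 (fun t => f t - h ^+ 2 * P u [:: y; x] * t) (fun t => g t - h ^+ 2 * P u [:: y; x]).
  move=> t t01 q q0; have [a a0 ha] := fg t t01 _ q0; exists a => // s s01 st.
  by have := ha s s01 st; congr (`|_| <= _); ring.
have := @deriv01_norm_le _ _ _ _ 1 fg'; rewrite lexx ler01 => /(_ _ isT gb).
rewrite !mulr1 mulr0 subr0 /f scale1r scale0r !addr0 !P0 //; do ?[exact: VD | exact: VZ | apply: VD].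
rewrite [u + h *: y + h *: x]addrAC.
by congr (`|_| <= _); ring.
Qed.

(** Schwarz's theorem, not postulated in [frechet_Ck]: the second difference is symmetric in [x] and
    [y]. *)
Lemma P_sym u x y : V u -> V x -> V y -> P u [:: x; y] = P u [:: y; x].
Proof.
move=> Vu Vx Vy; apply/subr0_eq; apply: (@small_norm0 R R^o _ 2) => e e0.
have [d d0 hd] := P_second_difference Vu Vx Vy e0.
have [d' d'0 hd'] := P_second_difference Vu Vy Vx e0.
pose h := Num.min d d' / 2; have m0 : 0 < Num.min d d' by rewrite lt_min d0.
have h0 : 0 < h by rewrite divr_gt0.
have : h < Num.min d d' by rewrite ltr_pdivrMr // ltr_pMr // ltr1n.
rewrite lt_min => /andP[hd1 hd2].
have a1 := hd h h0 hd1; have a2 := hd' h h0 hd2.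
rewrite [u + h *: y + h *: x]addrAC in a2.
have h2 : 0 < h ^+ 2 by rewrite exprn_gt0.
rewrite -(ler_pM2l h2) -{1}(gtr0_norm h2) -normrM.
move: a1 a2; set p := Pi _; set q := Pi _; set r := Pi _ => a1 a2.
apply: le_trans (_ : `|(p - q - (r - Pi u) - h ^+ 2 * P u [:: y; x]) - (p - r - (q - Pi u) - h ^+ 2 * P u [:: x; y])| <= _).
  by apply: le_of_eq; congr `|_|; ring.
apply: le_trans (ler_normB _ _) _; apply: le_trans (lerD a1 a2) _.
by apply: le_of_eq; ring.
Qed.

End CThree.

Lemma young (R : realType) (c x y : R) : 0 < c -> y * x <= c / 4 * x ^+ 2 + c^-1 * y ^+ 2.
Proof.
move=> c0; rewrite -subr_ge0 (_ : _ - _ = c^-1 * (c / 2 * x - y) ^+ 2); last by field; rewrite gt_eqF.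
by rewrite mulr_ge0 ?sqr_ge0 // invr_ge0 ltW.
Qed.

(** * Compensation for the work of the nonlinearity *)

Section CouplingFunctional.
Context {R : realType} {H : completeNormedModType R}.
Variable ip : {dot H for (@idfun R)}.
Hypothesis hip : forall x : H, ip x x = `|x| ^+ 2.
Variables (domA : set H) (A : H -> H).
Hypothesis hAsa : self_adjoint ip domA A.
Hypothesis hApos : positive_op ip domA A.
Hypothesis hAcomp : compact_resolvent domA A.
Local Notation V := (Hhalf ip domA A).
Local Notation Ah := (frac_pow ip domA A 2^-1).
Local Notation hn := (hnorm ip domA A).
Local Notation scv := (state_cvg ip domA A).
Variables (B : H -> H) (Pi : H -> R).
Hypotheses (lB : lipschitz_on_balls ip domA A 2^-1 B) (pB : frechet_potential ip domA A B Pi).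
Variables (c0 : R).
Hypothesis c00 : 0 < c0.

(** Each term can be absorbed: the first by the damping, the second by eps nu |A^{1/2} w|^2, the
    third by a large s_kappa, and the last by the energy in the exponential weight. *)
Definition coupling_slack (eta Ceta C1 : R) (X Xt : H * H) : R :=
  c0 / 4 * ip (Xt.1 - Xt.2) (Xt.1 - Xt.2) + eta * ip (Ah (X.1 - X.2)) (Ah (X.1 - X.2))
  + Ceta * ip (X.1 - X.2) (X.1 - X.2)
  + C1 * (`|Xt.1| + `|Xt.2|) * ip (Ah (X.1 - X.2)) (Ah (X.1 - X.2)).

Lemma coupling_slack_cvg eta Ceta C1 (I : Type) (F : set_system I) (FF : Filter F) X Xt x xt :
  scv F X Xt x xt -> (fun i => coupling_slack eta Ceta C1 (X i) (Xt i)) @ F --> coupling_slack eta Ceta C1 x xt.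
Proof.
move=> [x1 x2 t1 t2].
have dw : vcvg ip domA A F (fun i => (X i).1 - (X i).2) (x.1 - x.2) by exact: vcvgB.
have aw := vcvg_Ah dw.
have nw : (fun i => (X i).1 - (X i).2) @ F --> x.1 - x.2 by exact: vcvg_norm dw.
have tw : (fun i => (Xt i).1 - (Xt i).2) @ F --> xt.1 - xt.2 by exact: cvgB.
have cM (c : R) (f : I -> R) (l : R) : f @ F --> l -> (fun i => c * f i) @ F --> c * l.
  by move=> h; apply: cvgM h; exact: cvg_cst.
have ipc (f g : I -> H) y z : f @ F --> y -> g @ F --> z -> (fun i => ip (f i) (g i)) @ F --> ip y z.
  by move=> hf hg; exact: ip_cvg.
apply: cvgD; [apply: cvgD; [apply: cvgD|]|].
- exact: (cM _ _ _ (ipc _ _ _ _ tw tw)).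
- exact: (cM _ _ _ (ipc _ _ _ _ aw aw)).
- exact: (cM _ _ _ (ipc _ _ _ _ nw nw)).
- apply: cvgM; last exact: (ipc _ _ _ _ aw aw).
  by apply: cM; apply: cvgD; apply: cvg_norm.
Qed.

(* [Q] corrects the energy of [u - v] so that its derivative compensates the
   work [(B u - B v, u_t - v_t)] up to [coupling_slack]. *)
Definition coupling_functional (r C1 : R) (Q : H -> H -> R) : Prop :=
  (forall (I : Type) (F : set_system I) (FF : Filter F) X Xt x xt,
    scv F X Xt x xt -> (fun i => Q (X i).1 (X i).2) @ F --> Q x.1 x.2) /\
  forall eta, 0 < eta -> exists2 Ceta, 0 <= Ceta &
    (forall u v, V u -> V v -> `|Ah u| <= r -> `|Ah v| <= r ->
       `|Q u v| <= eta * `|Ah (u - v)| ^+ 2 + Ceta * `|u - v| ^+ 2) /\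
    forall a b M m U Ut Zx Zu Zy Zv,
      primitive a b M (fun r => 1 + (m r + m r)) -> (forall r, 0 <= m r) ->
      spath ip domA A a b m (fun t => (U t).1) (fun t => (Ut t).1) Zx Zu ->
      spath ip domA A a b m (fun t => (U t).2) (fun t => (Ut t).2) Zy Zv ->
      (forall t, a <= t <= b -> `|Ah (U t).1| <= r /\ `|Ah (U t).2| <= r) ->
      adiff a b M (fun r => 1 + (m r + m r)) (fun t => Q (U t).1 (U t).2)
        (fun t => ip (B (U t).1 - B (U t).2) ((Ut t).1 - (Ut t).2))
        (fun t => coupling_slack eta Ceta C1 (U t) (Ut t)).

Lemma path_difference_data a b (M m : R -> R) U Ut Zx Zu Zy Zv :
  primitive a b M (fun r => 1 + (m r + m r)) -> (forall r, 0 <= m r) ->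
  spath ip domA A a b m (fun t => (U t).1) (fun t => (Ut t).1) Zx Zu ->
  spath ip domA A a b m (fun t => (U t).2) (fun t => (Ut t).2) Zy Zv ->
  [/\ hderiv a b (fun t => (U t).1 - (U t).2) (fun t => (Ut t).1 - (Ut t).2),
     cvg_on a b (fun t => (Ut t).1 - (Ut t).2) &
     cvg_on a b (fun t => B (U t).1 - B (U t).2)].
Proof.
move=> pM m0 p1 p2; have [_ _ _ h1 h2] := spathB hip hAsa hAcomp p1 p2; split => // t tab.
have FF := seg_nbhs_filter a b t.
have [s1 s2 _ _] := spath_state_cvg p1 p2 tab.
by apply: cvgB; [exact: (vcvg_lipschitz hip hAsa hAcomp lB s1)|exact: (vcvg_lipschitz hip hAsa hAcomp lB s2)].
Qed.

(** In case (4b) no correction is made: |B(u) - B(v)| |w_t| is split by [young], and the square of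
    the weaker norm is interpolated between |A^{1/2} w| and |w|. *)
Lemma coupling_functional_subcritical (sigma r : R) : 0 < r -> sigma < 2^-1 ->
  lipschitz_on_balls ip domA A sigma B -> coupling_functional r 0 (fun _ _ => 0).
Proof.
move=> r0 s2 lS; split=> [I F FF X Xt x xt _|eta eta0]; first exact: cvg_cst.
have [L hL] := lS r r0; pose L' : R := `|L| + 1; have L'0 : 0 < L' by rewrite ltr_wpDl.
have L2 : 0 < L' ^+ 2 / c0 by rewrite divr_gt0 // exprn_gt0.
(* The interpolation parameter compensates the factor L'^2 / c0 produced by [young]. *)
have [C C0 hC] := hnorm_interpolation hip hAsa hApos hAcomp s2 (divr_gt0 eta0 L2).
exists (L' ^+ 2 / c0 * C); first by rewrite mulr_ge0 // ltW.
split=> [u v Vu Vv _ _|a b M m U Ut Zx Zu Zy Zv pM m0 p1 p2 ball].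
  by rewrite normr0; apply: addr_ge0; apply: mulr_ge0; rewrite ?sqr_ge0 ?(ltW eta0) // mulr_ge0 // ltW.
have [dw cwt cdb] := path_difference_data pM m0 p1 p2.
have M1 q : 1 <= 1 + (m q + m q) by rewrite lerDl addr_ge0.
apply: (adiff_grad hip pM M1 dw cwt cdb) => t tab e e0.
set db := B _ - B _; set wt := (Ut t).1 - (Ut t).2.
pose c : R := `|db| + 1; have c1 : 0 < c by rewrite ltr_wpDl.
have [d dp hd] := dw t tab _ (divr_gt0 e0 c1); exists d => // s sab st.
have hs := hd s sab st; rewrite subrr sub0r normrN; set x := _ - _ in hs *.
have hdb : `|db| <= L' * hn sigma ((U t).1 - (U t).2).
  have [V1 _ _ _ _] := p1; have [V2 _ _ _ _] := p2; have [b1 b2] := ball t tab.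
  apply: le_trans (hL _ _ (V1 t tab) (V2 t tab) b1 b2) _; rewrite ler_wpM2r ?normr_ge0 //.
  by rewrite /L'; have := ler_norm L; gen_norm; lra.
have hw := hC _ (VB (let: And5 V1 _ _ _ _ := p1 in V1 t tab) (let: And5 V2 _ _ _ _ := p2 in V2 t tab)).
rewrite -[X in ip db X](subrK ((s - t) *: wt)) -/x ipDr; apply: le_trans (ler_normD _ _) _; rewrite addrC.
apply: lerD.
  rewrite ipZr normrM mulrC ler_wpM2r //.
  apply: (le_trans (ip_cauchy_schwarz hip _ _)); rewrite /coupling_slack !hip mul0r mul0r addr0.
  apply: (@le_trans _ _ (c0 / 4 * `|wt| ^+ 2 + c0^-1 * `|db| ^+ 2)).
    exact: young.
  rewrite -addrA lerD2l.
  apply: (@le_trans _ _ (c0^-1 * (L' ^+ 2 * hn sigma ((U t).1 - (U t).2) ^+ 2))).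
    by rewrite ler_wpM2l ?invr_ge0 ?(ltW c00) // -exprMn ler_sqr ?nnegrE // (le_trans (normr_ge0 _) hdb).
  apply: (@le_trans _ _ (L' ^+ 2 / c0 * (eta / (L' ^+ 2 / c0) * `|Ah ((U t).1 - (U t).2)| ^+ 2 + C * `|(U t).1 - (U t).2| ^+ 2))).
    by rewrite mulrA (mulrC _^-1) ler_pM2l.
  by apply: le_of_eq; field; rewrite !gt_eqF.
apply: le_trans (ip_cauchy_schwarz hip _ _) _.
apply: (@le_trans _ _ (c * (e / c * `|s - t|))).
  by apply: ler_pM => //; rewrite /c lerDl.
rewrite mulrA mulrCA divff ?gt_eqF // mulr1 ler_pM2l //.
exact: (gauge_dist pM M1).
Qed.

(** Case (4a). By symmetry of the second derivative (B'(u) u_t, w) = (B'(u) w, u_t), and B'(u) w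
    differs from B(u) - B(v) by a Taylor remainder; likewise at v. Hence the derivative of (B(u) -
    B(v), w) / 2 is (B(u) - B(v), w_t) up to (C / 2) (|u_t| + |v_t|) |A^{1/2} w|^2. *)
Lemma coupling_functional_C3 (P : H -> seq H -> R) (r C : R) : 0 < r -> 0 < C ->
  frechet_Ck ip domA A 3 Pi P ->
  (forall u, V u -> `|Ah u| <= r -> forall v1 v2 v3, V v1 -> V v2 -> V v3 ->
     `|P u [:: v1; v2; v3]| <= C * `|Ah v1| * `|Ah v2| * `|v3|) ->
  coupling_functional r (C / 2) (fun u v => 2^-1 * ip (B u - B v) (u - v)).
Proof.
move=> r0 C0 hP hC.
have [L0 hL0] := lB r0; pose L : R := `|L0| + 1; have Lp : 0 < L by rewrite ltr_wpDl.
have hL u v : V u -> V v -> `|Ah u| <= r -> `|Ah v| <= r -> `|B u - B v| <= L * `|Ah (u - v)|.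
  move=> Vu Vv bu bv; apply: le_trans (hL0 _ _ Vu Vv bu bv) _; rewrite ler_wpM2r ?normr_ge0 //.
  by rewrite /L; have := ler_norm L0; gen_norm; lra.
split=> [I F FF X Xt x xt [x1 x2 t1 t2]|eta eta0].
  apply: cvgM; first exact: cvg_cst.
  apply: ip_cvg => //; apply: cvgB.
  - exact: (vcvg_lipschitz hip hAsa hAcomp lB x1).
  - exact: (vcvg_lipschitz hip hAsa hAcomp lB x2).
  - exact: (vcvg_norm hip hAsa hApos hAcomp x1).
  - exact: (vcvg_norm hip hAsa hApos hAcomp x2).
exists (L ^+ 2 / eta); first by rewrite divr_ge0 ?sqr_ge0 // ltW.
split=> [u v Vu Vv bu bv|a b M m U Ut Zx Zu Zy Zv pM m0 p1 p2 ball].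
  rewrite normrM ger0_norm ?invr_ge0 //.
  set g := `|Ah _|; set n := `|u - v|.
  have h : `|ip (B u - B v) (u - v)| <= L * g * n.
    by apply: le_trans (ip_cauchy_schwarz hip _ _) _; rewrite ler_wpM2r // hL.
  apply: (@le_trans _ _ (2^-1 * (L * g * n))); first by rewrite ler_pM2l // invr_gt0.
  have q0 : 0 <= L ^+ 2 / eta * n ^+ 2 by rewrite mulr_ge0 ?sqr_ge0 ?divr_ge0 ?sqr_ge0 // ltW.
  have p0 : 0 <= L * g * n by rewrite !mulr_ge0 ?normr_ge0 ?(ltW Lp).
  have y : L * g * n <= eta / 4 * g ^+ 2 + L ^+ 2 / eta * n ^+ 2.
    rewrite mulrAC; apply: le_trans (young g (L * n) eta0) _.
    by apply: le_of_eq; field; rewrite gt_eqF.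
  have : 0 <= eta * g ^+ 2 by rewrite mulr_ge0 ?sqr_ge0 // ltW.
  move: q0 p0 y; rewrite -(mulrAC eta); move: (L ^+ 2 / eta * n ^+ 2) (L * g * n) (eta * g ^+ 2) => x1 y1 z1; lra.
have [dw cwt cdb] := path_difference_data pM m0 p1 p2.
have M1 q : 1 <= 1 + (m q + m q) by rewrite lerDl addr_ge0.
have mm q : m q <= 1 + (m q + m q) by have := m0 q; lra.
have q1 := spathW mm p1; have q2 := spathW mm p2.
apply: (adiff_grad hip pM M1 dw cwt cdb) => t tab e e0.
have [V1 [wx1 _] _ _ du1] := q1; have [V2 [wx2 _] _ _ du2] := q2.
have [bu bv] := ball t tab.
have Vu := V1 t tab; have Vv := V2 t tab.
move: bu bv Vu Vv; set u := (U t).1; set v := (U t).2 => bu bv Vu Vv.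
have Vw := VB Vu Vv; set w := u - v in Vw *.
pose g := `|Ah w| ^+ 2; have g0 : 0 <= g by exact: sqr_ge0.
have Cg1 : 0 < C * g + 1 by rewrite ltr_wpDl // mulr_ge0 // ltW.
have sub1 : [set` [:: w]] `<=` V by move=> x /=; rewrite inE => /eqP ->.
have e3 : 0 < e / 3 by rewrite divr_gt0.
have [d1 d10 hd1] := P_diff hP Vu e3 (isT : (size [:: w] < 3)%N) sub1.
have [d2 d20 hd2] := P_diff hP Vv e3 (isT : (size [:: w] < 3)%N) sub1.
have e4 : 0 < e / 3 / (C * g + 1) by rewrite divr_gt0.
have [d3 d30 hd3] := du1 t tab _ e4; have [d4 d40 hd4] := du2 t tab _ e4.
have e5 : 0 < e / (6 * L) by rewrite divr_gt0 // mulr_gt0.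
have [d5 d50 hd5] := hderiv_continuous du1 tab e5; have [d6 d60 hd6] := hderiv_continuous du2 tab e5.
have cx1 : hcontinuous_on a b (fun t => Ah (U t).1) by apply: cvg_on_hcontinuous; case: p1.
have cx2 : hcontinuous_on a b (fun t => Ah (U t).2) by apply: cvg_on_hcontinuous; case: p2.
have [d7 d70 hd7] := cx1 t tab _ d10; have [d8 d80 hd8] := cx2 t tab _ d20.
exists (Num.min (Num.min d3 d4) (Num.min (Num.min d5 d6) (Num.min d7 d8))) => [|s sab].
  by rewrite !lt_min d30 d40 d50 d60 d70.
rewrite !lt_min => /andP[/andP[s3 s4] /andP[/andP[s5 s6] /andP[s7 s8]]].
have Vus := V1 s sab; have Vvs := V2 s sab; have [bus bvs] := ball s sab.
have da := wderiv_dist hip pM M1 wx1 sab tab; have db := wderiv_dist hip pM M1 wx2 sab tab.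
have h3 := hd3 s sab s3; have h4 := hd4 s sab s4; have h5 := hd5 s sab s5; have h6 := hd6 s sab s6.
have h7 := hd7 s sab s7; have h8 := hd8 s sab s8.
have gd := gauge_dist pM M1 sab tab.
move: Vus Vvs bus bvs da db h3 h4 h5 h6 h7 h8.
rewrite -/u -/v -(AhB hip hAsa hAcomp (V1 s sab) Vu) -(AhB hip hAsa hAcomp (V2 s sab) Vv).
set u' := (U s).1; set v' := (U s).2 => Vus Vvs bus bvs.
set ka := u' - u; set kb := v' - v => da db h3 h4 h5 h6 h7 h8.
have Va : V ka := VB Vus Vu. have Vb : V kb := VB Vvs Vv.
have ua : u + ka = u' by rewrite addrC subrK.
have vb : v + kb = v' by rewrite addrC subrK.
have i1 := hd1 ka Va h7; have i2 := hd2 kb Vb h8.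
rewrite ua !(P_grad hip hAsa hAcomp pB hP) // in i1.
rewrite vb !(P_grad hip hAsa hAcomp pB hP) // in i2.
(* Balls of H^{1/2} are convex, so (4a) applies along the segments used by [P_taylor]. *)
have seg (x y : H) z : V x -> V y -> `|Ah x| <= r -> `|Ah y| <= r -> 0 <= z <= 1 -> `|Ah (x + z *: (y - x))| <= r.
  move=> Vx Vy bx by_ /andP[z0 z1].
  rewrite (AhD hip hAsa hAcomp Vx (VZ z (VB Vy Vx))) (AhZ hip hAsa hAcomp _ (VB Vy Vx)) (AhB hip hAsa hAcomp Vy Vx).
  rewrite (_ : _ + _ = (1 - z) *: Ah x + z *: Ah y); last by apply: (ip_inj hip) => q; rewrite !ipE; ring.
  apply: le_trans (ler_normD _ _) _; rewrite !normrZ (ger0_norm z0) ger0_norm ?subr_ge0 //.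
  rewrite (_ : r = (1 - z) * r + z * r); last by ring.
  by apply: lerD; rewrite ler_wpM2l // subr_ge0.
(* The expansion at [u] goes in direction [- w], the one at [v] in direction [w], so both concern
   the same difference B(u) - B(v). *)
have i3 : `|ip (B v) ka - ip (B u) ka + P u [:: ka; w]| <= C * g * `|ka|.
  have := P_taylor hip hAsa hAcomp pB hP Vu (VN Vw) Va (C := C * g * `|ka|).
  have -> : u + - w = v by rewrite /w opprB addrC subrK.
  have -> : P u [:: - w; ka] = - P u [:: ka; w].
    by rewrite -scaleN1r (P_Z2l hP) // mulN1r (P_sym hip hAsa hAcomp hP Vu Vw Va).
  rewrite opprK; apply => z z01.
  have bz : `|Ah (u + z *: - w)| <= r by rewrite /w opprB; exact: seg.
  apply: le_trans (hC _ (VD Vu (VZ z (VN Vw))) bz _ _ _ (VN Vw) (VN Vw) Va) _.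
  by rewrite (AhN hip hAsa hAcomp Vw) normrN /g [`|_| ^+ 2]expr2 [C * (_ * _)]mulrA.
have i4 : `|ip (B u) kb - ip (B v) kb - P v [:: kb; w]| <= C * g * `|kb|.
  have := P_taylor hip hAsa hAcomp pB hP Vv Vw Vb (C := C * g * `|kb|).
  have -> : v + w = u by rewrite /w addrC subrK.
  rewrite (P_sym hip hAsa hAcomp hP Vv Vb Vw); apply => z z01.
  have bz : `|Ah (v + z *: w)| <= r by exact: seg.
  apply: le_trans (hC _ (VD Vv (VZ z Vw)) bz _ _ _ Vw Vw Vb) _.
  by rewrite /g [`|_| ^+ 2]expr2 [C * (_ * _)]mulrA.
have i5 : `|ip ((B u' - B u) - (B v' - B v)) (ka - kb)| <= (L * `|Ah ka| + L * `|Ah kb|) * (`|ka| + `|kb|).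
  apply: le_trans (ip_cauchy_schwarz hip _ _) _; apply: ler_pM => //; last exact: ler_normB.
  by apply: le_trans (ler_normB _ _) _; apply: lerD; apply: hL.
(* Twice the remainder splits into the differentiability remainders of [B] at [u] and [v] paired
   with [w], the two Taylor remainders, and the pairing of the increments of B(u) - B(v) and [w]. *)
rewrite (_ : _ - _ = 2^-1 * ((ip (B u') w - ip (B u) w - P u [:: ka; w]) - (ip (B v') w - ip (B v) w - P v [:: kb; w])
  + (ip (B v) ka - ip (B u) ka + P u [:: ka; w]) + (ip (B u) kb - ip (B v) kb - P v [:: kb; w])
  + ip ((B u' - B u) - (B v' - B v)) (ka - kb))); last first.
  by rewrite -ua -vb /w !ipE; field.
rewrite normrM (ger0_norm (_ : 0 <= 2^-1)) ?invr_ge0 //.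
set DM := `|M s - M t|; set ds := `|s - t|.
have ka1 : `|ka| <= (`|(Ut t).1| + e / 3 / (C * g + 1)) * ds.
  rewrite -(subrK ((s - t) *: (Ut t).1) ka); apply: le_trans (ler_normD _ _) _.
  by rewrite normrZ mulrDl addrC (mulrC `|s - t|) lerD2l.
have kb1 : `|kb| <= (`|(Ut t).2| + e / 3 / (C * g + 1)) * ds.
  rewrite -(subrK ((s - t) *: (Ut t).2) kb); apply: le_trans (ler_normD _ _) _.
  by rewrite normrZ mulrDl addrC (mulrC `|s - t|) lerD2l.
have DM0 : 0 <= DM := normr_ge0 _. have ds0 : 0 <= ds := normr_ge0 _.
have Cg0 : 0 <= C * g by rewrite mulr_ge0 // ltW.
have f1 : `|ip (B u') w - ip (B u) w - P u [:: ka; w]| <= e / 3 * DM by apply: le_trans i1 _; rewrite ler_pM2l.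
have f2 : `|ip (B v') w - ip (B v) w - P v [:: kb; w]| <= e / 3 * DM by apply: le_trans i2 _; rewrite ler_pM2l.
have small : C * g * (e / 3 / (C * g + 1) * ds) <= e / 3 * DM.
  apply: (@le_trans _ _ (e / 3 * ds)); last by rewrite ler_pM2l.
  rewrite mulrA ler_wpM2r // [e / 3 / _]mulrC mulrA -[leRHS]mul1r ler_pM2r //.
  by rewrite ler_pdivrMr // mul1r lerDl.
have f3 : C * g * `|ka| <= C * g * `|(Ut t).1| * ds + e / 3 * DM.
  apply: le_trans (ler_wpM2l Cg0 ka1) _; rewrite mulrDl mulrDr -[C * g * _ * ds]mulrA lerD2l //.
have f4 : C * g * `|kb| <= C * g * `|(Ut t).2| * ds + e / 3 * DM.
  apply: le_trans (ler_wpM2l Cg0 kb1) _; rewrite mulrDl mulrDr -[C * g * _ * ds]mulrA lerD2l //.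
have f5 : (L * `|Ah ka| + L * `|Ah kb|) * (`|ka| + `|kb|) <= 2 * (e / 3 * DM).
  apply: (@le_trans _ _ ((2 * L * DM) * (e / (3 * L)))).
    apply: ler_pM; rewrite ?addr_ge0 ?mulr_ge0 ?(ltW Lp) //.
      rewrite -mulrDr -mulrA mulrCA ler_pM2l // mulr_natl mulr2n; exact: lerD.
    rewrite (_ : e / (3 * L) = e / (6 * L) + e / (6 * L)); last by field; rewrite gt_eqF.
    by apply: lerD; exact: ltW.
  by apply: le_of_eq; field; rewrite gt_eqF.
have tri (x1 x2 x3 x4 x5 : R) : `|x1 - x2 + x3 + x4 + x5| <= `|x1| + `|x2| + `|x3| + `|x4| + `|x5|.
  apply: le_trans (ler_normD _ _) _; rewrite lerD2r.
  apply: le_trans (ler_normD _ _) _; rewrite lerD2r.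
  apply: le_trans (ler_normD _ _) _; rewrite lerD2r.
  exact: ler_normB.
have tot := le_trans (tri _ _ _ _ _) (lerD (lerD (lerD (lerD f1 f2) (le_trans i3 f3)) (le_trans i4 f4)) (le_trans i5 f5)).
apply: (@le_trans _ _ (2^-1 * (2 * (e * DM) + (C * g * `|(Ut t).1| * ds + C * g * `|(Ut t).2| * ds)))).
  by rewrite ler_pM2l ?invr_gt0 //; apply: le_trans tot _; apply: le_of_eq; field.
rewrite mulrDr [2^-1 * (2 * _)]mulrA mulVf // mul1r addrC lerD2r.
apply: (@le_trans _ _ (C / 2 * (`|(Ut t).1| + `|(Ut t).2|) * g * ds)).
  by apply: le_of_eq; field.
rewrite ler_wpM2r // /coupling_slack !hip -/g lerDr.
apply: addr_ge0; first apply: addr_ge0; apply: mulr_ge0; rewrite ?sqr_ge0 ?(ltW eta0) //.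
  by rewrite divr_ge0 // ltW.
by rewrite divr_ge0 ?sqr_ge0 // ltW.
Qed.

End CouplingFunctional.

(** * Real inequalities behind the two functionals *)

Section Algebra.
Context {R : realType}.
Implicit Types (P G h : R).

(** Legend: [P] is |U_t|^2, [G] is |A^{1/2} U|^2, [h] is kappa (K w, w), [p0] and [s1] are the sums
    of [Pi0] and [Pi1], and [cr], [dd], [ka], [bb] stand for (U_t, U), (D U, U), alpha (K w, w) and
    (B(U), U); [cc] is the squared Poincare constant. The dissipation is at least [m] times [S] up
    to constants, and [A] converts [S] into the Lyapunov function. *)
Lemma lyap_algebra (nu c0 eps eta delta C C2 cc CD al m P G h p0 cr dd ka s1 bb : R) :
  let S := P + G + h + p0 + 1 in let A := 4 + nu + CD + al + 4 * C in
  let E := 2^-1 * P + nu / 2 * G + 2^-1 * h + (p0 + s1) in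
  let L := E + eps * (cr + 2^-1 * dd + 2^-1 * ka) in
  0 < nu -> 0 < eps -> eps <= 2^-1 -> eps <= c0 / 2 -> eps * cc <= nu / 4 -> 0 <= C -> 0 <= CD -> 0 <= al ->
  0 <= m -> m <= c0 / 2 -> m <= eps * (1 - eta) * nu -> m <= eps -> m <= eps * delta ->
  0 <= P -> 0 <= G -> 0 <= h -> 0 <= p0 -> `|cr| <= 2^-1 * (P + cc * G) -> 0 <= dd <= CD * G ->
  0 <= ka <= al * h -> `|s1| <= nu / 8 * G + 2^-1 * p0 + 2 * C -> delta * p0 - bb <= eta * nu * G + C2 ->
  [/\ 4^-1 * (P + nu * G) + 2^-1 * h <= L + 2 * C, 0 <= E + 2 * C <= 2 * (L + 2 * C),
    L + 2 * C <= A * S &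
    - c0 * P + eps * (P - nu * G - h - bb) <= - (m / A) * (L + 2 * C) + (eps * C2 + m)].
Proof.
move=> S A E L nu0 e0 e1 e2 e3 C0 CD0 al0 m0 m1 m2 m3 m4 P0 G0 h0 p00 hcr /andP[dd0 hdd] /andP[ka0 hka] hs1 hbb.
have nG : 0 <= nu * G by rewrite mulr_ge0 // ltW.
have ycr : `|eps * cr| <= 4^-1 * P + nu / 8 * G.
  rewrite normrM gtr0_norm //; apply: le_trans (ler_wpM2l (ltW e0) hcr) _.
  have := ler_wpM2r P0 e1; have := ler_wpM2r G0 e3; lra.
have y2 : 0 <= eps * dd <= CD * G.
  rewrite mulr_ge0 ?(ltW e0) //=; apply: le_trans hdd; rewrite ler_piMl //; lra.
have y3 : 0 <= eps * ka <= al * h.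
  rewrite mulr_ge0 ?(ltW e0) //=; apply: le_trans hka; rewrite ler_piMl //; lra.
move: ycr hs1 y2 y3; rewrite !ler_norml => /andP[c1 c2] /andP[s11 s12] /andP[d1 d2] /andP[k1 k2].
have LE : L = E + eps * cr + 2^-1 * (eps * dd) + 2^-1 * (eps * ka) by rewrite /L; ring.
have S1 : 1 <= S /\ [/\ P <= S, G <= S, h <= S & p0 <= S] by rewrite /S; move: P0 G0 h0 p00; clear => P0 G0 h0 p00; do ![split]; lra.
have A0 : 0 < A by move: nu0 CD0 al0 C0; rewrite /A; clear; lra.
have upper : L + 2 * C <= A * S.
  have [S1' [SP SG Sh Sp]] := S1.
  have h1 := ler_wpM2l (ltW nu0) SG; have h2 := ler_wpM2l CD0 SG; have h3 := ler_wpM2l al0 Sh.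
  have h4 := ler_wpM2l C0 S1'.
  have -> : A * S = 4 * S + nu * S + CD * S + al * S + 4 * (C * S) by rewrite /A; ring.
  move: LE h1 h2 h3 h4 SP SG Sh Sp c2 s12 d1 d2 k1 k2 P0 G0 h0 nG; rewrite /E; clear; lra.
have c8 : 0 <= C /\ 0 <= nu * G /\ [/\ 0 <= P, 0 <= h & 0 <= p0] by [].
split => //.
- by rewrite LE /E; move: c8 c1 s11 d1 k1; clear => -[? [? [? ? ?]]]; lra.
- by rewrite LE /E; move: c8 c1 s11 d1 k1; clear => -[? [? [? ? ?]]]; lra.
have hg : m / A * (L + 2 * C) <= m * S.
  apply: le_trans (ler_wpM2l (divr_ge0 m0 (ltW A0)) upper) _.
  by rewrite mulrA divfK ?gt_eqF.
have t1 := ler_wpM2l (ltW e0) hbb.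
have t2 := ler_wpM2r P0 e2; have t3 := ler_wpM2r P0 m1; have t4 := ler_wpM2r G0 m2.
have t5 := ler_wpM2r h0 m3; have t6 := ler_wpM2r p00 m4.
by move: hg t1 t2 t3 t4 t5 t6; rewrite [- (m / A) * _]mulNr /S; move: (m / A * _) => q; clear; lra.
Qed.

(** Legend: [p], [g], [n], [h] are |w_t|^2, |A^{1/2} w|^2, |w|^2 and kappa (K w, w); [q] is the
    correction; [cr], [dd], [ka], [db] stand for (w_t, w), (D w, w), alpha (K w, w) and (B(u) -
    B(v), w); [u] and [v] are |u_t| and |v_t|. The functional decays at rate [g2] up to the term in
    [u + v]. Half of [g2] remains as the final rate; the other half and the decrease of the energy
    pay for that term. *)
Lemma diffun_algebra (nu c0 e L Ce C1 CD al s p g n h q cr dd ka db u v : R) :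
  let C2 := 2 + CD / nu + al in let g2 := Num.min (c0 / 2) (e / 2) / C2 in let C3 := 4 * C1 / nu in
  let F := 2^-1 * p + nu / 2 * g + h + q + e * (cr + 2^-1 * dd + ka) in
  0 < nu -> 0 < c0 -> 0 < e -> e <= 2^-1 -> e <= c0 / 4 -> 0 <= Ce -> 0 <= C1 -> 0 <= CD -> 0 <= al ->
  4 / e * (Ce + 2 * L ^+ 2 / nu) <= s -> 8 * (Ce + 1) <= s ->
  0 <= p -> 0 <= g -> 0 <= n -> 0 <= h -> s * n <= nu * g + h -> `|q| <= e * nu / 8 * g + Ce * n ->
  `|cr| <= 2^-1 * (p + n) -> 0 <= dd <= CD * g -> 0 <= ka <= al * h ->
  - db <= nu / 8 * g + 2 * L ^+ 2 / nu * n -> 0 <= u -> 0 <= v ->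
  [/\ 4^-1 * (p + nu * g + h) <= F, F <= C2 * (p + nu * g + h) &
   - c0 * p + e * (p - nu * g - 2 * h - db) + (c0 / 4 * p + e * nu / 8 * g + Ce * n + C1 * (u + v) * g)
   + F * (C3 ^+ 2 / (g2 * c0) * (- c0 * (u ^+ 2 + v ^+ 2)) + g2 / 2) <= 0].
Proof.
move=> C2 g2 C3 F nu0 c00 e0 e1 e2 Ce0 C10 CD0 al0 s1 s2 p0 g0 n0 h0 sn hq hcr /andP[dd0 hdd] /andP[ka0 hka] hdb u0 v0.
have nG : 0 <= nu * g by rewrite mulr_ge0 // ltW.
have ycr : `|e * cr| <= 4^-1 * p + 4^-1 * n.
  rewrite normrM gtr0_norm //; apply: le_trans (ler_wpM2l (ltW e0) hcr) _.
  have := ler_wpM2r (addr_ge0 p0 n0) e1; lra.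
have y2 : 0 <= e * dd <= CD / nu * (nu * g).
  rewrite mulr_ge0 ?(ltW e0) //= mulrA divfK ?gt_eqF //; apply: le_trans hdd; rewrite ler_piMl //; lra.
have y3 : 0 <= e * ka <= al * h.
  rewrite mulr_ge0 ?(ltW e0) //=; apply: le_trans hka; rewrite ler_piMl //; lra.
have cn : 8 * (Ce * n + n) <= nu * g + h.
  by apply: le_trans sn; apply: le_trans (ler_wpM2r n0 s2); apply: le_of_eq; ring.
have yq : e * nu / 8 * g <= (nu * g) / 16 by have := ler_wpM2r nG e1; lra.
move: ycr hq y2 y3; rewrite !ler_norml => /andP[c1 c2] /andP[q1 q2] /andP[d1 d2] /andP[k1 k2].
have FE : F = 2^-1 * p + nu / 2 * g + h + q + e * cr + 2^-1 * (e * dd) + e * ka by rewrite /F; ring.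
have lower : 4^-1 * (p + nu * g + h) <= F.
  have := mulr_ge0 Ce0 n0; move: FE c1 q1 d1 k1 cn yq p0 nG h0 n0; clear; lra.
pose S := p + nu * g + h; have CD1 : 0 <= CD / nu by rewrite divr_ge0 // ltW.
have upper : F <= C2 * S.
  have [SG Sh] : nu * g <= S /\ h <= S by move: p0 nG h0; rewrite /S; clear => p0 nG h0; split; lra.
  have h2 := ler_wpM2l CD1 SG; have h3 := ler_wpM2l al0 Sh.
  have := mulr_ge0 Ce0 n0; have hCS : C2 * S = 2 * S + CD / nu * S + al * S by rewrite /C2; ring.
  move: FE hCS h2 h3 k1 k2 d1 d2 c2 q2 cn yq p0 nG h0 n0; rewrite /S; clear; lra.
split => //.
have C20 : 0 < C2 by move: CD1 al0; rewrite /C2; clear; lra.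
have [m0 m1 m2] : [/\ 0 < Num.min (c0 / 2) (e / 2), Num.min (c0 / 2) (e / 2) <= c0 / 2 & Num.min (c0 / 2) (e / 2) <= e / 2].
  by rewrite lt_min !ge_min !lexx orbT !divr_gt0.
have g20 : 0 < g2 by rewrite divr_gt0.
have F0 : 0 <= F by apply: le_trans lower; rewrite mulr_ge0 // !addr_ge0.
have r1 : g2 * F <= Num.min (c0 / 2) (e / 2) * S.
  apply: le_trans (ler_wpM2l (ltW g20) upper) _; rewrite mulrA divfK ?gt_eqF //.
have r2 : e * - db <= e * (nu / 8 * g + 2 * L ^+ 2 / nu * n) by rewrite ler_pM2l.
(* The first bound on [s] makes the terms in |w|^2 at most a quarter of [e * (nu * g + h)]. *)
have r3 : Ce * n + e * (2 * L ^+ 2 / nu * n) <= e / 4 * (nu * g + h).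
  have : e / 4 * (4 / e * (Ce + 2 * L ^+ 2 / nu)) * n <= e / 4 * (nu * g + h).
    rewrite -mulrA ler_pM2l ?divr_gt0 //; apply: le_trans sn; exact: ler_wpM2r.
  apply: le_trans; rewrite (_ : e / 4 * _ = Ce + 2 * L ^+ 2 / nu); last by field; rewrite gt_eqF ?gt_eqF.
  have X0 : 0 <= 2 * L ^+ 2 / nu * n by rewrite mulr_ge0 // divr_ge0 ?(ltW nu0) // mulr_ge0 ?sqr_ge0.
  rewrite (mulrDl Ce) lerD2l; apply: le_trans (ler_wpM2r X0 (_ : e <= 1)) _; rewrite ?mul1r //; move: e1; clear; lra.
have m1p := ler_wpM2r p0 m1; have m2g := ler_wpM2r nG m2; have m2h := ler_wpM2r h0 m2.
have e2p := ler_wpM2r p0 e2.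
have r4 : C1 * (u + v) * g <= C3 * (u + v) * F.
  have : nu * g <= 4 * F by move: lower p0 h0; clear; lra.
  move=> hg; have : C1 * (u + v) / nu * (nu * g) <= C1 * (u + v) / nu * (4 * F).
    by rewrite ler_wpM2l // !mulr_ge0 ?addr_ge0 ?invr_ge0 ?(ltW nu0).
  congr (_ <= _); rewrite /C3; field; rewrite gt_eqF //.
have C30 : 0 <= C3 by rewrite !mulr_ge0 ?invr_ge0 ?(ltW nu0).
(* The quadratic term is matched by the factor C3^2 / (g2 c0) of the energy, whose slope carries
   [c0]. *)
have r5 : C3 * (u + v) <= g2 / 2 + C3 ^+ 2 / g2 * (u ^+ 2 + v ^+ 2).
  have := young 1 (C3 * (u + v)) (_ : 0 < 2 * g2); rewrite mulr1 expr1n mulr1 mulr_gt0 // => /(_ isT)/le_trans; apply.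
  rewrite (_ : 2 * g2 / 4 = g2 / 2); last by field.
  rewrite lerD2l exprMn (_ : (2 * g2)^-1 * _ = C3 ^+ 2 / g2 * (2^-1 * (u + v) ^+ 2)); last by field; rewrite gt_eqF.
  apply: ler_wpM2l; first by apply: divr_ge0; [exact: sqr_ge0|exact: ltW].
  by have := sqr_ge0 (u - v); clear; lra.
have r6 : F * (C3 ^+ 2 / (g2 * c0) * (- c0 * (u ^+ 2 + v ^+ 2)) + g2 / 2) <= F * (g2 - C3 * (u + v)).
  rewrite ler_wpM2l // (_ : C3 ^+ 2 / (g2 * c0) * _ = - (C3 ^+ 2 / g2 * (u ^+ 2 + v ^+ 2))).
    by move: r5; clear; lra.
  by field; rewrite !gt_eqF.
have eh := mulr_ge0 (ltW e0) h0.
move: r1 r2 r3 r4 r6 m1p m2g m2h e2p; rewrite mulrBr [F * g2]mulrC [F * (C3 * _)]mulrC /S.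
move: eh; clear; lra.
Qed.

End Algebra.

(** * Choice of constants and uniform synchronization *)

Section Constants.
Context {R : realType} {H : completeNormedModType R}.
Variable ip : {dot H for (@idfun R)}.
Hypothesis hip : forall x : H, ip x x = `|x| ^+ 2.
Variables (domA : set H) (A : H -> H).
Hypothesis hAsa : self_adjoint ip domA A.
Hypothesis hApos : positive_op ip domA A.
Hypothesis hAcomp : compact_resolvent domA A.
Local Notation V := (Hhalf ip domA A).
Local Notation Ah := (frac_pow ip domA A 2^-1).
Local Notation vbnd := (vbounded ip domA A).
Local Notation scv := (state_cvg ip domA A).
Variables (nu : R) (K D B : H -> H) (Pi Pi0 Pi1 : H -> R).
Hypothesis nu0 : 0 < nu.
Hypotheses (bK : vbnd K) (sK : symmetric_on ip V K) (bD : vbnd D) (sD : symmetric_on ip V D).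
Hypotheses (lB : lipschitz_on_balls ip domA A 2^-1 B) (pB : frechet_potential ip domA A B Pi).
Variables (alphabar c0 a alphastar : R).
Hypotheses (a0 : 0 < a) (pK : forall u, V u -> a * `|u| ^+ 2 <= ip (K u) u).
Hypothesis pD : forall u, V u -> 0 <= ip (D u) u.
Hypotheses (alphabar0 : 0 <= alphabar) (c00 : 0 < c0).
Hypothesis h1 : forall u v, V u -> V v -> c0 * (`|u| ^+ 2 + `|v| ^+ 2) <=
  ip (D u) u + ip (D v) v + alphabar * ip (K (u - v)) (u - v).
Hypothesis hPi : forall u, V u -> Pi u = Pi0 u + Pi1 u.
Hypothesis hPi0 : forall u, V u -> 0 <= Pi0 u.
Hypothesis hPi0b : bounded_on_balls ip domA A Pi0.
Hypothesis hPi1 : forall eta : R, 0 < eta -> exists C : R,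
  forall u, V u -> `|Pi1 u| <= eta * (`|Ah u| ^+ 2 + Pi0 u) + C.
Hypothesis h2 : exists eta delta C : R, [/\ eta < 1, 0 < delta, 0 < C &
   forall u v, V u -> V v -> delta * (Pi0 u + Pi0 v) - ip (B u) u - ip (B v) v <=
     eta * nu * (`|Ah u| ^+ 2 + `|Ah v| ^+ 2) + C].

Local Notation kin X := (ip X.1 X.1 + ip X.2 X.2).
Local Notation grad X := (ip (Ah X.1) (Ah X.1) + ip (Ah X.2) (Ah X.2)).
Local Notation gap X := (ip (K (X.1 - X.2)) (X.1 - X.2)).
Local Notation lyap' := (lyap ip domA A nu K D Pi).
Local Notation energy' := (energy ip domA A nu K Pi).
Local Notation lyap_rate' := (lyap_rate ip domA A nu K B).
Local Notation form_bottom := (form_bottom ip domA A nu K).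

Lemma coupling_form_ge0 u : V u -> 0 <= ip (K u) u.
Proof. by move=> Vu; apply: le_trans (pK Vu); rewrite mulr_ge0 ?sqr_ge0 // ltW. Qed.

Lemma damping_form_bound : exists2 C, 0 <= C & forall u, V u -> ip (D u) u <= C * ip (Ah u) (Ah u).
Proof.
have [_ [C C0 hC]] := bD; have [c cp hc] := poincare hip hAsa hApos hAcomp.
exists (C * c) => [|u Vu]; first by rewrite mulr_ge0 // ltW.
apply: le_trans (ip_le hip _ _) _; rewrite hip expr2 mulrACA.
by apply: ler_pM => //; [exact: hC|exact: hc].
Qed.

Lemma form_bottom_le kappa w : 0 <= kappa -> V w ->
  form_bottom kappa * ip w w <= nu * ip (Ah w) (Ah w) + kappa * ip (K w) w.
Proof.
move=> ka Vw; have K0 : K 0 = 0 by rewrite -(subrr 0) (vboundedB bK) ?subrr //; exact: V0.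
have [->|w0] := eqVneq w 0.
  by rewrite !(ip0r, ip0l) (Ah0 hip hAsa hAcomp) ip0r !mulr0 addr0.
have n0 : 0 < `|w| by rewrite normr_gt0.
have Vz : V (`|w|^-1 *: w) by exact: VZ.
have lb : form_bottom kappa <= nu * `|Ah (`|w|^-1 *: w)| ^+ 2 + kappa * ip (K (`|w|^-1 *: w)) (`|w|^-1 *: w).
  apply: ge_inf; last first.
    exists (`|w|^-1 *: w) => //; split => //.
    by rewrite normrZ normfV normr_id mulVf // gt_eqF.
  exists 0 => _ [z [Vz' _] <-]; apply: addr_ge0; apply: mulr_ge0; rewrite ?sqr_ge0 ?(ltW nu0) //.
  exact: coupling_form_ge0.
have KZ : K (`|w|^-1 *: w) = `|w|^-1 *: K w.
  have [lK _] := bK; have := lK `|w|^-1 w 0 Vw (V0 _ _ _).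
  by rewrite !addr0 K0 addr0.
move: lb; rewrite KZ (AhZ hip hAsa hAcomp _ Vw) -hip !ipE => lb.
rewrite hip -ler_pdivlMr ?exprn_gt0 //; apply: le_trans lb _.
by apply: le_of_eq; rewrite hip; field; rewrite gt_eqF.
Qed.

(** The bottom of the form at [kappa] is at most its value at a fixed unit vector, which increases
    in [kappa]; a bottom above the value at kappa = 1 thus forces kappa >= 1. *)
Lemma coupling_strength : exists m : R, forall kappa, 0 <= kappa -> m <= form_bottom kappa -> 0 < form_bottom kappa ->
  1 <= kappa.
Proof.
have [[e [Ve e1]]|ne] := pselect (exists e, V e /\ `|e| = 1); last first.
  (* Without a unit vector in H^{1/2} the infimum is over the empty set, hence 0 by convention. *)
  exists 0 => kappa _ _; rewrite /Defs.form_bottom; set E := image _ _.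
  suff -> : E = set0 by rewrite inf0 ltxx.
  by rewrite -subset0 => t [w hw _]; apply: ne; exists w.
exists (nu * ip (Ah e) (Ah e) + ip (K e) e) => kappa k0 hm _.
have := form_bottom_le k0 Ve; rewrite hip e1 expr1n mulr1 => /(le_trans hm).
rewrite lerD2l -{1}[ip (K e) e]mul1r ler_pM2r //.
by apply: lt_le_trans (pK Ve); rewrite e1 expr1n mulr1.
Qed.

(** The constants precede [alpha] and [kappa]: the coupling form enters only through
    [kappa * gap X], and kappa >= 1 bounds alpha (K w, w) by a multiple of it. *)
Lemma lyap_constants : exists eps gamma C0 C1 A1 : R, [/\ 0 < eps, 0 < gamma, 0 <= C1, 0 <= A1 &
  forall alpha kappa, 0 <= alpha <= `|alphastar| -> 1 <= kappa -> forall X Xt, V X.1 -> V X.2 ->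
  [/\ 4^-1 * (kin Xt + nu * grad X) + 2^-1 * (kappa * gap X) <= lyap' alpha kappa eps X Xt + C0,
      0 <= energy' kappa X Xt + C0 <= 2 * (lyap' alpha kappa eps X Xt + C0),
      lyap' alpha kappa eps X Xt + C0 <= A1 * (kin Xt + grad X + kappa * gap X + (Pi0 X.1 + Pi0 X.2) + 1) &
      lyap_rate' kappa c0 eps X Xt <= - gamma * (lyap' alpha kappa eps X Xt + C0) + C1]].
Proof.
have [cP cP0 hP] := poincare hip hAsa hApos hAcomp.
have [CD CD0 hD] := damping_form_bound.
have [eta [delta [C2 [eta1 delta0 C20 hB]]]] := h2.
(* With this parameter [Pi1] is dominated by nu / 8 of the gradient and half of [Pi0], which leaves
   the energy bounded below. *)
have e10 : (0 : R) < Num.min (nu / 8) 2^-1 by rewrite lt_min divr_gt0 //= invr_gt0 ltr0n.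
have [C hC] := hPi1 e10; pose C' : R := `|C|.
have cP2 : 0 < cP ^+ 2 by rewrite exprn_gt0.
have [eps eps0 [ep1 ep2 ep3]] : exists2 eps, 0 < eps & [/\ eps <= 2^-1, eps <= c0 / 2 & eps * cP ^+ 2 <= nu / 4].
  exists (Num.min 2^-1 (Num.min (c0 / 2) (nu / 4 / cP ^+ 2))); first by rewrite !lt_min invr_gt0 ltr0n /= !divr_gt0.
  by rewrite -ler_pdivlMr // !ge_min !lexx !orbT.
(* [m] lies below the rates at which the kinetic, gradient, coupling and [Pi0] terms are dissipated,
   in this order. *)
have [m m0 [m1 m2 m3 m4]] : exists2 m, 0 < m &
    [/\ m <= c0 / 2, m <= eps * (1 - eta) * nu, m <= eps & m <= eps * delta].
  exists (Num.min (c0 / 2) (Num.min (eps * (1 - eta) * nu) (Num.min eps (eps * delta)))).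
    by rewrite !lt_min eps0 divr_gt0 //= !mulr_gt0 // subr_gt0.
  by rewrite !ge_min !lexx !orbT.
pose A1 : R := 4 + nu + CD + `|alphastar| + 4 * C'.
have C'0 : 0 <= C' by exact: normr_ge0.
have A10 : 0 < A1 by rewrite /A1; do 4?[apply: ltr_wpDr; first by rewrite ?mulr_ge0 ?normr_ge0 ?(ltW nu0)].
exists eps, (m / A1), (2 * C'), (eps * C2 + m), A1; split => //.
- exact: divr_gt0.
- by rewrite addr_ge0 ?mulr_ge0 ?(ltW eps0) ?(ltW C20) ?(ltW m0).
- exact: ltW.
move=> alpha kappa /andP[al0 al1] k1 X Xt V1 V2.
have k0 : 0 <= kappa by apply: le_trans k1; exact: ler01.
have g0 : 0 <= gap X := coupling_form_ge0 (VB V1 V2).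
have hk : gap X <= kappa * gap X by rewrite -{1}[gap X]mul1r ler_wpM2r.
have Pi0s : 0 <= Pi0 X.1 + Pi0 X.2 by rewrite addr_ge0 ?hPi0.
have cross : `|ip Xt.1 X.1 + ip Xt.2 X.2| <= 2^-1 * (kin Xt + cP ^+ 2 * grad X).
  have one (x y : H) : V y -> `|ip x y| <= 2^-1 * (ip x x + cP ^+ 2 * ip (Ah y) (Ah y)).
    move=> Vy; apply: le_trans (ip_cauchy_schwarz hip _ _) _.
    apply: le_trans (ler_wpM2l (normr_ge0 _) (hP _ Vy)) _; rewrite !hip.
    by have := sqr_ge0 (`|x| - cP * `|Ah y|); gen_norm; lra.
  by apply: le_trans (ler_normD _ _) _; have := one Xt.1 _ V1; have := one Xt.2 _ V2; gen_norm; gen_ip; lra.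
have sPi : `|Pi1 X.1 + Pi1 X.2| <= nu / 8 * grad X + 2^-1 * (Pi0 X.1 + Pi0 X.2) + 2 * C'.
  have one x : V x -> `|Pi1 x| <= nu / 8 * ip (Ah x) (Ah x) + 2^-1 * Pi0 x + C'.
    move=> Vx; apply: le_trans (hC _ Vx) _; rewrite mulrDr hip; apply: lerD; last exact: ler_norm.
    by apply: lerD; rewrite ler_wpM2r ?sqr_ge0 ?hPi0 // ge_min lexx ?orbT.
  by apply: le_trans (ler_normD _ _) _; have := one _ V1; have := one _ V2; gen_norm; gen_ip;
     move: (Pi0 _) (Pi0 _) => ? ?; lra.
have dd : 0 <= ip (D X.1) X.1 + ip (D X.2) X.2 <= CD * grad X.
  by rewrite addr_ge0 ?pD //= mulrDr; apply: lerD; exact: hD.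
have ka : 0 <= alpha * gap X <= `|alphastar| * (kappa * gap X).
  by rewrite mulr_ge0 //=; apply: ler_pM.
have bb : delta * (Pi0 X.1 + Pi0 X.2) - (ip (B X.1) X.1 + ip (B X.2) X.2) <= eta * nu * grad X + C2.
  by have := hB _ _ V1 V2; rewrite !hip opprD addrA.
have kg : 0 <= kappa * gap X by exact: mulr_ge0.
have kin0 : 0 <= kin Xt by rewrite !hip addr_ge0 ?sqr_ge0.
have grad0 : 0 <= grad X by rewrite !hip addr_ge0 ?sqr_ge0.
have [r1 r2 r3 r4] := lyap_algebra nu0 eps0 ep1 ep2 ep3 C'0 CD0 (normr_ge0 _) (ltW m0) m1 m2 m3 m4 kin0 grad0 kg Pi0s cross dd ka sPi bb.
have eE : energy' kappa X Xt = 2^-1 * kin Xt + nu / 2 * grad X + 2^-1 * (kappa * gap X) + (Pi0 X.1 + Pi0 X.2 + (Pi1 X.1 + Pi1 X.2)).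
  by rewrite /energy (hPi V1) (hPi V2); ring.
have eL : lyap' alpha kappa eps X Xt = 2^-1 * kin Xt + nu / 2 * grad X + 2^-1 * (kappa * gap X) + (Pi0 X.1 + Pi0 X.2 + (Pi1 X.1 + Pi1 X.2))
  + eps * (ip Xt.1 X.1 + ip Xt.2 X.2 + 2^-1 * (ip (D X.1) X.1 + ip (D X.2) X.2) + 2^-1 * (alpha * gap X)).
  by rewrite /lyap eE; ring.
by rewrite eL eE; split.
Qed.

Local Notation diffun' := (diffun ip domA A nu K D).
Local Notation diffun_rate' := (diffun_rate ip domA A nu K).

Lemma diffun_constants r C1 Q : 0 < r -> 0 <= C1 -> coupling_functional ip domA A B c0 r C1 Q ->
  exists eps k omega s C2 Ceta eta : R, [/\ 0 <= eps, 0 <= k, 0 < omega, 0 <= C2 &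
  (forall a b M m U Ut Zx Zu Zy Zv,
      primitive a b M (fun r => 1 + (m r + m r)) -> (forall r, 0 <= m r) ->
      spath ip domA A a b m (fun t => (U t).1) (fun t => (Ut t).1) Zx Zu ->
      spath ip domA A a b m (fun t => (U t).2) (fun t => (Ut t).2) Zy Zv ->
      (forall t, a <= t <= b -> `|Ah (U t).1| <= r /\ `|Ah (U t).2| <= r) ->
      adiff a b M (fun r => 1 + (m r + m r)) (fun t => Q (U t).1 (U t).2)
        (fun t => ip (B (U t).1 - B (U t).2) ((Ut t).1 - (Ut t).2))
        (fun t => coupling_slack ip domA A c0 eta Ceta C1 (U t) (Ut t))) /\
  forall alpha kappa, 0 <= alpha <= `|alphastar| -> 1 <= kappa ->
    (forall w, V w -> s * ip w w <= nu * ip (Ah w) (Ah w) + kappa * ip (K w) w) ->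
  forall X Xt, V X.1 -> V X.2 -> `|Ah X.1| <= r -> `|Ah X.2| <= r ->
  let w := X.1 - X.2 in let wt := Xt.1 - Xt.2 in
  let S := ip wt wt + nu * ip (Ah w) (Ah w) + kappa * ip (K w) w in
  let F := diffun' alpha kappa eps w wt (Q X.1 X.2) in
  [/\ 4^-1 * S <= F, F <= C2 * S &
    diffun_rate' kappa c0 eps w wt (B X.1 - B X.2) + coupling_slack ip domA A c0 eta Ceta C1 X Xt
      + F * (k * (- c0 * kin Xt) + omega) <= 0]].
Proof.
move=> r0 C10 [_ hQ]; have [CD CD0 hD] := damping_form_bound.
have [L hL] := lB r0.
have [e e0 [e1 e2]] : exists2 e : R, 0 < e & e <= 2^-1 /\ e <= c0 / 4.
  exists (Num.min 2^-1 (c0 / 4)); first by rewrite lt_min invr_gt0 ltr0n divr_gt0.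
  by rewrite !ge_min !lexx !orbT.
(* A small share of the dissipation e nu |A^{1/2} w|^2, used both for the size of [Q] and for its
   slack. *)
have [Ce Ce0 [Qb Qd]] := hQ (e * nu / 8) (divr_gt0 (mulr_gt0 e0 nu0) (ltr0n _ 8)).
set al := `|alphastar|; pose C2 := 2 + CD / nu + al; pose g2 := Num.min (c0 / 2) (e / 2) / C2.
have C20 : 0 < C2 by do 2?[apply: ltr_wpDr; first by rewrite ?normr_ge0 ?divr_ge0 ?(ltW nu0)].
have g20 : 0 < g2 by rewrite divr_gt0 // lt_min !divr_gt0.
pose C3 := 4 * C1 / nu; pose s1 := 4 / e * (Ce + 2 * L ^+ 2 / nu); pose s2 := 8 * (Ce + 1).
exists e, (C3 ^+ 2 / (g2 * c0)), (g2 / 2), (Num.max s1 s2), C2, Ce, (e * nu / 8); split.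
- exact: ltW.
- by rewrite divr_ge0 ?sqr_ge0 // mulr_ge0 // ltW.
- exact: divr_gt0.
- exact: ltW.
split => // alpha kappa /andP[al0 al1] k1 hs X Xt V1 V2 b1 b2 w wt S F.
have k0 : 0 <= kappa by apply: le_trans k1; exact: ler01.
have Vw : V w := VB V1 V2; have g0 := coupling_form_ge0 Vw.
have hk : ip (K w) w <= kappa * ip (K w) w by rewrite -{1}[ip (K w) w]mul1r ler_wpM2r.
have ka : 0 <= alpha * ip (K w) w <= al * (kappa * ip (K w) w).
  by rewrite mulr_ge0 //=; apply: ler_pM.
have dd : 0 <= ip (D w) w <= CD * ip (Ah w) (Ah w) by rewrite pD ?hD.
have ge0 (x : H) : 0 <= ip x x by rewrite hip sqr_ge0.
have cr : `|ip wt w| <= 2^-1 * (ip wt wt + ip w w).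
  apply: le_trans (ip_cauchy_schwarz hip _ _) _; rewrite !hip.
  by have := sqr_ge0 (`|wt| - `|w|); gen_norm; lra.
have hdb : - ip (B X.1 - B X.2) w <= nu / 8 * ip (Ah w) (Ah w) + 2 * L ^+ 2 / nu * ip w w.
  apply: le_trans (ler_norm _) _; rewrite normrN; apply: le_trans (ip_cauchy_schwarz hip _ _) _.
  apply: le_trans (ler_wpM2r (normr_ge0 _) (hL _ _ V1 V2 b1 b2)) _; rewrite !hip.
  rewrite -/w mulrAC; apply: le_trans (young `|Ah w| (L * `|w|) (_ : 0 < nu / 2)) _; first exact: divr_gt0.
  by apply: le_of_eq; field; rewrite gt_eqF.
have hn : Num.max s1 s2 * ip w w <= nu * ip (Ah w) (Ah w) + kappa * ip (K w) w by exact: hs.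
have hq : `|Q X.1 X.2| <= e * nu / 8 * ip (Ah w) (Ah w) + Ce * ip w w by rewrite !hip; exact: Qb.
have s1m : s1 <= Num.max s1 s2 by rewrite le_max lexx.
have s2m : s2 <= Num.max s1 s2 by rewrite le_max lexx orbT.
have [p1 p2 p3] := diffun_algebra nu0 c00 e0 e1 e2 Ce0 C10 CD0 (normr_ge0 alphastar) s1m s2m (ge0 wt) (ge0 (Ah w)) (ge0 w)
  (mulr_ge0 k0 g0) hn hq cr dd ka hdb (normr_ge0 Xt.1) (normr_ge0 Xt.2).
split => //; move: p3; congr (_ <= _).
rewrite /F /diffun /diffun_rate /coupling_slack -/w -/wt !hip /g2 /C2 /C3 -/al; ring.
Qed.

Lemma ip_subr_le (x y : H) : ip (x - y) (x - y) <= 2 * (ip x x + ip y y).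
Proof.
have : 0 <= ip (x + y) (x + y) by rewrite hip sqr_ge0.
by rewrite !ipE; gen_ip; lra.
Qed.

Hypothesis coupling : forall r, 0 < r -> exists C1 Q, 0 <= C1 /\ coupling_functional ip domA A B c0 r C1 Q.

Local Ltac slra := clear -alphastar hip hAsa hApos hAcomp bK sK bD sD lB pB pK pD h1 hPi hPi0 hPi0b hPi1 h2 coupling
  nu0 a0 alphabar0 c00; lra.

(** The order of quantifiers matters: threshold and rate precede [kappa] and [M], the other
    constants may depend on them but not on the solution. Uniformity over bounded data is what the
    attractors require, and the factor 2 in the rate leaves room for a limit equal to 0. *)
Lemma uniform_synchronization : exists sstar omega : R, 0 < omega /\
  forall alpha kappa, alphabar <= alpha <= alphastar -> 0 <= kappa -> sstar <= form_bottom kappa ->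
  forall M, exists rho T N, forall U Ut, coupled_solution ip domA A nu K D B alpha kappa U Ut ->
    `|Ah (U 0).1| <= M -> `|Ah (U 0).2| <= M -> `|(Ut 0).1| <= M -> `|(Ut 0).2| <= M ->
    (forall t, 0 <= t -> `|Ah (U t).1| <= rho /\ `|Ah (U t).2| <= rho) /\
    forall t, T <= t -> `|(Ut t).1 - (Ut t).2| ^+ 2 + `|Ah ((U t).1 - (U t).2)| ^+ 2 <= N * expR (- (2 * omega * t)).
Proof.
have [eps [gamma [C0 [C1 [A1 [eps0 gamma0 C10 A10 hL]]]]]] := lyap_constants.
have x_le (x y : R) : x ^+ 2 <= y -> x <= y + 1.
  by move=> h; apply: le_trans (_ : x ^+ 2 + 1 <= _); [have := sqr_ge0 (x - 1); have := sqr_ge0 x; slra|rewrite lerD2r].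
(* An absorbing level of the Lyapunov function, independent of kappa and of the data; so are the
   radius [rho], the coupling functional on it and the threshold [s]. *)
pose z := C1 / gamma + 1; have z0 : 0 < z by rewrite ltr_wpDl // divr_ge0 // ltW.
pose rho := 4 * z / nu + 1; have rho0 : 0 < rho by rewrite ltr_wpDl // divr_ge0 ?mulr_ge0 ?(ltW z0) ?(ltW nu0).
have [Cq [Q [Cq0 hQ]]] := coupling (addr_gt0 rho0 ltr01).
have [e2 [k [omega [s [C2 [Ceta [eta [e20 k0 om0 C20 [Qd hF]]]]]]]]] := diffun_constants (addr_gt0 rho0 ltr01) Cq0 hQ.
have [m hm] := coupling_strength.
(* [m] together with positivity, secured by 1, forces kappa >= 1; [s] absorbs the terms in |w|^2. *)
exists (Num.max m (Num.max s 1)), (omega / 2); split; first exact: divr_gt0.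
move=> alpha kappa /andP[al1 al2] ka0; rewrite !ge_max => /and3P[fm fs f1] M.
have al0 : 0 <= alpha by exact: le_trans al1.
have al : 0 <= alpha <= `|alphastar| by rewrite al0 (le_trans al2) // ler_norm.
have ka1 : 1 <= kappa by apply: hm fm _ => //; exact: lt_le_trans f1.
have hs w : V w -> s * ip w w <= nu * ip (Ah w) (Ah w) + kappa * ip (K w) w.
  move=> Vw; apply: le_trans (form_bottom_le ka0 Vw); rewrite ler_wpM2r // hip sqr_ge0 //.
pose M' : R := `|M| + 1; have M'0 : 0 < M' by rewrite ltr_wpDl.
have MM : M <= M' by rewrite (le_trans (ler_norm _)) // lerDl.
have [M0 hM0] := hPi0b M'0; have [cP cP0 hP] := poincare hip hAsa hApos hAcomp.
have [lK [CK CK0 hK]] := bK.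
(* A bound for the initial value of the Lyapunov function. It grows with kappa, but enters only
   witnesses chosen after kappa. *)
pose N0 := A1 * (2 * M' ^+ 2 + 2 * M' ^+ 2 + kappa * (CK * cP * (4 * M' ^+ 2)) + 2 * M0 + 1).
pose Y X Xt := lyap' alpha kappa eps X Xt + C0.
have Yge X Xt : V X.1 -> V X.2 -> 0 <= Y X Xt.
  move=> V1 V2; have [h _ _ _] := hL alpha kappa al ka1 X Xt V1 V2; apply: le_trans h.
  have := coupling_form_ge0 (VB V1 V2) => g0.
  apply: addr_ge0; apply: mulr_ge0; rewrite ?mulr_ge0 //.
  by rewrite !hip !addr_ge0 ?mulr_ge0 ?addr_ge0 ?sqr_ge0 // ltW.
have dis U Ut t : coupled_solution ip domA A nu K D B alpha kappa U Ut -> 0 <= t ->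
    Y (U t) (Ut t) <= C1 / gamma + Y (U 0) (Ut 0) * expR (- (gamma * t)).
  move=> sU t0; apply: (solution_dissipation hip hAsa hApos hAcomp nu0 bK sK bD sD lB pB (alphabar := alphabar) (c0 := c0)) => //.
  - exact: coupling_form_ge0.
  - exact: ltW.
  - by move=> X Xt V1 V2; have [_ _ _] := hL alpha kappa al ka1 X Xt V1 V2.
have bdd X Xt y : V X.1 -> V X.2 -> Y X Xt <= y -> `|Ah X.1| <= 4 * y / nu + 1 /\ `|Ah X.2| <= 4 * y / nu + 1.
  move=> V1 V2 hy; have [h _ _ _] := hL alpha kappa al ka1 X Xt V1 V2.
  have := mulr_ge0 ka0 (coupling_form_ge0 (VB V1 V2)) => g0.
  have : nu * (`|Ah X.1| ^+ 2 + `|Ah X.2| ^+ 2) <= 4 * y.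
    move: (le_trans h hy) g0; rewrite !hip; have := sqr_ge0 `|Xt.1|; have := sqr_ge0 `|Xt.2|.
    by gen_ip; gen_norm; slra.
  rewrite mulrC -ler_pdivlMr // => hg.
  by split; apply: x_le; apply: le_trans hg; rewrite ?lerDl ?lerDr sqr_ge0.
(* The first witness bounds the whole trajectory, before the absorbing level is reached as well. The
   second is T0 + 1, where from [T0] on expR (gamma t) is at least [N0]. In the third, C2 (10 z)
   bounds [Phi] at [T0], k (2 z) bounds the drop of k E after [T0], and 4 / min(1, nu) passes from
   [Phi] to the norms. *)
exists (4 * (C1 / gamma + N0) / nu + 1), (N0 / gamma + 2),
  (4 / Num.min 1 nu * (C2 * (10 * z) * expR (k * (2 * z) + omega * (N0 / gamma + 1)))).
move=> U Ut sU b1 b2 b3 b4.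
have VU t : 0 <= t -> V (U t).1 /\ V (U t).2 by exact: solution_V sU.
have [V01 V02] := VU 0 (lexx 0).
have Y0 : Y (U 0) (Ut 0) <= N0.
  have [_ _ h _] := hL alpha kappa al ka1 (U 0) (Ut 0) V01 V02; apply: le_trans h _; rewrite ler_wpM2l //.
  have sq (x : H) : `|x| <= M -> ip x x <= M' ^+ 2.
    by move=> xM; rewrite hip ler_sqr ?nnegrE ?(ltW M'0) // (le_trans xM).
  have k1 := sq _ b3; have k2 := sq _ b4; have g1 := sq _ b1; have g2 := sq _ b2.
  have p1 := hM0 _ V01 (le_trans b1 MM); have p2 := hM0 _ V02 (le_trans b2 MM).
  have Vw := VB V01 V02.
  have gp : ip (K ((U 0).1 - (U 0).2)) ((U 0).1 - (U 0).2) <= CK * cP * (4 * M' ^+ 2).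
    apply: le_trans (ip_le hip _ _) _.
    apply: (@le_trans _ _ (CK * cP * `|Ah ((U 0).1 - (U 0).2)| ^+ 2)).
      by rewrite expr2 mulrACA; apply: ler_pM => //; [exact: hK|exact: hP].
    rewrite ler_wpM2l ?mulr_ge0 ?(ltW CK0) ?(ltW cP0) // -hip (AhB hip hAsa hAcomp) //.
    by apply: le_trans (ip_subr_le _ _) _; move: g1 g2; gen_ip; move: (M' ^+ 2) => q; slra.
  have gk := ler_wpM2l ka0 gp.
  have := ler_norm (Pi0 (U 0).1); have := ler_norm (Pi0 (U 0).2).
  move: k1 k2 g1 g2 p1 p2 gk; gen_ip; gen_norm; move: (kappa * _) (Pi0 _) (Pi0 _) (M' ^+ 2) => ? ? ? ?; slra.
have N00 : 0 <= N0 by apply: le_trans (Yge _ _ V01 V02) Y0.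
split=> [t t0|t tT].
  have [V1 V2] := VU t t0; apply: (bdd _ (Ut t)) => //; apply: le_trans (dis _ _ _ sU t0) _; rewrite lerD2l.
  apply: (fun h => le_trans h Y0); rewrite -[leRHS]mulr1.
  apply: ler_wpM2l; first exact: Yge.
  by rewrite -expR0 ler_expR oppr_le0; apply: mulr_ge0 => //; exact: ltW.
pose T0 := N0 / gamma + 1; have T00 : 0 < T0 by rewrite ltr_wpDl // divr_ge0 // ltW.
have Yz r : T0 <= r -> Y (U r) (Ut r) <= z.
  move=> Tr; apply: le_trans (dis _ _ _ sU (le_trans (ltW T00) Tr)) _; rewrite /z lerD2l expRN ler_pdivrMr ?expR_gt0 // mul1r.
  apply: (le_trans Y0); apply: le_trans (_ : 1 + gamma * r <= _); last exact: expR_ge1Dx.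
  have := ler_wpM2l (ltW gamma0) Tr; rewrite /T0 mulrDr mulrCA divff ?gt_eqF //; move: gamma0; slra.
have ball r : T0 <= r -> `|Ah (U r).1| <= rho /\ `|Ah (U r).2| <= rho.
  move=> Tr; have r0 : 0 <= r by apply: le_trans Tr; exact: ltW.
  have [V1 V2] := VU r r0; exact: (bdd _ (Ut r) _ V1 V2 (Yz r Tr)).
have Tt : T0 < t by apply: lt_le_trans tT; rewrite /T0 ltrD2l ltr1n.
have bigr (x : R) : x <= rho -> x <= rho + 1 by move/le_trans; apply; rewrite lerDl.
have hFs X Xt V1 V2 B1 B2 := hF alpha kappa al ka1 hs X Xt V1 V2 B1 B2.
have sync : diffun' alpha kappa e2 ((U t).1 - (U t).2) ((Ut t).1 - (Ut t).2) (Q (U t).1 (U t).2) *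
       expR (k * energy' kappa (U t) (Ut t) + omega * t) <=
       diffun' alpha kappa e2 ((U T0).1 - (U T0).2) ((Ut T0).1 - (Ut T0).2) (Q (U T0).1 (U T0).2) *
       expR (k * energy' kappa (U T0) (Ut T0) + omega * T0).
  have kqc (I : Type) (F : set_system I) (FF : Filter F) X Xt x xt : scv F X Xt x xt ->
      (fun i => coupling_slack ip domA A c0 eta Ceta Cq (X i) (Xt i)) @ F --> coupling_slack ip domA A c0 eta Ceta Cq x xt.
    exact: coupling_slack_cvg.
  apply: (solution_synchronization hip hAsa hApos hAcomp nu0 bK sK bD sD lB pB coupling_form_ge0 h1 al1 e20 k0 (proj1 hQ) kqc Qd) => //.
  - move=> X Xt [V1 [V2 [B1 B2]]]; have [h _ _] := hFs X Xt V1 V2 B1 B2; apply: le_trans h.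
    by rewrite mulr_ge0 // !addr_ge0 ?mulr_ge0 ?(ltW nu0) ?coupling_form_ge0 ?hip ?sqr_ge0 //; exact: VB.
  - by move=> X Xt [V1 [V2 [B1 B2]]]; have [_ _] := hFs X Xt V1 V2 B1 B2.
have t0 : 0 <= t by exact: ltW (lt_trans T00 Tt).
have [V1 V2] := VU t t0; have [W1 W2] := VU T0 (ltW T00).
have [B1 B2] := ball t (ltW Tt); have [B3 B4] := ball T0 (lexx T0).
have [Flow _ _] := hFs (U t) (Ut t) V1 V2 (bigr _ B1) (bigr _ B2).
have [FTlow Fup _] := hFs (U T0) (Ut T0) W1 W2 (bigr _ B3) (bigr _ B4).
have [_ /andP[Et _] _ _] := hL alpha kappa al ka1 (U t) (Ut t) V1 V2.
have [YT /andP[_ ET] _ _] := hL alpha kappa al ka1 (U T0) (Ut T0) W1 W2.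
have {}YT := le_trans YT (Yz T0 (lexx T0)).
have {}ET : energy' kappa (U T0) (Ut T0) + C0 <= 2 * z.
  by apply: le_trans ET _; rewrite ler_pM2l //; exact: Yz.
have {}Fup := le_trans Fup (ler_wpM2l C20 (_ : _ <= 10 * z)).
have mu0 : 0 < Num.min 1 nu by rewrite lt_min ltr01.
have gT := mulr_ge0 ka0 (coupling_form_ge0 (VB W1 W2)).
have gt := mulr_ge0 ka0 (coupling_form_ge0 (VB V1 V2)).
have {}Fup := Fup _.
have {}FTlow : 0 <= diffun' alpha kappa e2 ((U T0).1 - (U T0).2) ((Ut T0).1 - (Ut T0).2) (Q (U T0).1 (U T0).2).
  apply: le_trans FTlow; rewrite mulr_ge0 //; apply: addr_ge0 => //.
  by apply: addr_ge0; rewrite ?mulr_ge0 ?(ltW nu0) ?hip ?sqr_ge0.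
move: sync Flow Fup FTlow; set Ft := diffun' _ _ _ _ _ _; set FT := diffun' _ _ _ _ _ _ => sync Flow Fup FTlow.
(* Level [z] bounds the kinetic and gradient part by 4 z and the coupling form by 2 z; passing to
   differences doubles the former, and 8 z + 2 z = 10 z. *)
have {}Fup : FT <= C2 * (10 * z).
  apply: Fup; have wt := ip_subr_le (Ut T0).1 (Ut T0).2; have ww := ip_subr_le (Ah (U T0).1) (Ah (U T0).2).
  have := ler_wpM2l (ltW nu0) ww; rewrite (AhB hip hAsa hAcomp W1 W2).
  by move: YT wt gT (ltW z0); gen_ip; move: (kappa * _) => ?; slra.
have pg : `|(Ut t).1 - (Ut t).2| ^+ 2 + `|Ah ((U t).1 - (U t).2)| ^+ 2 <= 4 / Num.min 1 nu * Ft.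
  rewrite mulrAC ler_pdivlMr // -!hip mulrDl.
  have le1 (x y : R) : 0 <= x -> y <= 1 -> x * y <= x by move=> x0 y1; rewrite -[leRHS]mulr1 ler_wpM2l.
  have c1 : ip ((Ut t).1 - (Ut t).2) ((Ut t).1 - (Ut t).2) * Num.min 1 nu <= ip ((Ut t).1 - (Ut t).2) ((Ut t).1 - (Ut t).2).
    by apply: le1; rewrite ?hip ?sqr_ge0 // ge_min lexx.
  have c2 : ip (Ah ((U t).1 - (U t).2)) (Ah ((U t).1 - (U t).2)) * Num.min 1 nu <= nu * ip (Ah ((U t).1 - (U t).2)) (Ah ((U t).1 - (U t).2)).
    by rewrite mulrC ler_wpM2r ?hip ?sqr_ge0 // ge_min lexx orbT.
  apply: le_trans (lerD c1 c2) _; move: Flow gt.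
  by gen_ip; move: (kappa * _) => ?; slra.
apply: le_trans pg _; rewrite -[leRHS]mulrA ler_pM2l ?divr_gt0 //.
rewrite -(ler_pM2r (expR_gt0 (k * energy' kappa (U t) (Ut t) + omega * t))); apply: le_trans sync _.
move: (C2 * (10 * z)) Fup => c Fup; rewrite -(mulrA c) -(mulrA c) -!expRD; apply: ler_pM; rewrite ?expR_ge0 //.
rewrite ler_expR; have : k * (energy' kappa (U T0) (Ut T0) - energy' kappa (U t) (Ut t)) <= k * (2 * z).
  by rewrite ler_wpM2l //; move: ET Et; move: (energy' _ _ _) (energy' _ _ _) => ? ?; slra.
by rewrite mulrBr -/T0; move: (k * _) (k * _) (k * _) (omega * _) => ? ? ? ?; slra.
Qed.

End Constants.

(** * Synchronization of trajectories and equality of the attractors *)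

Section Attractors.
Context {R : realType} {H : completeNormedModType R}.
Variable ip : {dot H for (@idfun R)}.
Hypothesis hip : forall x : H, ip x x = `|x| ^+ 2.
Variables (domA : set H) (A : H -> H).
Hypothesis hAsa : self_adjoint ip domA A.
Hypothesis hApos : positive_op ip domA A.
Hypothesis hAcomp : compact_resolvent domA A.
Local Notation V := (Hhalf ip domA A).
Local Notation Ah := (frac_pow ip domA A 2^-1).
Variables (nu alpha kappa omega : R) (K D B : H -> H).
Hypotheses (K0 : K 0 = 0) (omega0 : 0 < omega).
Local Notation csol := (coupled_solution ip domA A nu K D B alpha kappa).
Local Notation ssol := (single_solution ip domA A nu D B).

Lemma norm2_le (x : H * H) : norm2 x <= `|x.1| + `|x.2|.
Proof.
rewrite /norm2 -[leRHS]ger0_norm ?addr_ge0 // -sqrtr_sqr ler_wsqrtr // sqrrD lerD2r lerDl.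
by rewrite mulrn_wge0 // mulr_ge0.
Qed.

(** On the diagonal the coupling terms reduce to [K 0], and the approximating strong solutions can
    be doubled too. *)
Lemma diagonal_solution w wt : ssol w wt -> csol (fun t => (w t, w t)) (fun t => (wt t, wt t)).
Proof.
move=> sw T T0; have [ew [wn [wtn [hs hc]]]] := sw T T0; split => //.
exists (fun n t => (wn n t, wn n t)), (fun n t => (wtn n t, wtn n t)); split.
  move=> n; have [wtt [cl ae]] := hs n; exists wtt, wtt; split => //.
  move: ae; apply: filterS; first exact: (ae_filter_ringOfSetsType (@lebesgue_measure R)).
  move=> t ht tT; have [f ef e0] := ht tT; exists f, f.
  by rewrite !subrr K0 !scaler0 !addr0.
move=> e e0; have e2 : 0 < e / 2 by exact: divr_gt0.
have := hc _ e2; apply: filterS => n hn t tT; have := hn t tT.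
set x := wt t - wtn n t; set y := Ah (w t - wn n t) => h.
have n1 := norm2_le (x, x); have n2 := norm2_le (y, y).
have n3 := ler_wpM2l (sqrtr_ge0 nu) n2; move: n1 n3; rewrite /= mulrDr => n1 n3.
apply: le_lt_trans (lerD n1 n3) _; move: h; move: (Num.sqrt nu * _) => q; gen_norm; lra.
Qed.

Hypothesis hsync : forall M : R, exists rho T N : R, forall U Ut, csol U Ut ->
    `|Ah (U 0).1| <= M -> `|Ah (U 0).2| <= M -> `|(Ut 0).1| <= M -> `|(Ut 0).2| <= M ->
    (forall t, 0 <= t -> `|Ah (U t).1| <= rho /\ `|Ah (U t).2| <= rho) /\
    forall t, T <= t -> `|(Ut t).1 - (Ut t).2| ^+ 2 + `|Ah ((U t).1 - (U t).2)| ^+ 2 <= N * expR (- (2 * omega * t)).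

Lemma common_bound (a b c d : R) : exists M, [/\ a <= M, b <= M, c <= M & d <= M].
Proof.
exists (Num.max (Num.max a b) (Num.max c d)).
by rewrite !le_max !lexx !orbT.
Qed.

Lemma expR_small (N e c : R) : 0 < e -> 0 < c -> exists t0, forall t, t0 <= t -> N * expR (- (c * t)) < e.
Proof.
move=> e0 c0; exists (`|N| / e / c) => t ht.
rewrite expRN ltr_pdivrMr ?expR_gt0 //; apply: le_lt_trans (ler_norm _) _.
apply: lt_le_trans (_ : e * (1 + c * t) <= _); last by rewrite ler_pM2l // expR_ge1Dx.
move: ht; rewrite ler_pdivrMr // ler_pdivrMr // => ht; apply: le_lt_trans ht _.
by rewrite mulrC ltr_pM2l // mulrC ltrDr.
Qed.

Lemma synchronization_limit U Ut : csol U Ut ->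
  expR (omega * t) * (`|(Ut t).1 - (Ut t).2| ^+ 2 + `|Ah ((U t).1 - (U t).2)| ^+ 2) @[t --> +oo] --> (0 : R).
Proof.
move=> sU; have [M [m1 m2 m3 m4]] := common_bound `|Ah (U 0).1| `|Ah (U 0).2| `|(Ut 0).1| `|(Ut 0).2|.
have [rho [T [N hN]]] := hsync M; have [_ hT] := hN U Ut sU m1 m2 m3 m4.
apply/cvgrPdist_lt => e e0; have [t0 ht0] := expR_small N e0 omega0.
near=> t; rewrite sub0r normrN ger0_norm ?mulr_ge0 ?expR_ge0 ?addr_ge0 ?sqr_ge0 //.
have tT : T <= t by near: t; apply: nbhs_pinfty_ge; exact: num_real.
have tt : t0 <= t by near: t; apply: nbhs_pinfty_ge; exact: num_real.
apply: le_lt_trans (ht0 t tt); apply: le_trans (ler_wpM2l (expR_ge0 _) (hT t tT)) _.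
rewrite mulrCA -expRD; apply: le_of_eq; congr (_ * expR _); ring.
Unshelve. all: by end_near. Qed.

Hypothesis huniq : forall U Ut U' Ut', csol U Ut -> csol U' Ut' -> U 0 = U' 0 -> Ut 0 = Ut' 0 ->
  forall t, 0 <= t -> U t = U' t /\ Ut t = Ut' t.

Variables (S : R -> (H * H) * (H * H) -> (H * H) * (H * H)) (Ss : R -> H * H -> H * H).
Variables (Att : set ((H * H) * (H * H))) (As : set (H * H)).
Hypotheses (flowS : coupled_flow ip domA A nu K D B alpha kappa S) (flowSs : single_flow ip domA A nu D B Ss).
Hypothesis attS : global_attractor (coupled_phase ip domA A) (coupled_dist ip domA A) S Att.
Hypothesis attSs : global_attractor (single_phase ip domA A) (single_dist ip domA A) Ss As.
Let diag (y : H * H) : (H * H) * (H * H) := ((y.1, y.1), (y.2, y.2)).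

(** The doubled single solution solves the coupled system, and by uniqueness it is the one that [S]
    follows. *)
Lemma diagonal_flow y t : single_phase ip domA A y -> 0 <= t -> S t (diag y) = diag (Ss t y).
Proof.
move=> Vy t0; have [w [wt [sw ey hw]]] := flowSs Vy.
have [U [Ut [sU eU hU]]] : exists U Ut, [/\ csol U Ut, (U 0, Ut 0) = diag y & forall t, 0 <= t -> S t (diag y) = (U t, Ut t)].
  by apply: flowS; split; exact: Vy.
have [||e1 e2] := huniq sU (diagonal_solution sw) _ _ t0.
- by case: eU => -> _; rewrite -ey.
- by case: eU => _ ->; rewrite -ey.
by rewrite hU // e1 e2 hw.
Qed.

Lemma diagonal_dist y z : coupled_dist ip domA A (diag y) (diag z) = Num.sqrt 2 * single_dist ip domA A y z.
Proof.
rewrite /coupled_dist /single_dist /norm2 /= -sqrtrM ?ler0n // !sqr_sqrtr ?addr_ge0 ?sqr_ge0 //.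
by congr Num.sqrt; ring.
Qed.

Lemma single_dist_le y z : single_dist ip domA A y z <= coupled_dist ip domA A (diag y) (diag z).
Proof.
by rewrite diagonal_dist ler_peMl ?sqrtr_ge0 // -{1}[1](@sqrtr1 R) ler_wsqrtr // ler1n.
Qed.

(** By invariance [x] is, for every t, the state at time t of a solution started in the attractor.
    These data are bounded independently of t, so the uniform decay bounds the gap in [x] by N expR
    (- 2 omega t) for all large t, and it vanishes. *)
Lemma attractor_synchronized x : Att x -> exists2 y, single_phase ip domA A y & x = diag y.
Proof.
have [[Aph [MA hMA]] _ Ainv _] := attS => Ax.
have le_sqrt (a b : R) : 0 <= b -> `|a| <= Num.sqrt (a ^+ 2 + b).
  by move=> b0; rewrite -sqrtr_sqr ler_wsqrtr // lerDl.
have dist_ge y z : [/\ norm2 (Ah (y.1.1 - z.1.1), Ah (y.1.2 - z.1.2)) <= coupled_dist ip domA A y z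
    & norm2 (y.2 - z.2) <= coupled_dist ip domA A y z].
  rewrite /coupled_dist; split; apply: (le_trans (ler_norm _)); first by apply: le_sqrt; exact: sqr_ge0.
  by rewrite [X in Num.sqrt X]addrC; apply: le_sqrt; exact: sqr_ge0.
(* [dist_bounded] limits mutual distances only, so the norms of points of the attractor are bounded
   relative to [x]. *)
have [M [m1 m2 m3 m4]] := common_bound (`|Ah x.1.1| + MA) (`|Ah x.1.2| + MA) (`|x.2.1| + MA) (`|x.2.2| + MA).
have near_x (p q : H) c : `|q - p| <= MA -> `|p| + MA <= c -> `|q| <= c.
  move=> h; apply: le_trans; rewrite -(subrK p q) addrC.
  by apply: le_trans (ler_normD _ _) _; rewrite lerD2l.
have [rho [T [N hN]]] := hsync M.
have [Vx1 Vx2] := Aph x Ax.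
pose f := `|x.2.1 - x.2.2| ^+ 2 + `|Ah (x.1.1 - x.1.2)| ^+ 2.
have fe t : 0 <= t -> T <= t -> f <= N * expR (- (2 * omega * t)).
  move=> t0 tT; have : (S t @` Att) x by rewrite Ainv.
  move=> [y Ay ey]; have [U [Ut [sU eU hU]]] := flowS (Aph y Ay).
  have [e1 e2] : U 0 = y.1 /\ Ut 0 = y.2 by rewrite -eU.
  have [Vy1 Vy2] := Aph y Ay; have [d1 d2] := dist_ge y x; have dM := hMA _ _ Ay Ax.
  have [c1 c2] : `|Ah (U 0).1| <= M /\ `|Ah (U 0).2| <= M.
    rewrite e1; split; [apply: near_x m1|apply: near_x m2]; rewrite -(AhB hip hAsa hAcomp) //.
      exact: le_trans (norm2_ge1 (_, _)) (le_trans d1 dM).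
    exact: le_trans (norm2_ge2 (_, _)) (le_trans d1 dM).
  have [c3 c4] : `|(Ut 0).1| <= M /\ `|(Ut 0).2| <= M.
    rewrite e2; split; [apply: near_x m3|apply: near_x m4].
      exact: le_trans (norm2_ge1 (y.2 - x.2)) (le_trans d2 dM).
    exact: le_trans (norm2_ge2 (y.2 - x.2)) (le_trans d2 dM).
  have [_ h] := hN U Ut sU c1 c2 c3 c4.
  by have := h t tT; rewrite /f -ey hU.
have f0 : f <= 0.
  apply/ler_addgt0Pr => e e0; rewrite add0r; have [t0 ht0] := expR_small N e0 (mulr_gt0 (ltr0n _ 2) omega0).
  pose t := Num.max (Num.max 0 T) t0.
  have [a1 a2 a3] : [/\ 0 <= t, T <= t & t0 <= t] by rewrite /t !le_max !lexx !orbT.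
  by apply: le_trans (fe t a1 a2) _; apply: ltW; exact: ht0.
have [s1 s2] : `|x.2.1 - x.2.2| ^+ 2 = 0 /\ `|Ah (x.1.1 - x.1.2)| ^+ 2 = 0.
  move: f0; rewrite /f; have := sqr_ge0 `|x.2.1 - x.2.2|; have := sqr_ge0 `|Ah (x.1.1 - x.1.2)|.
  by gen_norm; split; lra.
have z0 (z : H) : `|z| ^+ 2 = 0 -> z = 0 by move=> /eqP; rewrite sqrf_eq0 normr_eq0 => /eqP.
have e2 : x.2.1 = x.2.2 by apply/subr0_eq/z0.
have e1 : x.1.1 = x.1.2.
  apply/subr0_eq/eqP; rewrite -normr_le0; have [c cp hc] := poincare hip hAsa hApos hAcomp.
  by apply: le_trans (hc _ (VB Vx1 Vx2)) _; rewrite (z0 _ s2) normr0 mulr0.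
exists (x.1.1, x.2.1) => //.
by case: x e1 e2 {Ax m1 m2 m3 m4 Vx1 Vx2 f fe f0 s1 s2} => [[u v] [ut vt]] /= -> ->.
Qed.

(** Both inclusions follow one pattern. By invariance a point is the image at a late time t of a
    point of its own attractor; through the diagonal that attractor is a bounded set for the other
    flow and is attracted by the other attractor. So the point is arbitrarily close to the latter,
    which is closed. *)
Lemma attractor_diagonal : Att = diagonal_set As.
Proof.
have [[Aph [MA hMA]] Acl Ainv Aattr] := attS; have [[sph [Ms hMs]] scl sinv sattr] := attSs.
have time (P : R -> Prop) : (\forall t \near +oo, P t) -> exists2 t, 0 <= t & P t.
  move=> h; have [t [h1 h2]] := filter_ex (filterI (nbhs_pinfty_ge (num_real (0 : R))) h).
  by exists t.
apply/seteqP; split=> [x Ax|_ [a0 Aa0 <-]].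
  have [y0 Vy0 ex] := attractor_synchronized Ax.
  exists y0; last by rewrite ex.
  apply: scl => // e e0.
  have [t t0 ht] : exists2 t, 0 <= t & forall y, Att (diag y) -> exists2 a, As a & single_dist ip domA A (Ss t y) a < e.
    apply: time; apply: sattr e0; split.
      by move=> y /Aph[].
    by exists MA => y z Ay Az; apply: le_trans (single_dist_le _ _) _; exact: hMA.
  have : (S t @` Att) x by rewrite Ainv.
  move=> [x' Ax' ex']; have [y Vy exy] := attractor_synchronized Ax'.
  have : y0 = Ss t y.
    move: ex'; rewrite exy (diagonal_flow Vy t0) ex => -[e1 _ e2 _].
    by rewrite [y0]surjective_pairing [Ss t y]surjective_pairing e1 e2.
  by move=> ->; apply: ht; rewrite -exy.
apply: Acl => [|e e0]; first by split; exact: sph Aa0.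
have [t t0 ht] : exists2 t, 0 <= t & forall x, diagonal_set As x -> exists2 a, Att a & coupled_dist ip domA A (S t x) a < e.
  apply: time; apply: Aattr e0; split.
    by move=> _ [y /sph Vy <-]; split.
  exists (Num.sqrt 2 * Ms) => _ _ [y Ay <-] [z Az <-].
  by rewrite [leLHS]diagonal_dist ler_wpM2l ?sqrtr_ge0 // hMs.
have : (Ss t @` As) a0 by rewrite sinv.
move=> [a Aa ea]; have [|b Ab hb] := ht (diag a); first by exists a.
by exists b => //; move: hb; rewrite (diagonal_flow (sph _ Aa) t0) ea.
Qed.

End Attractors.

Theorem theorem3p14 (R : realType) (H : completeNormedModType R)
    (ip : {dot H for (@idfun R)})
    (hip : forall x : H, ip x x = `|x| ^+ 2)
    (hsep : @separable_space R H)
    (domA : set H) (A : H -> H)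
    (hAsa : self_adjoint ip domA A)
    (hApos : positive_op ip domA A)
    (hAcomp : compact_resolvent domA A)
    (nu : R) (hnu : 0 < nu)
    (domK : set H) (K : H -> H)
    (hKdom : lin_subspace domK /\ Hhalf ip domA A `<=` domK)
    (hKlin : linear_on domK K)
    (hKsym : symmetric_on ip domK K)
    (hKpos : exists2 a : R, 0 < a &
       forall u, domK u -> a * `|u| ^+ 2 <= ip (K u) u)
    (D : H -> H)
    (hDlin : linear_on (Hhalf ip domA A) D)
    (hDsym : symmetric_on ip (Hhalf ip domA A) D)
    (hDpos : forall u, Hhalf ip domA A u -> 0 <= ip (D u) u)
    (B : H -> H) (hBlip : lipschitz_on_balls ip domA A 2^-1 B)
    (Pi Pi0 Pi1 : H -> R)
    (hPiB : frechet_potential ip domA A B Pi)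
    (hPi : forall u, Hhalf ip domA A u -> Pi u = Pi0 u + Pi1 u)
    (hPi0 : forall u, Hhalf ip domA A u -> 0 <= Pi0 u)
    (hPi0b : bounded_on_balls ip domA A Pi0)
    (hPi1 : forall eta : R, 0 < eta -> exists C : R,
       forall u, Hhalf ip domA A u ->
         `|Pi1 u| <= eta * (hnorm ip domA A 2^-1 u ^+ 2 + Pi0 u) + C)
    (* (1) *)
    (hDbd : exists C : R, forall u, Hhalf ip domA A u ->
       `|D u| <= C * hnorm ip domA A 2^-1 u)
    (alphabar : R) (halphabar : 0 <= alphabar)
    (h1 : exists2 c0 : R, 0 < c0 &
       forall u v, Hhalf ip domA A u -> Hhalf ip domA A v ->
         c0 * (`|u| ^+ 2 + `|v| ^+ 2) <=
         ip (D u) u + ip (D v) v + alphabar * ip (K (u - v)) (u - v))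
    (* (2) *)
    (h2 : exists eta delta C : R, [/\ eta < 1, 0 < delta, 0 < C &
       forall u v, Hhalf ip domA A u -> Hhalf ip domA A v ->
         delta * (Pi0 u + Pi0 v) - ip (B u) u - ip (B v) v <=
         eta * nu * (hnorm ip domA A 2^-1 u ^+ 2 +
                     hnorm ip domA A 2^-1 v ^+ 2) + C])
    (* (3) *)
    (h3 : (exists2 delta : R, 0 < delta &
             lipschitz_on_balls ip domA A (2^-1 - delta) B)
          \/
          ((exists2 delta : R, 0 < delta &
              functional_continuous ip domA A (2^-1 - delta) Pi) /\
           (exists delta l : R, [/\ 0 < delta, 0 < l &
              map_continuous ip domA A (2^-1 - delta) (- l)
                (fun u => frac_pow ip domA A (- l) (B u))])))
    (* (4) *)
    (h4 : (exists P : H -> seq H -> R,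
             frechet_Ck ip domA A 3 Pi P /\
             exists2 sigma : R, sigma < 2^-1 &
             forall rho : R, 0 < rho -> exists2 C : R, 0 < C &
             forall u, Hhalf ip domA A u -> hnorm ip domA A 2^-1 u <= rho ->
               (forall v, Hhalf ip domA A v ->
                  `|P u [:: v; v]| <= C * hnorm ip domA A sigma v ^+ 2) /\
               (forall v1 v2 v3, Hhalf ip domA A v1 -> Hhalf ip domA A v2 ->
                  Hhalf ip domA A v3 ->
                  `|P u [:: v1; v2; v3]| <=
                    C * hnorm ip domA A 2^-1 v1 * hnorm ip domA A 2^-1 v2 * `|v3|))
          \/
          (exists2 sigma0 : R, sigma0 < 2^-1 &
             lipschitz_on_balls ip domA A sigma0 B))
    (alphastar : R) :
  exists sstar omega : R, 0 < omega /\
    forall alpha kappa : R,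
      alphabar <= alpha <= alphastar -> 0 <= kappa ->
      sstar <= form_bottom ip domA A nu K kappa ->
      (forall U Ut : R -> H * H,
         coupled_solution ip domA A nu K D B alpha kappa U Ut ->
         expR (omega * t) *
           (`|(Ut t).1 - (Ut t).2| ^+ 2 +
            hnorm ip domA A 2^-1 ((U t).1 - (U t).2) ^+ 2)
         @[t --> +oo] --> (0 : R))
      /\
      (forall (S : R -> (H * H) * (H * H) -> (H * H) * (H * H))
              (Ssingle : R -> H * H -> H * H)
              (Att : set ((H * H) * (H * H))) (Attsingle : set (H * H)),
         coupled_flow ip domA A nu K D B alpha kappa S ->
         single_flow ip domA A nu D B Ssingle ->
         global_attractor (coupled_phase ip domA A) (coupled_dist ip domA A) S Att ->
         global_attractor (single_phase ip domA A) (single_dist ip domA A)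
           Ssingle Attsingle ->
         Att = diagonal_set Attsingle).
Proof.
have bK : vbounded ip domA A K.
  split; last exact: (symmetric_bounded hip hAsa hApos hAcomp hKdom hKlin hKsym).
  by move=> a x y Vx Vy; apply: hKlin; apply: (proj2 hKdom).
have sK : symmetric_on ip (Hhalf ip domA A) K.
  by move=> x y Vx Vy; apply: hKsym; apply: (proj2 hKdom).
have [a a0 hKa] := hKpos.
have pK u : Hhalf ip domA A u -> a * `|u| ^+ 2 <= ip (K u) u.
  by move=> Vu; apply: hKa; apply: (proj2 hKdom).
have pK0 u : Hhalf ip domA A u -> 0 <= ip (K u) u.
  by move=> Vu; apply: le_trans (pK u Vu); rewrite mulr_ge0 ?sqr_ge0 // ltW.
have bD : vbounded ip domA A D.
  split; first exact: hDlin.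
  have [C hC] := hDbd; exists (`|C| + 1) => [|u Vu]; first by rewrite ltr_wpDl.
  apply: le_trans (hC u Vu) _; rewrite ler_wpM2r ?normr_ge0 //.
  by apply: le_trans (ler_norm _) _; rewrite lerDl.
have [c0 c00 hc0] := h1.
(* The two alternatives of (4) meet here; only the correction [Q] and the constant [C1] distinguish
   them from now on. *)
have coupling r : 0 < r -> exists C1 Q, 0 <= C1 /\ coupling_functional ip domA A B c0 r C1 Q.
  move=> r0; case: h4 => [[P [hP [sigma _ hs]]]|[sigma s2 hs]].
    have [C C0 hC] := hs r r0.
    exists (C / 2), (fun u v => 2^-1 * ip (B u - B v) (u - v)); split; first by rewrite divr_ge0 // ltW.
    apply: (coupling_functional_C3 hip hAsa hApos hAcomp hBlip hPiB c00 r0 C0 hP) => u Vu ur.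
    by have [_] := hC u Vu ur.
  exists 0, (fun _ _ => 0); split => //.
  exact: (coupling_functional_subcritical hip hAsa hApos hAcomp hBlip c00 r0 s2 hs).
have [sstar [omega [omega0 hsync]]] := uniform_synchronization hip hAsa hApos hAcomp hnu bK sK bD hDsym hBlip hPiB
  alphastar a0 pK hDpos halphabar c00 hc0 hPi hPi0 hPi0b hPi1 h2 coupling.
exists sstar, omega; split => // alpha kappa al ka hs; have hM := hsync alpha kappa al ka hs.
split=> [U Ut sU|S Ss Att As flowS flowSs attS attSs].
  exact: synchronization_limit omega0 hM U Ut sU.
have K0 : K 0 = 0 by rewrite -(subrr 0) (vboundedB bK) ?subrr //; exact: V0.
have huniq U Ut U' Ut' : coupled_solution ip domA A nu K D B alpha kappa U Ut ->
    coupled_solution ip domA A nu K D B alpha kappa U' Ut' -> U 0 = U' 0 -> Ut 0 = Ut' 0 ->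
    forall t, 0 <= t -> U t = U' t /\ Ut t = Ut' t.
  move=> sU sU' e0 e1.
  (* Equal initial data put both solutions in one ball for all times, where a single Lipschitz
     constant of [B] serves. *)
  have [M [m1 m2 m3 m4]] := common_bound `|frac_pow ip domA A 2^-1 (U 0).1| `|frac_pow ip domA A 2^-1 (U 0).2|
    `|(Ut 0).1| `|(Ut 0).2|.
  have [rho [T [N hN]]] := hM M.
  have [ball _] := hN U Ut sU m1 m2 m3 m4.
  have := hN U' Ut' sU'; rewrite -e0 -e1 => /(_ m1 m2 m3 m4)[ball' _].
  have r1 : 0 < `|rho| + 1 by rewrite ltr_wpDl.
  have [L hL] := hBlip (`|rho| + 1) r1.
  have rr : rho + 1 <= `|rho| + 1 by rewrite lerD2r ler_norm.
  have hL' u v : Hhalf ip domA A u -> Hhalf ip domA A v -> `|frac_pow ip domA A 2^-1 u| <= rho + 1 ->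
      `|frac_pow ip domA A 2^-1 v| <= rho + 1 -> `|B u - B v| <= `|L| * `|frac_pow ip domA A 2^-1 (u - v)|.
    move=> Vu Vv bu bv; apply: le_trans (hL u v Vu Vv (le_trans bu rr) (le_trans bv rr)) _.
    by rewrite ler_wpM2r ?normr_ge0 // ler_norm.
  have al0 : 0 <= alpha by case/andP: al => + _; exact: le_trans.
  exact: (solution_uniqueness hip hAsa hApos hAcomp hnu bK sK bD hBlip pK0 hDpos al0 ka (normr_ge0 L) hL' sU sU' e0 e1 ball ball').
exact: (attractor_diagonal hip hAsa hApos hAcomp K0 omega0 hM huniq flowS flowSs attS attSs).
Qed.
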